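(* Let $\mathbf G$ be a Lie group acting analytically and effectively on a manifold $\mathbf X$. If the action is locally proper with finite stabilizers, then the quotient $\mathbf X/\mathbf G$ is an orbifold.
   Context: Let $\mathbb F=\mathbb R$ or $\mathbb C$. $\mathbf X$ is a real analytic (resp. complex) manifold, $\mathbf G$ a real (resp. complex) Lie group, and $\mathbf G\times\mathbf X\to\mathbf X$ a real analytic (resp. holomorphic) effective left action. $\mathbf X/\mathbf G$ has the quotient topology. The action is locally proper at $\mathbf x$ if it is proper throughout some $\mathbf G$-invariant open neighborhood of $\mathbf x$; it is locally proper if this is so at every point. Here an action on a locally compact space is proper if for every pair of points $\mathbf x,\mathbf x'$ there exist neighborhoods $U$ of $\mathbf x$ and $U'$ of $\mathbf x'$ such that the set of all $g\in\mathbf G$ with $g(U)\cap U'\ne\emptyset$ has compact closure in $\mathbf G$. A $d$-dimensional $\mathbb F$-orbifold chart around a point $\mathbf y$ of a topological space $\mathbf Y$ consists of a finite group $\mathcal R\subset\mathrm{GL}_d(\mathbb F)$, an $\mathcal R$-invariant open neighborhood $W$ of $\mathbf 0\in\mathbb F^d$, and a homeomorphism from $W/\mathcal R$ onto an open neighborhood $U$ of $\mathbf y$ taking the class of $\mathbf 0$ to $\mathbf y$. Given a point $\mathbf z\in U$ and $w_0\in W$ over $\mathbf z$, with stabilizer $\mathcal R_{w_0}$, a restriction of the chart to a small neighborhood of $\mathbf z$ is the projection $W'/\mathcal R_{w_0}\to U$ where $W'$ is an $\mathcal R_{w_0}$-invariant neighborhood of $w_0$, so small that its distinct images under $\mathcal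 R$ are disjoint. An orbifold atlas on $\mathbf Y$ is a collection of orbifold charts $W_j/\mathcal R_j\cong U_j$ with the $U_j$ covering $\mathbf Y$, such that for each $\mathbf y\in U_i\cap U_j$ and each sufficiently small neighborhood $U'$ of $\mathbf y$, the two restrictions $W_i'/\mathcal R_{i,w_i}\cong U'$ and $W_j'/\mathcal R_{j,w_j}\cong U'$ are isomorphic: there are a group isomorphism $\phi:\mathcal R_{i,w_i}\to\mathcal R_{j,w_j}$ and an analytic isomorphism $\psi:W_i'\to W_j'$ with $\psi\circ g=\phi(g)\circ\psi$ for every $g\in\mathcal R_{i,w_i}$. Two atlases are equivalent if their union is an atlas. An orbifold is a space with an equivalence class of orbifold atlases. (Orbifolds are not required to be Hausdorff, only locally Hausdorff.) *)

(* Defs.v *)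
From HB Require Import structures.
From mathcomp Require Import all_boot all_order all_algebra.
From mathcomp Require Import all_classical all_reals all_analysis.
From mathcomp Require Import complex.

Set Implicit Arguments.
Unset Strict Implicit.
Unset Printing Implicit Defensive.

Import Order.TTheory GRing.Theory Num.Theory.
Import numFieldNormedType.Exports.

Local Open Scope classical_set_scope.
Local Open Scope ring_scope.

Variant ground := RealGround | ComplexGround.

Definition ground_field (R : realType) (k : ground) : numFieldType :=
  match k with
  | RealGround => R : numFieldType
  | ComplexGround => R[i] : numFieldType
  end.

Section Analytic.
Variable K : numFieldType.

(* Multi-indices with all entries < N; the degree in each variable, rather     *)
(* than the total degree, is truncated, which does not matter for absolutely   *)
(* convergent series.                                                          *)
Definition power_sum n (c : {ffun 'I_n -> nat} -> K) (h : 'cV[K]_n) (N : nat) : K :=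
  \sum_(e : {ffun 'I_n -> 'I_N})
     c [ffun i => e i : nat] * \prod_(i < n) h i 0 ^+ e i.

(* f is the sum of an absolutely convergent power series centered at a on the  *)
(* polydisc of radius r around a. Over the complex numbers this is holomorphy. *)
Definition scalar_analytic_at n (f : 'cV[K]_n -> K) (a : 'cV[K]_n) : Prop :=
  exists (c : {ffun 'I_n -> nat} -> K) (r : K),
    [/\ 0 < r,
        exists M : K, forall N,
          power_sum (fun e => `|c e|) (const_mx r) N <= M &
        forall x : 'cV[K]_n, (forall i, `|x i 0 - a i 0| < r) ->
          power_sum c (x - a) @ \oo --> f x].

Definition analytic_at n m (f : 'cV[K]_n -> 'cV[K]_m) (a : 'cV[K]_n) : Prop :=
  forall j, scalar_analytic_at (fun x => f x j 0) a.

Definition analytic_on n m (D : set 'cV[K]_n) (f : 'cV[K]_n -> 'cV[K]_m) : Prop :=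
  forall a, D a -> analytic_at f a.

End Analytic.

Section Manifolds.
Variable K : numFieldType.

(* chart_map and chart_inv are only meaningful on chart_dom and chart_cod.     *)
Record chart (n : nat) (X : Type) := Chart {
  chart_dom : set X;
  chart_cod : set 'cV[K]_n;
  chart_map : X -> 'cV[K]_n;
  chart_inv : 'cV[K]_n -> X }.

Definition is_chart n (X : topologicalType) (c : chart n X) : Prop :=
  [/\ open (chart_dom c) /\ open (chart_cod c),
      forall x, chart_dom c x ->
        chart_cod c (chart_map c x) /\ chart_inv c (chart_map c x) = x,
      forall v, chart_cod c v ->
        chart_dom c (chart_inv c v) /\ chart_map c (chart_inv c v) = v,
      {within chart_dom c, continuous (chart_map c)} &
      {within chart_cod c, continuous (chart_inv c)}].

Definition is_manifold n (X : topologicalType) (A : set (chart n X)) : Prop :=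
  [/\ hausdorff_space X,
      @second_countable X,
      forall c, A c -> is_chart c,
      forall x, exists2 c, A c & chart_dom c x &
      forall c c', A c -> A c' ->
        analytic_on (chart_map c @` (chart_dom c `&` chart_dom c'))
          (chart_map c' \o chart_inv c)].

Definition analytic_map n m (X Y : topologicalType)
    (A : set (chart n X)) (B : set (chart m Y)) (f : X -> Y) : Prop :=
  continuous f /\
  forall c c' x, A c -> B c' -> chart_dom c x -> chart_dom c' (f x) ->
    analytic_at (chart_map c' \o f \o chart_inv c) (chart_map c x).

Definition prod_chart n m (X Y : Type) (c : chart n X) (c' : chart m Y) :
    chart (n + m) (X * Y) :=
  Chart (chart_dom c `*` chart_dom c')
        [set v | chart_cod c (usubmx v) /\ chart_cod c' (dsubmx v)]
        (fun p => col_mx (chart_map c p.1) (chart_map c' p.2))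
        (fun v => (chart_inv c (usubmx v), chart_inv c' (dsubmx v))).

Definition prod_atlas n m (X Y : Type) (A : set (chart n X)) (B : set (chart m Y)) :
    set (chart (n + m) (X * Y)) :=
  [set d | exists c c', [/\ A c, B c' & d = prod_chart c c']].

End Manifolds.

(* A group carrying a topology, without any compatibility between the two.     *)
HB.structure Definition GroupWithTopology := {G of Group G & Topological G}.

Definition is_lie_group (K : numFieldType) m (G : GroupWithTopology.type)
    (A : set (chart K m G)) : Prop :=
  [/\ is_manifold A,
      analytic_map (prod_atlas A A) A (fun p : G * G => (p.1 * p.2)%g) &
      analytic_map A A (fun g : G => (g^-1)%g)].

Record left_action (G : groupType) (X : Type) := LeftAction {
  act :> G -> X -> X;
  act1 : forall x, act 1%g x = x;
  actM : forall g h x, act (g * h)%g x = act g (act h x) }.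

Section OrbitSpace.
Variables (G : groupType) (X : topologicalType) (a : left_action G X).

Definition same_orbit : rel X := fun x y => `[< exists g, a g x = y >].

Lemma same_orbit_refl : reflexive same_orbit.
Proof. by move=> x; apply/asboolP; exists 1%g; rewrite act1. Qed.

Lemma same_orbit_sym : symmetric same_orbit.
Proof.
have H x y : same_orbit x y -> same_orbit y x.
  move=> /asboolP[g <-]; apply/asboolP; exists (g^-1)%g.
  by rewrite -actM mulVg act1.
by move=> x y; apply/idP/idP; exact: H.
Qed.

Lemma same_orbit_trans : transitive same_orbit.
Proof.
move=> y x z /asboolP[g <-] /asboolP[h <-]; apply/asboolP.
by exists (h * g)%g; rewrite actM.
Qed.

Canonical same_orbit_equiv :=
  EquivRel same_orbit same_orbit_refl same_orbit_sym same_orbit_trans.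

Definition orbit_space : topologicalType :=
  quotient_topology {eq_quot same_orbit}%qT.

Definition effective : Prop := forall g, (forall x, a g x = x) -> g = 1%g.

Definition finite_stabilizers : Prop := forall x, finite_set [set g | a g x = x].

End OrbitSpace.

Section Proper.
Variables (G : GroupWithTopology.type) (X : topologicalType) (a : left_action G X).

Definition proper_on (V : set X) : Prop :=
  forall x x', V x -> V x' -> exists U U',
    [/\ nbhs x U /\ U `<=` V, nbhs x' U' /\ U' `<=` V &
        compact (closure [set g | (a g @` U) `&` U' !=set0])].

Definition locally_proper_at (x : X) : Prop :=
  exists V, [/\ open V, V x, (forall g y, V y -> V (a g y)) & proper_on V].

Definition locally_proper : Prop := forall x, locally_proper_at x.

End Proper.

Definition analytic_action (K : numFieldType) m n
    (G : GroupWithTopology.type) (X : topologicalType)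
    (AG : set (chart K m G)) (AX : set (chart K n X)) (a : left_action G X) : Prop :=
  analytic_map (prod_atlas AG AX) AX (fun p : G * X => a p.1 p.2).

Section Orbifolds.
Variables (K : numFieldType) (d : nat).

Definition finite_subgroup_GL (H : set 'M[K]_d) : Prop :=
  [/\ finite_set H,
      H `<=` [set g | g \in unitmx],
      H 1%:M,
      forall g h, H g -> H h -> H (g *m h) &
      forall g, H g -> H (invmx g)].

Variable Y : topologicalType.

(* orb_proj is the composite of the projection of W onto W/R with the          *)
(* homeomorphism of W/R onto U, where R = orb_group, W = orb_dom and           *)
(* U = orb_proj @` W; it is only meaningful on W. The chart is around          *)
(* the point orb_proj 0.                                                       *)
Record orb_chart := OrbChart {
  orb_group : set 'M[K]_d;
  orb_dom : set 'cV[K]_d;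
  orb_proj : 'cV[K]_d -> Y }.

(* The last two clauses say that the map from W/R to U induced by orb_proj is  *)
(* well defined and injective, and that it is a homeomorphism for the quotient *)
(* topology on W/R.                                                            *)
Definition is_orb_chart (c : orb_chart) : Prop :=
  let W := orb_dom c in let p := orb_proj c in
  [/\ finite_subgroup_GL (orb_group c),
      [/\ open W, W 0 & forall g w, orb_group c g -> W w -> W (g *m w)],
      open (p @` W),
      (forall w w', W w -> W w' ->
         (p w = p w' <-> exists2 g, orb_group c g & g *m w = w')) &
      (forall B, B `<=` p @` W -> (open B <-> open (W `&` p @^-1` B)))].

Definition orb_stab (c : orb_chart) (w0 : 'cV[K]_d) : set 'M[K]_d :=
  [set g | orb_group c g /\ g *m w0 = w0].

(* The images of W' under R are indexed by the cosets of the stabilizer of w0, *)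
(* so W' is disjoint from g W' as soon as g does not fix w0; this is what      *)
(* makes W' modulo the stabilizer homeomorphic to U'.                          *)
Definition is_restriction (c : orb_chart) (w0 : 'cV[K]_d)
    (W' : set 'cV[K]_d) (U' : set Y) : Prop :=
  [/\ open W' /\ W' w0,
      W' `<=` orb_dom c,
      forall g w, orb_stab c w0 g -> W' w -> W' (g *m w),
      forall g, orb_group c g -> ~ orb_stab c w0 g ->
        ((fun w => g *m w) @` W') `&` W' = set0 &
      orb_proj c @` W' = U'].

(* Isomorphism of two charts onto the same U', hence compatible with the       *)
(* projections to U'.                                                          *)
Definition restrictions_isomorphic (c1 c2 : orb_chart) (w1 w2 : 'cV[K]_d)
    (W1 W2 : set 'cV[K]_d) : Prop :=
  exists (phi : 'M[K]_d -> 'M[K]_d) (psi psi' : 'cV[K]_d -> 'cV[K]_d),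
    [/\ set_bij (orb_stab c1 w1) (orb_stab c2 w2) phi /\
        (forall g h, orb_stab c1 w1 g -> orb_stab c1 w1 h ->
           phi (g *m h) = phi g *m phi h),
        (forall w, W1 w -> W2 (psi w) /\ psi' (psi w) = w) /\
        (forall w, W2 w -> W1 (psi' w) /\ psi (psi' w) = w),
        analytic_on W1 psi /\ analytic_on W2 psi',
        (forall g w, orb_stab c1 w1 g -> W1 w -> psi (g *m w) = phi g *m psi w) &
        (forall w, W1 w -> orb_proj c2 (psi w) = orb_proj c1 w)].

Definition orb_compatible (c1 c2 : orb_chart) : Prop :=
  forall w1 w2, orb_dom c1 w1 -> orb_dom c2 w2 -> orb_proj c1 w1 = orb_proj c2 w2 ->
    exists2 N, nbhs (orb_proj c1 w1) N &
      forall U', open U' -> U' (orb_proj c1 w1) -> U' `<=` N ->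
        exists W1 W2,
          [/\ is_restriction c1 w1 W1 U', is_restriction c2 w2 W2 U' &
              restrictions_isomorphic c1 c2 w1 w2 W1 W2].

Definition is_orb_atlas (A : set orb_chart) : Prop :=
  [/\ forall c, A c -> is_orb_chart c,
      forall y, exists2 c, A c & (orb_proj c @` orb_dom c) y &
      forall c1 c2, A c1 -> A c2 -> orb_compatible c1 c2].

Definition orb_atlas_equiv (A B : set orb_chart) : Prop := is_orb_atlas (A `|` B).

Definition is_orb_structure (S : set (set orb_chart)) : Prop :=
  exists2 A, is_orb_atlas A &
    S = [set B | is_orb_atlas B /\ orb_atlas_equiv A B].

End Orbifolds.

Definition is_orbifold (K : numFieldType) (Y : topologicalType) : Prop :=
  exists (d : nat) (S : set (set (orb_chart K d Y))), is_orb_structure S.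

(* Main.v *)
Require Import Defs.
From HB Require Import structures.
From mathcomp Require Import all_boot all_order all_algebra.
From mathcomp Require Import all_classical all_reals all_analysis.
From mathcomp Require Import finmap complex ring lra.

Set Implicit Arguments.
Unset Strict Implicit.
Unset Printing Implicit Defensive.
Import Order.TTheory GRing.Theory Num.Theory.
Import numFieldNormedType.Exports.
Local Open Scope classical_set_scope.
Local Open Scope ring_scope.

(** Write G_x for the stabilizer of x.  Near the orbit of x the action is shown
    to look like the action of G on the quotient of G x W by G_x, where W is an
    open subset of a linear representation of the finite group G_x.  Then W
    modulo G_x is a chart of X / G around the orbit of x.  The group of the
    chart is the image of G_x in GL_d, where d is the difference of the
    dimensions of X and G: an element of G_x may act trivially on W.

    A slice (the record [slice]) is such a local model: a section w |-> sec(w)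
    over W, equivariant under G_x and transverse to the orbits, such that
    (k, w) |-> k sec(w) is an analytic isomorphism from a neighbourhood of
    {1} x W onto an open set, and such that two points of the section in one
    orbit differ by an element of G_x.  It is built from three facts.

    - The orbit map g |-> g x is an immersion at 1
      ([orbit_jacobian_injective]).  By equivariance its rank is constant, so if
      it were smaller than dim G then the fibre through 1 would contain a
      submanifold of positive dimension; but this fibre is G_x, which is finite.

    - In suitable coordinates G_x acts linearly ([linearizing_coordinates],
      by averaging a chart), and the tangent space of the orbit has an invariant
      complement ([equivariant_complement], by averaging a projection).  The
      complement is the section, and the inverse function theorem makes
      (k, w) |-> k sec(w) a local isomorphism ([local_tube]).

    - Properness confines the elements that move a small neighbourhood of x to
      meet itself to a small neighbourhood of G_x ([proper_shift]), where the
      local isomorphism controls them.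

    For the compatibility of two charts, take g mapping a point of one section
    to a point of the other.  Nearby points of g sec_1(w) are pushed along their
    orbits into the second section; this map is analytic, has an inverse of the
    same kind, and is equivariant ([good_transition_near]).  It intertwines the
    isotropy groups, so the isomorphism between them is conjugation by its
    derivative ([transition_conj_stab]).

    The analysis is done at once for the real and the complex numbers, over an
    archimedean normed field K in which families with bounded finite sums of
    norms have a sum.  The statement [power_series r f M] says that
    f has norm at most M in the Banach algebra of power series that converge
    absolutely on the closed polydisc of radius r.  By Fubini this relation is
    stable under sums of families ([power_series_sum]); products, compositions
    and changes of centre follow, and the inverse function theorem
    ([inverse_function]) is a fixed point iteration in the Banach algebra. *)

(** * Unordered sums *)

Section Sums.
Local Open Scope fset_scope.
Local Open Scope ring_scope.
Variable K : numFieldType.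

(** Finite sums are compared with a bound instead of taking a supremum, so that
    the same definition serves an ordered and a partially ordered field. *)
Definition abs_bound (I : choiceType) (f : I -> K) (M : K) : Prop :=
  forall s : {fset I}, \sum_(i <- s) `|f i| <= M.

Definition has_sum (I : choiceType) (f : I -> K) (S : K) : Prop :=
  forall e, 0 < e -> exists s0 : {fset I}, forall s : {fset I},
    s0 `<=` s -> `|\sum_(i <- s) f i - S| <= e.

Lemma normr_le_eps_eq0 (x : K) : (forall e, 0 < e -> `|x| <= e) -> x = 0.
Proof.
move=> H; apply/eqP; apply: contraT => x0.
have /H : 0 < `|x| / 2 by rewrite divr_gt0 ?normr_gt0.
rewrite ler_pdivlMr // mulr_natr mulr2n gerDl => h.
by move: x0; rewrite -normr_gt0 => /lt_le_trans /(_ h); rewrite ltxx.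
Qed.

Variable I : choiceType.
Implicit Types (f g : I -> K) (s : {fset I}).

Lemma ler_sum_fsubset s t f : (forall i, 0 <= f i) -> s `<=` t ->
  \sum_(i <- s) f i <= \sum_(i <- t) f i.
Proof.
move=> f0 st; rewrite [leRHS](big_fsetID _ (mem s)) /=.
rewrite (_ : [fset x in _ | x \in s] = s); first by rewrite lerDl sumr_ge0.
apply/fsetP => x; rewrite !inE /= andbC; case: (boolP (x \in s)) => //= xs.
exact: (fsubsetP st).
Qed.

Lemma has_sum_unique f S T : has_sum f S -> has_sum f T -> S = T.
Proof.
move=> HS HT; apply/eqP; rewrite -subr_eq0; apply/eqP; apply: normr_le_eps_eq0 => e e0.
have e20 : 0 < e / 2 by rewrite divr_gt0.
have [s Hs] := HS _ e20; have [t Ht] := HT _ e20.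
have {}Hs := Hs _ (fsubsetUl s t); have {}Ht := Ht _ (fsubsetUr s t).
set u := \sum_(i <- _) _ in Hs Ht.
have -> : S - T = (u - T) - (u - S) by ring.
by rewrite (le_trans (ler_normB _ _)) // (splitr e) lerD.
Qed.

Lemma has_sum_ext f g S : f =1 g -> has_sum f S -> has_sum g S.
Proof. by move=> /funext ->. Qed.

Lemma abs_bound_ext f g M : f =1 g -> abs_bound f M -> abs_bound g M.
Proof. by move=> /funext ->. Qed.

Lemma abs_bound_ge0 f M : abs_bound f M -> 0 <= M.
Proof. by move=> /(_ fset0); rewrite big_seq_fset0. Qed.

Lemma abs_bound_le f M M' : M <= M' -> abs_bound f M -> abs_bound f M'.
Proof. by move=> h H s; apply: le_trans h. Qed.

Lemma abs_bound_sub f g M : (forall i, `|f i| <= `|g i|) ->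
  abs_bound g M -> abs_bound f M.
Proof. by move=> h H s; apply: le_trans (H s); apply: ler_sum. Qed.

Lemma abs_boundD f g M N : abs_bound f M -> abs_bound g N ->
  abs_bound (fun i => f i + g i) (M + N).
Proof.
move=> Hf Hg s; apply: le_trans (lerD (Hf s) (Hg s)).
by rewrite -big_split; apply: ler_sum => i _; exact: ler_normD.
Qed.

Lemma abs_boundZ c f M : abs_bound f M -> abs_bound (fun i => c * f i) (`|c| * M).
Proof.
move=> Hf s; under eq_bigr do rewrite normrM.
by rewrite -mulr_sumr ler_wpM2l.
Qed.

(** The order of K may be partial; M and the norm of S are comparable because
    both are real. *)
Lemma has_sum_le f S M : abs_bound f M -> has_sum f S -> `|S| <= M.
Proof.
move=> HM HS.
have M0 := abs_bound_ge0 HM.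
have H e : 0 < e -> `|S| <= M + e.
  move=> e0; have [s /(_ _ (fsubset_refl s)) Hs] := HS _ e0.
  set u := \sum_(i <- _) _ in Hs.
  rewrite -(subrK u S) (le_trans (ler_normD _ _)) // addrC lerD //; last by rewrite distrC.
  by rewrite (le_trans (ler_norm_sum _ _ _)).
have cmp : M \is Num.real by exact: ger0_real.
case: (real_leP (normr_real S) cmp) => // lt.
have /H : 0 < (`|S| - M) / 2 by rewrite divr_gt0 // subr_gt0.
rewrite -lerBlDl ler_pdivlMr // mulr_natr mulr2n gerDl => h.
by move: lt; rewrite -subr_gt0 => /lt_le_trans /(_ h); rewrite ltxx.
Qed.

Lemma has_sumD f g S T : has_sum f S -> has_sum g T ->
  has_sum (fun i => f i + g i) (S + T).
Proof.
move=> HS HT e e0; have e20 : 0 < e / 2 by rewrite divr_gt0.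
have [s Hs] := HS _ e20; have [t Ht] := HT _ e20.
exists (s `|` t) => u; rewrite fsubUset => /andP[su tu].
rewrite big_split opprD addrACA (le_trans (ler_normD _ _)) //.
by rewrite (splitr e) lerD ?Hs ?Ht.
Qed.

Lemma has_sumZ c f S : has_sum f S -> has_sum (fun i => c * f i) (c * S).
Proof.
move=> HS e e0; have c0 : 0 < `|c| + 1 by rewrite ltr_wpDl.
have [s Hs] := HS _ (divr_gt0 e0 c0); exists s => t /Hs h.
rewrite -mulr_sumr -mulrBr normrM -[e](divfK (lt0r_neq0 c0)) mulrC.
by apply: ler_pM => //; rewrite lerDl.
Qed.

Lemma has_sum0 : has_sum (fun _ : I => 0) 0.
Proof. by move=> e e0; exists fset0 => s _; rewrite big1 // subr0 normr0 ltW. Qed.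

Lemma has_sum_finsupp f s : (forall i, i \notin s -> f i = 0) ->
  has_sum f (\sum_(i <- s) f i).
Proof.
move=> H e e0; exists s => t st.
rewrite (big_fset_incl _ st) => [|i _ /H ->//].
by rewrite subrr normr0 ltW.
Qed.

Lemma has_sum_single f i0 : (forall i, i != i0 -> f i = 0) -> has_sum f (f i0).
Proof.
move=> H; have <- : \sum_(i <- [fset i0]) f i = f i0 by rewrite big_seq_fset1.
by apply: has_sum_finsupp => i; rewrite inE => /H.
Qed.

Lemma abs_bound_single f i0 M : (forall i, i != i0 -> f i = 0) ->
  `|f i0| <= M -> abs_bound f M.
Proof.
move=> H HM s; have [i0s|i0s] := boolP (i0 \in s).
  rewrite (big_fsetD1 i0) //= big1_fset ?addr0// => i.
  by rewrite !inE => /andP[/H -> _]; rewrite normr0.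
rewrite big1_fset ?(le_trans _ HM)// => i is_ _; rewrite H ?normr0 //.
by apply: contraNneq i0s => <-.
Qed.

End Sums.

Section Reindex.
Local Open Scope fset_scope.
Local Open Scope ring_scope.
Variables (K : numFieldType) (I J : choiceType) (h : I -> J) (h' : J -> I).
Hypotheses (hK : cancel h h') (h'K : cancel h' h).
Implicit Types (f : J -> K).

Lemma abs_bound_reindex f M : abs_bound f M -> abs_bound (f \o h) M.
Proof.
move=> H s; have := H (h @` s); rewrite big_imfset //=.
by move=> x y _ _; exact: (can_inj hK).
Qed.

Lemma has_sum_reindex f S : has_sum f S -> has_sum (f \o h) S.
Proof.
move=> H e /H[s0 Hs]; exists (h' @` s0) => s ss.
have := Hs (h @` s); rewrite big_imfset /=; last by move=> x y _ _; exact: (can_inj hK).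
apply; apply/fsubsetP => j js; rewrite -(h'K j) in_imfset //=.
by apply: (fsubsetP ss); rewrite in_imfset.
Qed.
End Reindex.

Section Fubini.
Local Open Scope fset_scope.
Local Open Scope ring_scope.
Variables (K : numFieldType) (I J : choiceType).
Implicit Types (f : I * J -> K).

Lemma abs_bound_row f M i : abs_bound f M -> abs_bound (fun j => f (i, j)) M.
Proof.
move=> H s; have := H ((fun j => (i, j)) @` s); rewrite big_imfset //=.
by move=> x y _ _ [].
Qed.

Lemma abs_bound_pair f (B : I -> K) M :
  (forall i, abs_bound (fun j => f (i, j)) (B i)) -> abs_bound B M ->
  abs_bound f M.
Proof.
move=> HB HM s; set t := [fset x.1 | x in s]; set u := [fset x.2 | x in s].
have su : s `<=` [fset (i, j) | i : I in t, j : J in u].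
  apply/fsubsetP => -[i j] ijs; apply/imfset2P => /=.
  exists i; first by apply/imfsetP; exists (i, j).
  by exists j => //; apply/imfsetP; exists (i, j).
apply: (@le_trans _ _ (\sum_(x <- [fset (i, j) | i : I in t, j : J in u]) `|f x|)).
  by apply: ler_sum_fsubset.
rewrite big_imfset2 /=; last by move=> [i j] [i' j'] _ _ /= [-> ->].
rewrite (le_trans _ (HM t)) // ler_sum // => i _.
by rewrite (le_trans (HB i u)) // real_ler_norm // ger0_real // (abs_bound_ge0 (HB i)).
Qed.

Lemma has_sum_sum (T : Type) (t : seq T) (g : T -> J -> K) (S : T -> K) :
  (forall i, has_sum (g i) (S i)) ->
  has_sum (fun j => \sum_(i <- t) g i j) (\sum_(i <- t) S i).
Proof.
move=> H; elim: t => [|x l IH].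
  by rewrite big_nil; apply: has_sum_ext (@has_sum0 _ _) => j; rewrite big_nil.
rewrite big_cons; apply: has_sum_ext (has_sumD (H x) IH) => j.
by rewrite big_cons.
Qed.

(** The norms of finitely many row sums are added by choosing phases sg i that
    turn each F i into its norm; the bound then follows from that of a
    single sum over the columns. *)
Lemma fubini_bound f (F : I -> K) M : abs_bound f M ->
  (forall i, has_sum (fun j => f (i, j)) (F i)) -> abs_bound F M.
Proof.
move=> HM HF t; pose sg i := if F i == 0 then 0 else `|F i| / F i.
have sgE i : `|F i| = sg i * F i.
  by rewrite /sg; case: eqP => [->|/eqP ?]; rewrite ?normr0 ?mul0r // divfK.
have sg1 i : `|sg i| <= 1.
  rewrite /sg; case: eqP => [_|/eqP F0]; first by rewrite normr0.
  by rewrite normrM normfV normr_id divff // normr_eq0.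
rewrite (eq_bigr _ (fun i _ => sgE i)).
have := has_sum_sum t (fun i => has_sumZ (sg i) (HF i)) => hs.
have b : abs_bound (fun j => \sum_(i <- t) sg i * f (i, j)) M.
  move=> u; have := HM [fset (i, j) | i : I in t, j : J in u].
  rewrite big_imfset2 /=; last by move=> [i j] [i' j'] _ _ /= [-> ->].
  apply: le_trans; rewrite [leRHS]exchange_big /=; apply: ler_sum => j _.
  rewrite (le_trans (ler_norm_sum _ _ _)) // ler_sum // => i _.
  by rewrite normrM ler_piMl.
have := has_sum_le b hs; rewrite ger0_norm //.
by apply: sumr_ge0 => i _; rewrite -sgE.
Qed.

(** Given e, choose a finite set s that approximates S; each finite set of rows
    containing the first coordinates of s, cut at finitely many columns that
    contain the second coordinates, still contains s. *)
Lemma fubini f (F : I -> K) M S : abs_bound f M ->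
  (forall i, has_sum (fun j => f (i, j)) (F i)) -> has_sum f S -> has_sum F S.
Proof.
move=> HM HF HS e e0; have e20 : 0 < e / 2 by rewrite divr_gt0.
have [s Hs] := HS _ e20.
exists [fset x.1 | x in s] => t ts.
have [u Hu] := has_sum_sum t HF e20.
pose v := u `|` [fset x.2 | x in s].
have := Hu v (fsubsetUl _ _); have := Hs [fset (i, j) | i : I in t, j : J in v].
rewrite big_imfset2 /=; last by move=> [i j] [i' j'] _ _ /= [-> ->].
rewrite exchange_big /= => h1 h2.
have {}h1 : `|\sum_(i <- v) \sum_(j <- t) f (j, i) - S| <= e / 2.
  apply: h1; apply/fsubsetP => -[i j] ijs; apply/imfset2P => /=.
  exists i; first by apply: (fsubsetP ts); apply/imfsetP; exists (i, j).
  exists j => //; rewrite /v inE; apply/orP; right.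
  by apply/imfsetP; exists (i, j).
set w := \sum_(i <- v) _ in h1 h2.
rewrite (splitr e) -(subrK w (\sum_(i <- t) F i)) -addrA.
by rewrite (le_trans (ler_normD _ _)) // lerD // distrC.
Qed.

End Fubini.

(** * Real and complex summation *)

(** Completeness in the only form that is used: absolutely summable families
    have a sum. *)
Definition summation_complete (K : numFieldType) : Prop :=
  forall (I : choiceType) (f : I -> K) M, abs_bound f M -> exists S, has_sum f S.

Definition archimedean_norm (K : numFieldType) : Prop :=
  forall x : K, 0 <= x -> exists N, x <= N%:R.

(** A nonnegative family is summed by a supremum; a general f is the difference
    of the nonnegative families |f| + f and |f|. *)
Lemma summation_complete_real (R : realType) : summation_complete R.
Proof.
have pos (I : choiceType) (f : I -> R) M : (forall i, 0 <= f i) ->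
    abs_bound f M -> exists S, has_sum f S.
  move=> f0 HM; pose A : set R := [set x | exists s : {fset I}, x = \sum_(i <- s) f i]%classic.
  have ub (s : {fset I}) : \sum_(i <- s) f i <= M.
    rewrite (le_trans _ (HM s)) // ler_sum // => i _; exact: ler_norm.
  have hA : has_sup A.
    split; first by exists (\sum_(i <- fset0) f i); exists fset0.
    by exists M => _ [s ->].
  exists (sup A) => e e0.
  have [_ [s ->] lt] := sup_adherent e0 hA; exists s => t st.
  rewrite distrC ger0_norm ?subr_ge0; last first.
    by apply: ub_le_sup => //; [exact: hA.2 | exists t].
  rewrite lerBlDr -lerBlDl (le_trans (ltW lt)) //.
  exact: ler_sum_fsubset.
move=> I f M HM; have HM' : abs_bound (fun i => `|f i|) M.
  by apply: abs_bound_sub HM => i; rewrite normr_id.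
have [i|S HS] := pos _ _ _ (fun i => _) HM'; first exact: normr_ge0.
have [i|T HT] := pos _ (fun i => `|f i| + f i) _ _ (abs_boundD HM' HM).
  by rewrite -lerBlDr sub0r -normrN ler_norm.
exists (T + -1 * S); apply: has_sum_ext (has_sumD HT (has_sumZ (-1) HS)) => i.
by ring.
Qed.

Lemma summation_complete_complex (R : realType) : summation_complete R[i].
Proof.
have emb (I : choiceType) (g : I -> R) S : has_sum g S ->
    has_sum (fun i => (g i)%:C%C : R[i]) S%:C%C.
  move=> H [e1 e2]; rewrite ltcE /= => /andP[/eqP-> e0].
  have [s Hs] := H _ e0; exists s => t /Hs h.
  by rewrite -rmorph_sum -rmorphB /= normc_def /= expr0n addr0 sqrtr_sqr lecR.
move=> I f M HM.
have HRe : abs_bound (fun i => complex.Re (f i)) (complex.Re M).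
  move=> s; have := HM s; rewrite lecE => /andP[_]; rewrite raddf_sum; apply: le_trans.
  apply: ler_sum => i _; have := normc_ge_Re (f i).
  by rewrite lecE => /andP[_].
have HIm : abs_bound (fun i => complex.Im (f i)) (complex.Re M).
  move=> s; have := HM s; rewrite lecE => /andP[_]; rewrite raddf_sum; apply: le_trans.
  apply: ler_sum => i _.
  by rewrite normc_def /= -sqrtr_sqr ler_wsqrtr // lerDr sqr_ge0.
have [S HS] := summation_complete_real HRe.
have [T HT] := summation_complete_real HIm.
exists (S%:C%C + 'i%C * T%:C%C).
apply: has_sum_ext (has_sumD (emb _ _ _ HS) (has_sumZ 'i%C (emb _ _ _ HT))) => i.
by rewrite -complexE.
Qed.

Lemma archimedean_real (R : realType) : archimedean_norm R.
Proof. by move=> x x0; exists (Num.bound x); rewrite ltW // archi_boundP. Qed.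

Lemma archimedean_complex (R : realType) : archimedean_norm R[i].
Proof.
move=> [x y]; rewrite lecE /= => /andP[/eqP -> x0].
have [N HN] := archimedean_real x0; exists N.
by rewrite -(rmorph_nat (real_complex R)) lecR.
Qed.

(** * Absolutely convergent power series *)

Section Monomials.
Variable K : numFieldType.

Definition mono n (x : 'cV[K]_n) (e : {ffun 'I_n -> nat}) : K :=
  \prod_(i < n) x i 0 ^+ e i.

Definition deg n (e : {ffun 'I_n -> nat}) : nat := \sum_(i < n) e i.

Definition in_box n (r : K) (x : 'cV[K]_n) : Prop := forall i, `|x i 0| < r.

(** Monomials as products over lists of variables: statements about all
    monomials become inductions on lists. *)
Lemma mono_list n (e : {ffun 'I_n -> nat}) : exists l : seq 'I_n,
  size l = deg e /\ forall x, mono x e = \prod_(i <- l) x i 0.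
Proof.
exists (flatten [seq nseq (e i) i | i <- enum 'I_n]); split.
  rewrite size_flatten /shape -map_comp sumnE big_map big_enum /=.
  by apply: eq_bigr => i _; rewrite size_nseq.
move=> x; rewrite big_flatten big_map big_enum /=; apply: eq_bigr => i _.
by rewrite big_nseq iter_mulr mulr1.
Qed.

Lemma mono_le n (x : 'cV[K]_n) e t : (forall i, `|x i 0| <= t) ->
  `|mono x e| <= t ^+ deg e.
Proof.
have [l [<- ->]] := mono_list e => H.
elim: l => [|i l IH]; first by rewrite big_nil normr1 expr0.
by rewrite big_cons normrM exprS ler_pM.
Qed.

Lemma monoD n (x : 'cV[K]_n) (e e' : {ffun 'I_n -> nat}) :
  mono x [ffun i => (e i + e' i)%N] = mono x e * mono x e'.
Proof. by rewrite -big_split; apply: eq_bigr => i _; rewrite ffunE exprD. Qed.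

Lemma degD n (e e' : {ffun 'I_n -> nat}) :
  deg [ffun i => (e i + e' i)%N] = (deg e + deg e')%N.
Proof. by rewrite -big_split; apply: eq_bigr => i _; rewrite ffunE. Qed.

Definition unit_exp n (i : 'I_n) : {ffun 'I_n -> nat} := [ffun j => (j == i) : nat].

Lemma deg_unit_exp n (i : 'I_n) : deg (unit_exp i) = 1%N.
Proof.
rewrite /deg (bigD1 i) //= big1 => [|j /negPf ji]; first by rewrite ffunE eqxx.
by rewrite ffunE ji.
Qed.

Lemma mono_unit_exp n (x : 'cV[K]_n) i : mono x (unit_exp i) = x i 0.
Proof.
rewrite /mono (bigD1 i) //= big1 => [|j /negPf ji]; first by rewrite ffunE eqxx mulr1.
by rewrite ffunE ji.
Qed.

Lemma deg0 n : deg [ffun _ : 'I_n => 0%N] = 0%N.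
Proof. by rewrite /deg big1 // => i _; rewrite ffunE. Qed.

Lemma mono_deg0 n (x : 'cV[K]_n) : mono x [ffun _ => 0%N] = 1.
Proof. by rewrite /mono big1 // => i _; rewrite ffunE. Qed.

Lemma deg_lt2 n (e : {ffun 'I_n -> nat}) : (deg e < 2)%N ->
  e = [ffun _ => 0%N] \/ exists i, e = unit_exp i.
Proof.
rewrite ltnS leq_eqVlt ltnS leqn0 => /orP[/eqP d1|/eqP d0]; last first.
  left; apply/ffunP => i; rewrite ffunE; apply/eqP; rewrite -leqn0 -d0.
  by rewrite /deg (bigD1 i) //= leq_addr.
right; have /existsP[i ei] : [exists i, e i != 0%N].
  apply: contraT; rewrite negb_exists => /forallP H; move: d1.
  by rewrite /deg big1 // => i _; have := H i; rewrite negbK => /eqP.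
exists i; apply/ffunP => j; rewrite ffunE.
move: d1; rewrite /deg (bigD1 i) //=; case: eqP => [->|/eqP ji].
  by move: ei; case: (e i) => // -[|k].
rewrite (bigD1 j) //=; move: ei; case: (e i) => //= k _.
by rewrite addSn addnA => -[/eqP]; rewrite addn_eq0 addn_eq0 => /andP[/andP[_ /eqP]].
Qed.

End Monomials.

Section PowerSeries.
Variable K : numFieldType.
Hypothesis K_complete : summation_complete K.

(** The l1 norm of the coefficients, weighted by the powers of r, is at most M. *)
Definition power_series n (r : K) (f : 'cV[K]_n -> K) (M : K) : Prop :=
  exists2 c : {ffun 'I_n -> nat} -> K,
    abs_bound (fun e => c e * r ^+ deg e) M &
    forall x, in_box r x -> has_sum (fun e => c e * mono x e) (f x).

Implicit Types (r s M t rho d : K).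

Lemma mono_term_le n r (x : 'cV[K]_n) (c : K) e : 0 < r -> in_box r x ->
  `|c * mono x e| <= `|c * r ^+ deg e|.
Proof.
move=> r0 xr; rewrite !normrM ler_wpM2l // (le_trans (mono_le _ (fun i => ltW (xr i)))) //.
by rewrite ger0_norm // exprn_ge0 // ltW.
Qed.

Lemma power_series_bound n r (f : 'cV[K]_n -> K) M x : 0 < r ->
  power_series r f M -> in_box r x -> `|f x| <= M.
Proof.
move=> r0 [c cM cf] xr; apply: has_sum_le (cf x xr).
by apply: abs_bound_sub cM => e; exact: mono_term_le.
Qed.

Lemma power_series_ge0 n r (f : 'cV[K]_n -> K) M : power_series r f M -> 0 <= M.
Proof. by case=> c /abs_bound_ge0. Qed.

Lemma power_series_ext n r (f g : 'cV[K]_n -> K) M :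
  (forall x, in_box r x -> f x = g x) -> power_series r f M -> power_series r g M.
Proof. by move=> fg [c cM cf]; exists c => // x xr; rewrite -fg //; exact: cf. Qed.

Lemma power_series_weaken n r (f : 'cV[K]_n -> K) M N : M <= N ->
  power_series r f M -> power_series r f N.
Proof. by move=> MN [c cM cf]; exists c => //; exact: abs_bound_le cM. Qed.

Lemma power_series_shrink n r s (f : 'cV[K]_n -> K) M : 0 < s -> s <= r ->
  power_series r f M -> power_series s f M.
Proof.
move=> s0 sr [c cM cf]; exists c => [|x xs]; last first.
  by apply: cf => i; exact: lt_le_trans (xs i) sr.
have r0 := lt_le_trans s0 sr.
apply: abs_bound_sub cM => e; rewrite !normrM ler_wpM2l // !normrX !gtr0_norm //.
by rewrite lerXn2r // ?nnegrE ltW.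
Qed.

(** Products and substitutions are sums of such terms, by [power_series_sum]. *)
Lemma power_series_single n r (c : K) (e0 : {ffun 'I_n -> nat}) : 0 < r ->
  power_series r (fun x => c * mono x e0) (`|c| * r ^+ deg e0).
Proof.
move=> r0; exists (fun e => if e == e0 then c else 0) => [|x xr].
  apply: (@abs_bound_single _ _ _ e0) => [e /negPf ->|]; first by rewrite mul0r.
  by rewrite eqxx normrM (ger0_norm (exprn_ge0 _ (ltW r0))).
have := @has_sum_single _ _ (fun e => (if e == e0 then c else 0) * mono x e) e0.
by rewrite eqxx; apply => e /negPf ->; rewrite mul0r.
Qed.

Lemma power_series_cst n r (c : K) : 0 < r ->
  power_series r (fun _ : 'cV[K]_n => c) `|c|.
Proof.
move=> r0; have := power_series_single c [ffun _ : 'I_n => 0%N] r0.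
rewrite deg0 expr0 mulr1; apply: power_series_ext => x _.
by rewrite mono_deg0 mulr1.
Qed.

Lemma power_series_coord n r (i : 'I_n) : 0 < r ->
  power_series r (fun x : 'cV[K]_n => x i 0) r.
Proof.
move=> r0; have := power_series_single 1 (unit_exp i) r0.
rewrite deg_unit_exp expr1 normr1 mul1r; apply: power_series_ext => x _.
by rewrite mono_unit_exp mul1r.
Qed.

Lemma power_seriesD n r (f g : 'cV[K]_n -> K) M N :
  power_series r f M -> power_series r g N ->
  power_series r (fun x => f x + g x) (M + N).
Proof.
move=> [c cM cf] [d dN dg]; exists (fun e => c e + d e).
  by apply: abs_bound_ext (abs_boundD cM dN) => e; rewrite mulrDl.
move=> x xr; apply: has_sum_ext (has_sumD (cf x xr) (dg x xr)) => e.
by rewrite mulrDl.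
Qed.

Lemma power_seriesZ n r (f : 'cV[K]_n -> K) M a :
  power_series r f M -> power_series r (fun x => a * f x) (`|a| * M).
Proof.
move=> [c cM cf]; exists (fun e => a * c e).
  by apply: abs_bound_ext (abs_boundZ a cM) => e; rewrite mulrA.
by move=> x xr; apply: has_sum_ext (has_sumZ a (cf x xr)) => e; rewrite mulrA.
Qed.

Lemma power_seriesB n r (f g : 'cV[K]_n -> K) M N :
  power_series r f M -> power_series r g N ->
  power_series r (fun x => f x - g x) (M + N).
Proof.
move=> fM /(power_seriesZ (-1)); rewrite normrN1 mul1r => /(power_seriesD fM).
by apply: power_series_ext => x _; rewrite mulN1r.
Qed.

Lemma power_series_bigD n r m (f : 'I_m -> 'cV[K]_n -> K) (M : 'I_m -> K) : 0 < r ->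
  (forall k, power_series r (f k) (M k)) ->
  power_series r (fun x => \sum_k f k x) (\sum_k M k).
Proof.
move=> r0 H; elim: (index_enum _) => [|k l IH].
  rewrite big_nil; have := power_series_cst n 0 r0; rewrite normr0.
  by apply: power_series_ext => x _; rewrite big_nil.
rewrite big_cons; apply: power_series_ext (power_seriesD (H k) IH) => x _.
by rewrite big_cons.
Qed.

(** The Banach space property.  The coefficients of F are the sums of those of
    the f k, and F is their power series by exchanging the two summations. *)
Lemma power_series_sum n r (I : choiceType) (f : I -> 'cV[K]_n -> K)
    (M : I -> K) B (F : 'cV[K]_n -> K) : 0 < r ->
  (forall k, power_series r (f k) (M k)) -> abs_bound M B ->
  (forall x, in_box r x -> has_sum (fun k => f k x) (F x)) ->
  power_series r F B.
Proof.
move=> r0 fM MB fF.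
have /choice [c Hc] : forall k, exists c : {ffun 'I_n -> nat} -> K,
    abs_bound (fun e => c e * r ^+ deg e) (M k) /\
    (forall x, in_box r x -> has_sum (fun e => c e * mono x e) (f k x)).
  by move=> k; have [c] := fM k; exists c.
have swap (g : I * {ffun 'I_n -> nat} -> K) := @abs_bound_reindex K _ _
  (fun p : {ffun 'I_n -> nat} * I => (p.2, p.1)) (fun p => (p.2, p.1))
  (fun p => let: (_, _) := p in erefl) g.
have swaps (g : I * {ffun 'I_n -> nat} -> K) := @has_sum_reindex K _ _
  (fun p : {ffun 'I_n -> nat} * I => (p.2, p.1)) (fun p => (p.2, p.1))
  (fun p => let: (_, _) := p in erefl) (fun p => let: (_, _) := p in erefl) g.
have bc : abs_bound (fun p : I * {ffun 'I_n -> nat} => c p.1 p.2 * r ^+ deg p.2) B.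
  by apply: abs_bound_pair MB => k; exact: (Hc k).1.
have /choice [C HC] e : exists C, has_sum (fun k => c k e) C.
  have [S HS] := K_complete (abs_bound_row e (swap _ _ bc)).
  exists ((r ^+ deg e)^-1 * S); apply: has_sum_ext (has_sumZ _ HS) => k /=.
  by rewrite mulrC mulfK // expf_neq0 // lt0r_neq0.
exists C => [|x xr].
  apply: fubini_bound (swap _ _ bc) _ => e /=.
  by rewrite mulrC; apply: has_sum_ext (has_sumZ _ (HC e)) => k; rewrite mulrC.
have bx : abs_bound (fun p : I * {ffun 'I_n -> nat} => c p.1 p.2 * mono x p.2) B.
  by apply: abs_bound_sub bc => p; exact: mono_term_le.
have [T HT] := K_complete bx.
have HF := fubini bx (fun k => (Hc k).2 x xr) HT.
rewrite (has_sum_unique (fF x xr) HF).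
apply: fubini (swap _ _ bx) _ (swaps _ _ HT) => e /=.
by rewrite mulrC; apply: has_sum_ext (has_sumZ _ (HC e)) => k; rewrite mulrC.
Qed.

(** The product is the sum of a monomial for each pair of exponents, and
    [power_series_sum] collects the coefficients. *)
Lemma power_seriesM n r (f g : 'cV[K]_n -> K) M N : 0 < r ->
  power_series r f M -> power_series r g N ->
  power_series r (fun x => f x * g x) (M * N).
Proof.
move=> r0 [c cM cf] [d dN dg].
pose E := {ffun 'I_n -> nat}.
have b : abs_bound (fun p : E * E => `|c p.1 * r ^+ deg p.1| * `|d p.2 * r ^+ deg p.2|) (M * N).
  apply: (@abs_bound_pair _ _ _ _ (fun e => `|c e * r ^+ deg e| * N)) => [e|].
    rewrite /=; apply: abs_bound_sub (abs_boundZ (c e * r ^+ deg e) dN) => e'.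
    by rewrite !normrM !normr_id.
  rewrite mulrC -[N]ger0_norm ?(abs_bound_ge0 dN)//.
  by apply: abs_bound_sub (abs_boundZ N cM) => e; rewrite !normrM !normr_id mulrC.
apply: (@power_series_sum _ _ _ (fun (p : E * E) x =>
  (c p.1 * d p.2) * mono x [ffun i => (p.1 i + p.2 i)%N]) _ _ _ r0 _ b) => [p|x xr].
  have := power_series_single (c p.1 * d p.2) [ffun i => (p.1 i + p.2 i)%N] r0.
  apply: power_series_weaken; rewrite degD exprD !normrM mulrACA !normrX.
  by rewrite (gtr0_norm r0) mulrACA.
have bx : abs_bound (fun p : E * E => c p.1 * d p.2 * mono x [ffun i => (p.1 i + p.2 i)%N]) (M * N).
  apply: abs_bound_sub b => p; rewrite monoD mulrACA normrM [leRHS]ger0_norm ?mulr_ge0 //.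
  by rewrite ler_pM // mono_term_le.
have [T HT] := K_complete bx; rewrite (_ : f x * g x = T) //.
have row e : has_sum (fun e' => c e * d e' * mono x [ffun i => (e i + e' i)%N])
      (c e * mono x e * g x).
  by apply: has_sum_ext (has_sumZ _ (dg x xr)) => e'; rewrite monoD mulrACA.
apply: has_sum_unique (fubini bx row HT).
by rewrite mulrC; apply: has_sum_ext (has_sumZ _ (cf x xr)) => e; rewrite mulrC.
Qed.

Lemma power_series_prod n r m (u : 'I_m -> 'cV[K]_n -> K) rho l : 0 < r ->
  (forall j, power_series r (u j) rho) ->
  power_series r (fun x => \prod_(j <- l) u j x) (rho ^+ size l).
Proof.
move=> r0 H; elim: l => [|j l IH].
  rewrite expr0; have := power_series_cst n 1 r0; rewrite normr1.
  by apply: power_series_ext => x _; rewrite big_nil.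
rewrite /= exprS; apply: power_series_ext (power_seriesM r0 (H j) IH) => x _.
by rewrite big_cons.
Qed.

(** The telescoping sum for a difference of products bounds it by size l times
    rho ^ (size l - 1) times d; dividing by rho avoids the predecessor. *)
Lemma power_series_prodB n r m (u v : 'I_m -> 'cV[K]_n -> K) rho d l : 0 < r -> 0 < rho ->
  (forall j, power_series r (u j) rho) -> (forall j, power_series r (v j) rho) ->
  (forall j, power_series r (fun x => u j x - v j x) d) ->
  power_series r (fun x => \prod_(j <- l) u j x - \prod_(j <- l) v j x)
    ((size l)%:R * rho ^+ size l * (d / rho)).
Proof.
move=> r0 rho0 Hu Hv Hd; elim: l => [|j l IH].
  rewrite !mul0r; have := power_series_cst n 0 r0; rewrite normr0.
  by apply: power_series_ext => x _; rewrite !big_nil subrr.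
have := power_seriesD (power_seriesM r0 (Hu j) IH)
  (power_seriesM r0 (Hd j) (power_series_prod l r0 Hv)).
rewrite (_ : _ + _ = (size (j :: l))%:R * rho ^+ size (j :: l) * (d / rho)).
  by apply: power_series_ext => x _; rewrite !big_cons; ring.
by rewrite /= exprS -natr1; field; exact: lt0r_neq0.
Qed.

(** Substitution is again a sum: one term c e (U x) ^ e for each exponent e of
    f.  The inequality rho < r keeps U x inside the polydisc of f. *)
Lemma power_series_comp n m r s (f : 'cV[K]_m -> K) (U : 'cV[K]_n -> 'cV[K]_m) M rho :
  0 < s -> 0 <= rho -> rho < r -> power_series r f M ->
  (forall j, power_series s (fun x => U x j 0) rho) ->
  power_series s (f \o U) M.
Proof.
move=> s0 rho0 rhor [c cM cf] HU.
have r0 := le_lt_trans rho0 rhor.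
apply: (@power_series_sum _ _ _ (fun e x => c e * mono (U x) e)
   (fun e => `|c e| * rho ^+ deg e)) => // [e||x xs].
- have [l [<- El]] := mono_list K e.
  apply: power_series_ext (power_seriesZ (c e) (power_series_prod l s0 HU)) => x _.
  by rewrite El.
- apply: abs_bound_sub cM => e; rewrite !normrM normr_id ler_wpM2l // !normrX.
  by rewrite lerXn2r ?nnegrE // !ger0_norm // ltW.
- apply: cf => j; apply: le_lt_trans rhor; exact: power_series_bound (HU j) xs.
Qed.

(** Series vanishing to order k at the centre. *)
Definition power_series_ord n k (r : K) (f : 'cV[K]_n -> K) (M : K) : Prop :=
  exists c : {ffun 'I_n -> nat} -> K,
    [/\ forall e, (deg e < k)%N -> c e = 0,
    abs_bound (fun e => c e * r ^+ deg e) M &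
    forall x, in_box r x -> has_sum (fun e => c e * mono x e) (f x)].

Lemma power_series_ordW n k r (f : 'cV[K]_n -> K) M :
  power_series_ord k r f M -> power_series r f M.
Proof. by case=> c [_ ? ?]; exists c. Qed.

Lemma power_series_coef0 n r (f : 'cV[K]_n -> K) (c : {ffun 'I_n -> nat} -> K) : 0 < r ->
  (forall x, in_box r x -> has_sum (fun e => c e * mono x e) (f x)) ->
  c [ffun _ => 0%N] = f 0.
Proof.
move=> r0 cf; have h0 : in_box r (0 : 'cV[K]_n) by move=> i; rewrite mxE normr0.
apply: has_sum_unique (cf 0 h0).
rewrite -[X in has_sum _ X]mulr1 -(mono_deg0 (0 : 'cV[K]_n)).
apply: (@has_sum_single _ _ (fun e => c e * mono 0 e)) => e ez.
rewrite /mono; have [i ei] : exists i, e i != 0%N.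
  apply/existsP; apply: contraNT ez; rewrite negb_exists => /forallP H.
  by apply/eqP/ffunP => i; rewrite ffunE; apply/eqP; rewrite -[_ == _]negbK.
by rewrite (bigD1 i) //= mxE expr0n (negPf ei) mul0r mulr0.
Qed.

Lemma power_series_ord1 n r (f : 'cV[K]_n -> K) M : 0 < r -> f 0 = 0 ->
  power_series r f M -> power_series_ord 1 r f M.
Proof.
move=> r0 f0 [c cM cf]; exists c; split=> // e; rewrite ltnS leqn0 => /eqP e0.
rewrite (_ : e = [ffun _ => 0%N]) ?(power_series_coef0 r0 cf) //.
have [|->//|[i ei]] := @deg_lt2 _ e; first by rewrite e0.
by move: e0; rewrite ei deg_unit_exp.
Qed.

(** Each monomial of degree at least k gains a factor (s / r) ^ k, so a series
    that vanishes at the centre has small norm on small polydiscs. *)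
Lemma power_series_ord_shrink n k r s (f : 'cV[K]_n -> K) M : 0 < s -> s <= r ->
  power_series_ord k r f M -> power_series_ord k s f (M * (s / r) ^+ k).
Proof.
move=> s0 sr [c [c0 cM cf]]; have r0 := lt_le_trans s0 sr.
exists c; split=> // [|x xs]; last first.
  by apply: cf => i; exact: lt_le_trans (xs i) sr.
have q0 : 0 <= (s / r) ^+ k by rewrite exprn_ge0 // divr_ge0 // ltW.
rewrite mulrC -(ger0_norm q0); apply: abs_bound_sub (abs_boundZ _ cM) => e.
have [/c0 ->|ek] := ltnP (deg e) k; first by rewrite !mul0r mulr0.
have rk : 0 <= r ^+ deg e by rewrite exprn_ge0 // ltW.
have sk : 0 <= s ^+ deg e by rewrite exprn_ge0 // ltW.
rewrite mulrCA !(normrM (c e)) ler_wpM2l //.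
rewrite (ger0_norm (mulr_ge0 q0 rk)) (ger0_norm sk) -(subnK ek) !exprD.
rewrite (_ : (s / r) ^+ k * _ = r ^+ (deg e - k) * s ^+ k); last first.
  rewrite expr_div_n mulrCA mulrC divfK ?expf_neq0 ?gt_eqF //.
  by rewrite mulrC.
rewrite ler_wpM2r ?exprn_ge0 ?(ltW s0) // lerXn2r // nnegrE ltW //.
Qed.

(** The exponents of degree less than two are 0 and the unit vectors, which give
    the constant and the linear part. *)
Lemma power_series_taylor n r (f : 'cV[K]_n -> K) M : 0 < r -> power_series r f M ->
  exists D : 'rV[K]_n, power_series_ord 2 r (fun x => f x - (f 0 + (D *m x) 0 0)) M.
Proof.
move=> r0 [c cM cf]; exists (\row_i c (unit_exp i)).
exists (fun e => if (deg e < 2)%N then 0 else c e); split.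
- by move=> e ->.
- by apply: abs_bound_sub cM => e; case: ifP; rewrite // mul0r normr0.
move=> x xr; pose z : {ffun 'I_n -> nat} := [ffun _ => 0%N].
pose g e := if (deg e < 2)%N then c e * mono x e else 0.
have E0 : c z = f 0 := power_series_coef0 r0 cf.
suff Hg : has_sum g (f 0 + ((\row_i c (unit_exp i)) *m x) 0 0).
  have := has_sumD (cf x xr) (has_sumZ (-1) Hg); rewrite mulN1r.
  by apply: has_sum_ext => e; rewrite /g; case: ifP => _; ring.
rewrite !mxE -E0; pose pick e0 e := if e == e0 then c e * mono x e else 0.
have Hp e0 : has_sum (pick e0) (c e0 * mono x e0).
  have := @has_sum_single _ _ (pick e0) e0; rewrite /pick eqxx; apply.
  by move=> e /negPf ->.
have := has_sumD (Hp z) (has_sum_sum (index_enum 'I_n) (fun i => Hp (unit_exp i))).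
rewrite mono_deg0 mulr1 (eq_bigr (fun i => (\row_i c (unit_exp i)) 0 i * x i 0)).
  apply: has_sum_ext => e; rewrite /g; case: ifP => [/deg_lt2 [->|[i ->]]|e2].
  - rewrite /pick eqxx big1 ?addr0 // => i _; case: eqP => // zi.
    by have := deg_unit_exp i; rewrite -zi deg0.
  - rewrite {1}/pick; case: eqP => [iz|_].
      by have := deg_unit_exp i; rewrite iz deg0.
    rewrite add0r (bigD1 i) //= /pick eqxx big1 ?addr0 // => j ji.
    case: eqP => // /ffunP/(_ i); rewrite !ffunE eqxx => /esym/eqP.
    by rewrite eqb1 => /eqP /esym /eqP; rewrite (negPf ji).
  - rewrite /pick; case: eqP => [ez|_]; first by rewrite ez deg0 in e2.
    rewrite big1 ?addr0 // => i _; case: eqP => // ei.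
    by rewrite ei deg_unit_exp in e2.
by move=> i _; rewrite mono_unit_exp mxE.
Qed.

Lemma power_series_ord2_bound n r (f : 'cV[K]_n -> K) M t x : 0 < r -> 0 <= t -> t <= r ->
  power_series_ord 2 r f M -> in_box r x -> (forall i, `|x i 0| <= t) ->
  `|f x| <= M * (t / r) ^+ 2.
Proof.
move=> r0 t0 tr [c [c0 cM cf]] xr xt; apply: has_sum_le (cf x xr).
have q0 : 0 <= (t / r) ^+ 2 by rewrite exprn_ge0 // divr_ge0 // ltW.
rewrite mulrC -(ger0_norm q0); apply: abs_bound_sub (abs_boundZ _ cM) => e.
have [/c0 ->|e2] := ltnP (deg e) 2; first by rewrite !mul0r mulr0.
rewrite mulrCA !(normrM (c e)) ler_wpM2l // (le_trans (mono_le _ xt)) //.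
have rk : 0 <= r ^+ deg e by rewrite exprn_ge0 // ltW.
rewrite ger0_norm ?(mulr_ge0 q0 rk) //.
rewrite -(subnK e2) !exprD.
rewrite (_ : (t / r) ^+ 2 * _ = r ^+ (deg e - 2) * t ^+ 2); last first.
  by field; rewrite gt_eqF.
by rewrite ler_wpM2r ?exprn_ge0 // lerXn2r // nnegrE ltW.
Qed.

(** This is the contraction estimate: the Lipschitz constant 4 M rho / r ^ 2 of a
    series of order two tends to 0 with rho. *)
Lemma power_series_ord2_compB n m r s (f : 'cV[K]_m -> K) (U V : 'cV[K]_n -> 'cV[K]_m)
    M rho d : 0 < s -> 0 < rho -> 0 <= d -> 2 * rho <= r -> power_series_ord 2 r f M ->
  (forall j, power_series s (fun x => U x j 0) rho) ->
  (forall j, power_series s (fun x => V x j 0) rho) ->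
  (forall j, power_series s (fun x => U x j 0 - V x j 0) d) ->
  power_series s (fun x => f (U x) - f (V x)) (4 * M * rho / r ^+ 2 * d).
Proof.
move=> s0 rho0 d0 rhor [c [c0 cM cf]] HU HV Hd.
have rhor' : rho < r by rewrite (lt_le_trans _ rhor) // ltr_pMl // ltr1n.
have r0 := lt_trans rho0 rhor'.
have fin j (W : 'cV[K]_n -> 'cV[K]_m) : power_series s (fun x => W x j 0) rho ->
    forall x, in_box s x -> `|W x j 0| < r.
  by move=> HW x xs; apply: le_lt_trans rhor'; exact: power_series_bound HW xs.
pose B e := `|c e| * ((deg e)%:R * rho ^+ deg e * (d / rho)).
apply: (@power_series_sum _ _ _ (fun e x => c e * mono (U x) e - c e * mono (V x) e)
   B) => // [e||x xs].
- rewrite /B; have [l [<- El]] := mono_list K e.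
  apply: power_series_ext (power_seriesZ (c e) (power_series_prodB l s0 rho0 HU HV Hd)) => x _.
  by rewrite !El mulrBr.
- have q0 : 0 <= 4 * rho / r ^+ 2 * d.
    by rewrite mulr_ge0 // divr_ge0 ?exprn_ge0 ?mulr_ge0 ?ltW.
  have -> : 4 * M * rho / r ^+ 2 * d = (4 * rho / r ^+ 2 * d) * M by ring.
  rewrite -(ger0_norm q0); apply: abs_bound_sub (abs_boundZ _ cM) => e.
  rewrite /B; have [/c0 ->|e2] := ltnP (deg e) 2; first by rewrite normr0 !mul0r mulr0 normr0.
  rewrite [X in _ <= `|X|]mulrCA normrM normr_id (normrM (c e)) ler_wpM2l //.
  have k2 : (deg e)%:R * rho ^+ deg e <= 4 * rho ^+ 2 / r ^+ 2 * r ^+ deg e.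
    apply: (@le_trans _ _ ((2 * rho) ^+ deg e)).
      rewrite exprMn ler_wpM2r ?(exprn_ge0 _ (ltW rho0)) // -(natrX K 2 (deg e)) ler_nat.
      by rewrite ltnW // ltn_expl.
    rewrite -(subnK e2) !exprD.
    rewrite (_ : 4 * _ / _ * _ = r ^+ (deg e - 2) * (2 * rho) ^+ 2); last first.
      by field; rewrite gt_eqF.
    have rho2 : 0 <= 2 * rho by rewrite mulr_ge0 // ltW.
    by rewrite ler_wpM2r ?exprn_ge0 // lerXn2r // nnegrE ltW.
  have dr : 0 <= d / rho by rewrite divr_ge0 // ltW.
  have re : 0 <= r ^+ deg e by rewrite exprn_ge0 // ltW.
  have rhoe : 0 <= rho ^+ deg e by rewrite exprn_ge0 // ltW.
  rewrite (ger0_norm (mulr_ge0 q0 re)) ger0_norm ?mulr_ge0 ?ler0n ?invr_ge0 ?(ltW rho0) //.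
  apply: le_trans (ler_wpM2r dr k2) _.
  rewrite le_eqVlt; apply/orP; left; apply/eqP; field.
  by rewrite !gt_eqF.
- have h1 := cf _ (fun j => fin j U (HU j) x xs).
  have h2 := cf _ (fun j => fin j V (HV j) x xs).
  have := has_sumD h1 (has_sumZ (-1) h2); rewrite mulN1r.
  by apply: has_sum_ext => e; rewrite mulN1r.
Qed.
End PowerSeries.

(** * Polydiscs and analytic germs *)

Section Local.
Variable K : numFieldType.

Lemma exists_pos_le2 (a b : K) : 0 < a -> 0 < b -> exists c, [/\ 0 < c, c <= a & c <= b].
Proof.
move=> a0 b0; have [ab|ba] := real_leP (ger0_real (ltW a0)) (ger0_real (ltW b0)).
  by exists a.
by exists b; split=> //; exact: ltW.
Qed.

Lemma exists_pos_le_fin (I : finType) (P : I -> K -> Prop) :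
  (forall i r s, 0 < s -> s <= r -> P i r -> P i s) ->
  (forall i, exists2 r, 0 < r & P i r) -> exists2 r, 0 < r & forall i, P i r.
Proof.
move=> H1 H2.
suff [r r0 Hr] : exists2 r, 0 < r & {in enum I, forall i, P i r}.
  by exists r => // i; apply: Hr; rewrite mem_enum.
elim: (enum I) => [|i l [r r0 IH]]; first by exists 1.
have [s s0 Hs] := H2 i; have [c [c0 cr cs]] := exists_pos_le2 r0 s0.
exists c => // j; rewrite inE => /orP[/eqP ->|jl]; first exact: H1 Hs.
by apply: H1 (IH _ jl).
Qed.

Lemma nbhs_boxP n (a : 'cV[K]_n) (U : set 'cV[K]_n) :
  nbhs a U <-> exists2 r, 0 < r & forall x, in_box r (x - a) -> U x.
Proof.
split=> [/nbhs_ballP[r r0 H]|[r r0 H]].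
  exists r => // x xr; apply: H; split=> // i j; rewrite ord1 -ball_normE /=.
  by have := xr i; rewrite !mxE distrC.
apply/nbhs_ballP; exists r => // x [_ xr]; apply: H => i.
by have := xr i 0; rewrite -ball_normE /= !mxE distrC.
Qed.

Lemma continuous_boxP n m (f : 'cV[K]_n -> 'cV[K]_m) a :
  {for a, continuous f} <-> forall e, 0 < e -> exists2 r, 0 < r &
    forall x, in_box r (x - a) -> in_box e (f x - f a).
Proof.
split=> [H e e0|H U /nbhs_boxP[e /H[r r0 rf] HU]].
  have /H /nbhs_boxP[r r0 Hr] : nbhs (f a) [set y | in_box e (y - f a)].
    by apply/nbhs_boxP; exists e.
  by exists r.
by apply/nbhs_boxP; exists r => // x /rf /HU.
Qed.

End Local.

Section AnalyticBridge.
Local Open Scope fset_scope.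
Local Open Scope ring_scope.
Variable K : numFieldType.
Hypothesis K_complete : summation_complete K.

Definition cube n (N : nat) : {fset {ffun 'I_n -> nat}} :=
  let T : finType := {ffun 'I_n -> 'I_N} in
  [fset ([ffun i => nat_of_ord ((e : T) i)] : {ffun 'I_n -> nat}) | e in T].

Lemma in_cube n N (e : {ffun 'I_n -> nat}) :
  reflect (forall i, (e i < N)%N) (e \in cube n N).
Proof.
apply: (iffP idP) => [/imfsetP[/= e' _ ->] i|H]; first by rewrite ffunE.
apply/imfsetP; exists [ffun i => Ordinal (H i)] => //=.
by apply/ffunP => i; rewrite !ffunE.
Qed.

(** The partial sums in the definition of analyticity run over the cubes
    {0, ..., N - 1} ^ n, which are cofinal among the finite sets of exponents. *)
Lemma power_sumE n (c : {ffun 'I_n -> nat} -> K) h N :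
  power_sum c h N = \sum_(e <- cube n N) c e * mono h e.
Proof.
rewrite big_imfset /=; last first.
  by move=> e e' _ _ /ffunP H; apply/ffunP => i; have := H i; rewrite !ffunE => /val_inj.
rewrite /power_sum big_enum /=; apply: eq_bigr => e _; congr (_ * _).
by apply: eq_bigr => i _; rewrite ffunE.
Qed.

Lemma cube_cofinal n (s : {fset {ffun 'I_n -> nat}}) :
  exists N0, forall N, (N0 <= N)%N -> s `<=` cube n N.
Proof.
exists (\max_(e <- s) deg e).+1 => N HN; apply/fsubsetP => e es.
apply/in_cube => i; apply: leq_trans HN; rewrite ltnS.
rewrite (leq_trans _ (leq_bigmax_seq _ es _)) //.
by rewrite /deg (bigD1 i) //= leq_addr.
Qed.

(** Absolute convergence makes the sum along cubes and the unordered sum agree. *)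
Lemma scalar_analyticP n (f : 'cV[K]_n -> K) a : scalar_analytic_at f a <->
  exists r M, 0 < r /\ power_series r (fun h => f (a + h)) M.
Proof.
split=> [[c [r [r0 [M HM] Hf]]]|[r [M [r0 [c cM cf]]]]].
  exists r, M; split => //.
  have cM : abs_bound (fun e => c e * r ^+ deg e) M.
    move=> s; have [N /(_ _ (leqnn N)) sN] := cube_cofinal s.
    apply: le_trans (HM N); rewrite power_sumE.
    have E e : mono (const_mx r : 'cV[K]_n) e = r ^+ deg e.
      rewrite /mono; under eq_bigr do rewrite mxE.
      by rewrite prodrXr.
    apply: le_trans (ler_sum_fsubset _ sN); last first.
      by move=> e; rewrite E mulr_ge0 // exprn_ge0 // ltW.
    rewrite le_eqVlt; apply/orP; left; apply/eqP; apply: eq_bigr => e _.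
    by rewrite E normrM (ger0_norm (exprn_ge0 _ (ltW r0))).
  exists c => // h hr.
  have xr i : `|(a + h) i 0 - a i 0| < r by rewrite mxE addrC addKr.
  have := Hf _ xr; rewrite [a + h - a]addrC addKr => /cvgrPdist_le cv.
  have [|S HS] := @K_complete _ (fun e => c e * mono h e) M.
    by apply: abs_bound_sub cM => e; exact: mono_term_le.
  suff <- : S = f (a + h) by [].
  apply/eqP; rewrite -subr_eq0; apply/eqP; apply: normr_le_eps_eq0 => e e0.
  have e20 : 0 < e / 2 by rewrite divr_gt0.
  have [s Hs] := HS _ e20; have [N0 HN0] := cube_cofinal s.
  have [N1 _ HN1] := cv _ e20.
  have := HN1 (maxn N0 N1) (leq_maxr _ _).
  have := Hs _ (HN0 _ (leq_maxl _ N1)).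
  rewrite power_sumE; set w := \sum_(i <- _) _ => h1 h2.
  rewrite (splitr e) (_ : S - f (a + h) = (S - w) + (w - f (a + h))); last by ring.
  by rewrite (le_trans (ler_normD _ _)) // lerD // distrC.
exists c, r; split => //.
  exists M => N; rewrite power_sumE; apply: le_trans (cM (cube n N)).
  rewrite le_eqVlt; apply/orP; left; apply/eqP; apply: eq_bigr => e _.
  rewrite normrM (ger0_norm (exprn_ge0 _ (ltW r0))); congr (_ * _).
  by rewrite /mono; under eq_bigr do rewrite mxE; rewrite prodrXr.
move=> x xr; apply/cvgrPdist_le => e e0.
have /cf : in_box r (x - a) by move=> i; rewrite !mxE.
rewrite [a + (x - a)]addrC subrK => /(_ _ e0)[s Hs].
have [N0 HN0] := cube_cofinal s; exists N0 => // N /= NN0.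
by rewrite power_sumE distrC; apply: Hs; exact: HN0.
Qed.

End AnalyticBridge.

(** * Calculus of analytic maps *)

Section AnalyticCalculus.
Variable K : numFieldType.
Hypothesis K_complete : summation_complete K.

Lemma analytic_atP n m (f : 'cV[K]_n -> 'cV[K]_m) a : analytic_at f a <->
  exists r M, 0 < r /\ forall j, power_series r (fun h => f (a + h) j 0) M.
Proof.
split=> [H|[r [M [r0 H]]] j]; last by apply/(scalar_analyticP K_complete); exists r, M.
have /choice[M HM] : forall j, exists M,
    exists2 r, 0 < r & power_series r (fun h => f (a + h) j 0) M.
  move=> j.
  by have [r [M [r0 HM]]] := (scalar_analyticP K_complete _ _).1 (H j); exists M, r.
have [j r s s0 sr|r r0 Hr] := @exists_pos_le_fin K 'I_m
  (fun j r => power_series r (fun h => f (a + h) j 0) (M j)) _ HM.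
  exact: power_series_shrink.
exists r, (\sum_j M j); split => // j; apply: power_series_weaken (Hr j).
rewrite (bigD1 j) //= lerDl sumr_ge0 // => i _; exact: power_series_ge0 (Hr i).
Qed.

Lemma analytic_at_ext n m (f g : 'cV[K]_n -> 'cV[K]_m) a :
  (\forall x \near a, f x = g x) -> analytic_at f a -> analytic_at g a.
Proof.
move=> /nbhs_boxP[s s0 fg] /analytic_atP[r [M [r0 H]]].
have [t [t0 tr ts]] := exists_pos_le2 r0 s0.
apply/analytic_atP; exists t, M; split => // j.
apply: power_series_ext (power_series_shrink t0 tr (H j)) => x xt.
by rewrite fg // => i; rewrite addrC addKr; exact: lt_le_trans (xt i) ts.
Qed.

Lemma analytic_at_eq n m (f g : 'cV[K]_n -> 'cV[K]_m) a :
  f =1 g -> analytic_at f a -> analytic_at g a.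
Proof. by move=> /funext ->. Qed.

(** A change of centre is the substitution of h |-> b + h. *)
Lemma power_series_shift n r s t (f : 'cV[K]_n -> K) (b : 'cV[K]_n) M :
  0 < s -> 0 <= t -> t + s < r -> (forall i, `|b i 0| <= t) -> power_series r f M ->
  power_series s (fun h => f (b + h)) M.
Proof.
move=> s0 t0 tsr bt fM.
apply: (power_series_comp (U := fun h => b + h) K_complete s0 _ tsr fM) => [|j].
  by rewrite addr_ge0 // ltW.
have := power_seriesD (power_series_cst n (b j 0) s0) (power_series_coord j s0).
move/(power_series_weaken (lerD (bt j) (lexx s))).
by apply: power_series_ext => x _; rewrite mxE.
Qed.

(** Recentring costs two thirds of the radius, but leaves the bound unchanged. *)
Lemma analytic_at_uniform n m (f : 'cV[K]_n -> 'cV[K]_m) a : analytic_at f a ->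
  exists r M, 0 < r /\ forall x, in_box r (x - a) -> forall j,
    power_series r (fun h => f (x + h) j 0) M.
Proof.
move=> /analytic_atP[r [M [r0 H]]].
have r30 : 0 < r / 3 by rewrite divr_gt0.
exists (r / 3), M; split => // x xr j.
have := power_series_shift r30 (ltW r30) _ (fun i => ltW (xr i)) (H j).
have -> : (r / 3 + r / 3 < r) = true.
  rewrite -subr_gt0 (_ : r - (r / 3 + r / 3) = r / 3) //.
  by field.
move=> /(_ isT); apply: power_series_ext => h _.
by congr (f _ _ _); rewrite addrA [a + _]addrC subrK.
Qed.

Lemma analytic_at_near n m (f : 'cV[K]_n -> 'cV[K]_m) a : analytic_at f a ->
  \forall x \near a, analytic_at f x.
Proof.
move=> /analytic_at_uniform[r [M [r0 H]]]; apply/nbhs_boxP; exists r => // x xr.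
by apply/analytic_atP; exists r, M; split => // j; exact: H.
Qed.

(** A map that vanishes at the centre has small norm on small polydiscs, so it
    can be substituted into any series. *)
Lemma power_series_small n m (u : 'cV[K]_n -> 'cV[K]_m) r M e : 0 < r -> 0 < e ->
  (forall j, u 0 j 0 = 0) -> (forall j, power_series r (fun h => u h j 0) M) ->
  exists s, [/\ 0 < s, s <= r & forall j, power_series s (fun h => u h j 0) e].
Proof.
move=> r0 e0 u0 H.
have M0 : 0 < `|M| + 1 by rewrite ltr_wpDl.
have [s [s0 sr sM]] := exists_pos_le2 r0 (mulr_gt0 e0 (divr_gt0 r0 M0)).
exists s; split=> // j.
have := power_series_ord_shrink s0 sr (power_series_ord1 r0 (u0 j) (H j)).
move=> /power_series_ordW; apply: power_series_weaken; rewrite expr1.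
apply: (@le_trans _ _ ((`|M| + 1) * (s / r))).
  rewrite ler_wpM2r ?(divr_ge0 (ltW s0) (ltW r0)) //.
  by rewrite ger0_norm ?(power_series_ge0 (H j)) // lerDl.
by rewrite mulrA ler_pdivrMr // mulrC -ler_pdivlMr // -mulrA.
Qed.

Lemma analytic_comp n m p (f : 'cV[K]_n -> 'cV[K]_m) (g : 'cV[K]_m -> 'cV[K]_p) a :
  analytic_at f a -> analytic_at g (f a) -> analytic_at (g \o f) a.
Proof.
move=> /analytic_atP[s [N [s0 fN]]] /analytic_atP[r [M [r0 gM]]].
apply/analytic_atP.
have r20 : 0 < r / 2 by rewrite divr_gt0.
have [||t [t0 ts Ht]] := @power_series_small _ _ (fun h => f (a + h) - f a) s
    (N + \sum_j `|f a j 0|) (r / 2) s0 r20.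
- by move=> j; rewrite addr0 subrr mxE.
- move=> j; have := power_seriesB (fN j) (power_series_cst n (f a j 0) s0).
  move=> h; apply: power_series_weaken (power_series_ext _ h) => [|x _].
    by rewrite lerD2l (bigD1 j) //= lerDl sumr_ge0.
  by rewrite !mxE.
exists t, M; split=> // j.
have r2r : r / 2 < r by rewrite ltr_pdivrMr // ltr_pMr // ltr1n.
apply: power_series_ext (power_series_comp K_complete t0 (ltW r20) r2r (gM j) Ht) => x _ /=.
by rewrite addrC subrK.
Qed.

Lemma analytic_affine n m (A : 'M[K]_(m, n)) b a : analytic_at (fun x => A *m x + b) a.
Proof.
apply/analytic_atP.
exists 1, (\sum_j (\sum_i `|A j i| + `|(A *m a + b) j 0|)); split=> // j.
have := power_seriesD (power_series_bigD (@ltr01 K)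
   (fun i => power_seriesZ (A j i) (power_series_coord i (@ltr01 K))))
   (power_series_cst n ((A *m a + b) j 0) (@ltr01 K)).
move=> h; apply: power_series_weaken (power_series_ext _ h) => [|x _]; last first.
  by rewrite mulmxDr addrAC !mxE [X in _ = X]addrC.
under eq_bigr do rewrite mulr1.
rewrite [leRHS](bigD1 j) //= lerDl sumr_ge0 // => i _; rewrite addr_ge0 // sumr_ge0 //.
Qed.

Lemma analytic_linear n m (A : 'M[K]_(m, n)) a : analytic_at (fun x => A *m x) a.
Proof.
by apply: analytic_at_eq (analytic_affine A 0 a) => x; rewrite addr0.
Qed.

Lemma analytic_id n (a : 'cV[K]_n) : analytic_at id a.
Proof.
apply: analytic_at_eq (analytic_linear 1%:M a).
by move=> x; rewrite mul1mx.
Qed.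

Lemma analytic_cst n m (b : 'cV[K]_m) (a : 'cV[K]_n) : analytic_at (fun _ => b) a.
Proof.
apply: analytic_at_eq (analytic_affine 0 b a).
by move=> x; rewrite mul0mx add0r.
Qed.

Lemma analytic_col_mx n m p (f : 'cV[K]_n -> 'cV[K]_m) (g : 'cV[K]_n -> 'cV[K]_p) a :
  analytic_at f a -> analytic_at g a -> analytic_at (fun x => col_mx (f x) (g x)) a.
Proof.
move=> Hf Hg j; case: (splitP j) => k jk.
  have -> : j = lshift p k by apply: val_inj.
  rewrite (_ : (fun x => _) = (fun x => f x k 0)); first exact: Hf.
  by apply/funext => x; rewrite col_mxEu.
have -> : j = rshift m k by apply: val_inj.
rewrite (_ : (fun x => _) = (fun x => g x k 0)); first exact: Hg.
by apply/funext => x; rewrite col_mxEd.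
Qed.

Lemma analyticD n m (f g : 'cV[K]_n -> 'cV[K]_m) a :
  analytic_at f a -> analytic_at g a -> analytic_at (fun x => f x + g x) a.
Proof.
move=> Hf Hg; have := analytic_comp (analytic_col_mx Hf Hg) (analytic_linear (row_mx 1%:M 1%:M) _).
by apply: analytic_at_eq; move=> x /=; rewrite mul_row_col !mul1mx.
Qed.

Lemma analyticZ n m c (f : 'cV[K]_n -> 'cV[K]_m) a :
  analytic_at f a -> analytic_at (fun x => c *: f x) a.
Proof.
move=> Hf; have := analytic_comp Hf (analytic_linear c%:M _).
by apply: analytic_at_eq; move=> x /=; rewrite mul_scalar_mx.
Qed.

Lemma analytic_sum n m (I : eqType) (l : seq I) (f : I -> 'cV[K]_n -> 'cV[K]_m) a :
  (forall i, i \in l -> analytic_at (f i) a) -> analytic_at (fun x => \sum_(i <- l) f i x) a.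
Proof.
elim: l => [|i l IH] H.
  by apply: analytic_at_eq (analytic_cst 0 a) => x; rewrite big_nil.
have {}IH := IH (fun j jl => H j (mem_behead (s := i :: l) jl)).
by apply: analytic_at_eq (analyticD (H i (mem_head i l)) IH) => x; rewrite big_cons.
Qed.

Lemma analytic_continuous n m (f : 'cV[K]_n -> 'cV[K]_m) a :
  analytic_at f a -> {for a, continuous f}.
Proof.
move=> /analytic_atP[r [M [r0 fM]]]; apply/continuous_boxP => e e0.
have e20 : 0 < e / 2 by rewrite divr_gt0.
have [||t [t0 tr Ht]] := @power_series_small _ _ (fun h => f (a + h) - f a) r
    (M + \sum_j `|f a j 0|) (e / 2) r0 e20.
- by move=> j; rewrite addr0 subrr mxE.
- move=> j; have := power_seriesB (fM j) (power_series_cst n (f a j 0) r0).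
  move=> h; apply: power_series_weaken (power_series_ext _ h) => [|x _].
    by rewrite lerD2l (bigD1 j) //= lerDl sumr_ge0.
  by rewrite !mxE.
exists t => // x xt j; have := power_series_bound t0 (Ht j) xt.
rewrite [a + _]addrC subrK => /le_lt_trans; apply.
by rewrite ltr_pdivrMr // ltr_pMr // ltr1n.
Qed.

End AnalyticCalculus.

(** * Derivatives *)

Section Jacobian.
Variable K : numFieldType.

Definition vnorm n (x : 'cV[K]_n) : K := \sum_i `|x i 0|.

Lemma vnorm_ge0 n (x : 'cV[K]_n) : 0 <= vnorm x.
Proof. exact: sumr_ge0. Qed.

Lemma le_vnorm n (x : 'cV[K]_n) i : `|x i 0| <= vnorm x.
Proof. by rewrite /vnorm (bigD1 i) //= lerDl sumr_ge0. Qed.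

Lemma vnorm0 n : vnorm (0 : 'cV[K]_n) = 0.
Proof. by rewrite /vnorm big1 // => i _; rewrite mxE normr0. Qed.

Lemma vnorm_eq0 n (x : 'cV[K]_n) : vnorm x = 0 -> x = 0.
Proof.
move=> x0; apply/matrixP => i j; rewrite ord1 mxE; apply/eqP.
by rewrite -normr_le0 -x0 le_vnorm.
Qed.

Lemma vnormD n (x y : 'cV[K]_n) : vnorm (x + y) <= vnorm x + vnorm y.
Proof.
by rewrite /vnorm -big_split ler_sum // => i _; rewrite mxE ler_normD.
Qed.

Lemma vnormZ n c (x : 'cV[K]_n) : vnorm (c *: x) = `|c| * vnorm x.
Proof.
by rewrite /vnorm mulr_sumr; apply: eq_bigr => i _; rewrite mxE normrM.
Qed.

Lemma vnormN n (x : 'cV[K]_n) : vnorm (- x) = vnorm x.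
Proof. by rewrite /vnorm; apply: eq_bigr => i _; rewrite mxE normrN. Qed.

Lemma vnorm_col_mx n m (x : 'cV[K]_n) (y : 'cV[K]_m) :
  vnorm (col_mx x y) = vnorm x + vnorm y.
Proof.
rewrite /vnorm big_split_ord; congr (_ + _); apply: eq_bigr => i _.
  by rewrite col_mxEu.
by rewrite col_mxEd.
Qed.

Definition mnorm n m (A : 'M[K]_(m, n)) : K := \sum_j \sum_i `|A j i|.

Lemma mnorm_ge0 n m (A : 'M[K]_(m, n)) : 0 <= mnorm A.
Proof. by apply: sumr_ge0 => j _; exact: sumr_ge0. Qed.

Lemma vnorm_mulmx n m (A : 'M[K]_(m, n)) x : vnorm (A *m x) <= mnorm A * vnorm x.
Proof.
rewrite /vnorm /mnorm mulr_suml ler_sum // => j _.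
rewrite mxE (le_trans (ler_norm_sum _ _ _)) // mulr_suml ler_sum // => i _.
by rewrite normrM ler_wpM2l // le_vnorm.
Qed.

Lemma vnorm_delta n (i : 'I_n) : vnorm (delta_mx i 0 : 'cV[K]_n) = 1.
Proof.
rewrite /vnorm (bigD1 i) //= big1 ?addr0 => [|j /negPf ji]; rewrite mxE ?eqxx ?normr1 //.
by rewrite ji normr0.
Qed.

Lemma nbhs_vnormP n (a : 'cV[K]_n) (U : set 'cV[K]_n) :
  nbhs a U <-> exists2 r, 0 < r & forall x, vnorm (x - a) < r -> U x.
Proof.
split=> [/nbhs_boxP[r r0 H]|[r r0 H]].
  by exists r => // x xr; apply: H => i; exact: le_lt_trans (le_vnorm _ _) xr.
apply/nbhs_boxP; exists (r / n.+1%:R); rewrite ?divr_gt0 // => x xr; apply: H.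
apply: (@le_lt_trans _ _ (\sum_(i < n) r / n.+1%:R)).
  by apply: ler_sum => i _; exact/ltW/xr.
rewrite sumr_const card_ord -[_ *+ n]mulr_natr mulrAC ltr_pdivrMr //.
by rewrite ltr_pM2l // ltr_nat.
Qed.

(** Differentiability with a quadratic remainder.  Analytic maps satisfy it, and
    it composes with explicit constants. *)
Definition jacobian n m (f : 'cV[K]_n -> 'cV[K]_m) a (D : 'M[K]_(m, n)) : Prop :=
  exists C r, [/\ 0 < r, 0 <= C & forall h, vnorm h < r ->
    vnorm (f (a + h) - f a - D *m h) <= C * vnorm h ^+ 2].

(** Test both derivatives on multiples s of a basis vector: their difference is at
    most (C + C') s. *)
Lemma jacobian_unique n m (f : 'cV[K]_n -> 'cV[K]_m) a D E :
  jacobian f a D -> jacobian f a E -> D = E.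
Proof.
move=> [C [r [r0 C0 HD]]] [C' [r' [r'0 C'0 HE]]]; apply/matrixP => j i.
apply/eqP; rewrite -subr_eq0; apply/eqP; apply: normr_le_eps_eq0 => e e0.
have CC : 0 < C + C' + 1 by rewrite ltr_wpDl // addr_ge0.
have [t [t0 tr te]] := exists_pos_le2 (divr_gt0 r0 (ltr0n K 2)) (divr_gt0 e0 CC).
have [s [s0 sr st]] := exists_pos_le2 (divr_gt0 r'0 (ltr0n K 2)) t0.
pose h : 'cV[K]_n := s *: delta_mx i 0.
have hs : vnorm h = s by rewrite vnormZ vnorm_delta mulr1 gtr0_norm.
have half (x : K) : 0 < x -> x / 2 < x.
  by move=> x0; rewrite ltr_pdivrMr // ltr_pMr // ltr1n.
have h1 := HD h; have h2 := HE h; rewrite hs in h1 h2.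
have {}h1 := h1 (le_lt_trans (le_trans st tr) (half _ r0)).
have {}h2 := h2 (le_lt_trans sr (half _ r'0)).
have H : vnorm ((D - E) *m h) <= (C + C') * s ^+ 2.
  rewrite mulrDl; apply: le_trans (lerD h1 h2).
  rewrite -[X in _ <= X + _]vnormN (le_trans _ (vnormD _ _)) //.
  rewrite (_ : - _ + _ = (D - E) *m h) // mulmxBl.
  by rewrite opprB addrA subrK.
have := le_trans (le_vnorm _ j) H.
rewrite /h -scalemxAr mxE -colE !mxE normrM (gtr0_norm s0) expr2 mulrCA ler_pM2l //.
move=> /le_trans; apply; apply: (@le_trans _ _ ((C + C' + 1) * (e / (C + C' + 1)))).
  by rewrite ler_pM ?(ltW s0) ?(addr_ge0 C0 C'0) ?(le_trans st) // lerDl.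
by rewrite mulrC divfK // gt_eqF.
Qed.

Lemma jacobian_ext n m (f g : 'cV[K]_n -> 'cV[K]_m) a D :
  (\forall x \near a, f x = g x) -> jacobian f a D -> jacobian g a D.
Proof.
move=> /nbhs_vnormP[s s0 fg] [C [r [r0 C0 H]]].
have [t [t0 tr ts]] := exists_pos_le2 r0 s0.
exists C, t; split=> // h ht; rewrite -!fg; first exact/H/(lt_le_trans ht).
  by rewrite subrr vnorm0.
by rewrite addrC addKr (lt_le_trans ht).
Qed.

Lemma jacobian_affine n m (A : 'M[K]_(m, n)) b a : jacobian (fun x => A *m x + b) a A.
Proof.
exists 0, 1; split=> // h _; rewrite mul0r (_ : _ - _ = 0) ?vnorm0 //.
by rewrite mulmxDr opprD addrACA subrr addr0 addrC addKr subrr.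
Qed.

Lemma jacobian_eq n m (f g : 'cV[K]_n -> 'cV[K]_m) a D :
  f =1 g -> jacobian f a D -> jacobian g a D.
Proof. by move=> /funext ->. Qed.

Lemma jacobian_linear n m (A : 'M[K]_(m, n)) a : jacobian (fun x => A *m x) a A.
Proof. by apply: jacobian_eq (jacobian_affine A 0 a) => x; rewrite addr0. Qed.

Lemma jacobian_id n a : jacobian (@id 'cV[K]_n) a 1%:M.
Proof. by apply: jacobian_eq (jacobian_linear 1%:M a) => x; rewrite mul1mx. Qed.

Lemma jacobian_cst n m (b : 'cV[K]_m) a : jacobian (fun _ : 'cV[K]_n => b) a 0.
Proof. by apply: jacobian_eq (jacobian_affine 0 b a) => x; rewrite mul0mx add0r. Qed.

Lemma jacobian_comp n m p (f : 'cV[K]_n -> 'cV[K]_m) (g : 'cV[K]_m -> 'cV[K]_p) a D E :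
  jacobian f a D -> jacobian g (f a) E -> jacobian (g \o f) a (E *m D).
Proof.
move=> [C [r [r0 C0 HD]]] [C' [r' [r'0 C'0 HE]]].
pose L := mnorm D + C * r.
have L0 : 0 <= L by rewrite addr_ge0 ?mnorm_ge0 // mulr_ge0 // ltW.
have L1 : 0 < L + 1 by rewrite ltr_wpDl.
have [t [t0 tr tL]] := exists_pos_le2 r0 (divr_gt0 r'0 L1).
exists (C' * L ^+ 2 + mnorm E * C), t; split=> //.
  by rewrite addr_ge0 // mulr_ge0 ?exprn_ge0 ?mnorm_ge0.
move=> h ht; have hr := lt_le_trans ht tr.
set k := f (a + h) - f a; have Hk := HD h hr; rewrite -/k in Hk.
have kL : vnorm k <= L * vnorm h.
  rewrite -(subrK (D *m h) k) (le_trans (vnormD _ _)) // addrC mulrDl lerD ?vnorm_mulmx //.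
  rewrite (le_trans Hk) // expr2 mulrA ler_wpM2r ?vnorm_ge0 // ler_wpM2l //; exact: ltW.
have kr : vnorm k < r'.
  have [h0|h0] := eqVneq (vnorm h) 0.
    by rewrite (le_lt_trans kL) // h0 mulr0.
  apply: (@le_lt_trans _ _ ((L + 1) * vnorm h)).
    by rewrite (le_trans kL) // ler_wpM2r ?vnorm_ge0 // lerDl.
  by rewrite mulrC -ltr_pdivlMr // (lt_le_trans ht).
have := HE k kr; rewrite [f a + k]addrC subrK => Hg.
rewrite /= (_ : _ - _ = (g (f (a + h)) - g (f a) - E *m k) + E *m (k - D *m h)); last first.
  by rewrite (mulmxBr E k) mulmxA addrA subrK.
rewrite (le_trans (vnormD _ _)) // mulrDl lerD //.
  rewrite (le_trans Hg) // -mulrA ler_wpM2l // -exprMn lerXn2r // nnegrE ?vnorm_ge0 //.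
  by rewrite mulr_ge0 ?vnorm_ge0.
by rewrite (le_trans (vnorm_mulmx _ _)) // -mulrA ler_wpM2l ?mnorm_ge0.
Qed.

Lemma jacobian_col_mx n m p (f : 'cV[K]_n -> 'cV[K]_m) (g : 'cV[K]_n -> 'cV[K]_p) a D E :
  jacobian f a D -> jacobian g a E ->
  jacobian (fun x => col_mx (f x) (g x)) a (col_mx D E).
Proof.
move=> [C [r [r0 C0 HD]]] [C' [r' [r'0 C'0 HE]]].
have [t [t0 tr tr']] := exists_pos_le2 r0 r'0.
exists (C + C'), t; split=> // [|h ht]; first by rewrite addr_ge0.
rewrite mul_col_mx !opp_col_mx !add_col_mx vnorm_col_mx mulrDl lerD //.
  by apply: HD; exact: lt_le_trans tr.
by apply: HE; exact: lt_le_trans tr'.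
Qed.

Lemma jacobianD n m (f g : 'cV[K]_n -> 'cV[K]_m) a D E :
  jacobian f a D -> jacobian g a E -> jacobian (fun x => f x + g x) a (D + E).
Proof.
move=> Hf Hg.
have := jacobian_comp (jacobian_col_mx Hf Hg) (jacobian_linear (row_mx 1%:M 1%:M) _).
rewrite mul_row_col !mul1mx; apply: jacobian_eq => x /=.
by rewrite mul_row_col !mul1mx.
Qed.

Lemma jacobianZ n m c (f : 'cV[K]_n -> 'cV[K]_m) a D :
  jacobian f a D -> jacobian (fun x => c *: f x) a (c *: D).
Proof.
move=> Hf; have := jacobian_comp Hf (jacobian_linear c%:M _).
by rewrite mul_scalar_mx; apply: jacobian_eq => x /=; rewrite mul_scalar_mx.
Qed.

Lemma jacobian_sum n m (I : eqType) (l : seq I) (f : I -> 'cV[K]_n -> 'cV[K]_m) a D :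
  (forall i, i \in l -> jacobian (f i) a (D i)) ->
  jacobian (fun x => \sum_(i <- l) f i x) a (\sum_(i <- l) D i).
Proof.
elim: l => [|i l IH] H.
  by rewrite big_nil; apply: jacobian_eq (jacobian_cst 0 a) => x; rewrite big_nil.
have {}IH := IH (fun j jl => H j (mem_behead (s := i :: l) jl)).
rewrite big_cons; apply: jacobian_eq (jacobianD (H i (mem_head i l)) IH) => x.
by rewrite big_cons.
Qed.

Hypothesis K_complete : summation_complete K.

Lemma power_series_taylor_vnorm n m (f : 'cV[K]_n -> 'cV[K]_m) x r M
    (D : 'I_m -> 'rV[K]_n) : 0 < r ->
  (forall j, power_series_ord 2 r
    (fun h => f (x + h) j 0 - (f (x + 0) j 0 + (D j *m h) 0 0)) M) ->
  forall h, vnorm h < r -> vnorm (f (x + h) - f x - (\matrix_(j, i) D j 0 i) *m h)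
    <= `|\sum_(j < m) M / r ^+ 2| * vnorm h ^+ 2.
Proof.
move=> r0 HD h hr.
apply: (@le_trans _ _ ((\sum_(j < m) M / r ^+ 2) * vnorm h ^+ 2)); last first.
  rewrite ler_wpM2r ?exprn_ge0 ?vnorm_ge0 // ger0_norm // sumr_ge0 // => j _.
  by rewrite divr_ge0 ?exprn_ge0 ?(ltW r0) // (power_series_ge0 (power_series_ordW (HD j))).
rewrite mulr_suml /vnorm ler_sum // => j _.
have hb : in_box r h by move=> i; exact: le_lt_trans (le_vnorm _ _) hr.
have := power_series_ord2_bound r0 (vnorm_ge0 h) (ltW hr) (HD j) hb (le_vnorm h).
rewrite addr0 expr_div_n mulrA mulrAC; congr (_ <= _); congr (`| _ |).
rewrite !mxE opprD addrA; congr (_ - _ - _); apply: eq_bigr => i _.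
by rewrite mxE.
Qed.

(** One constant serves all x near a; [jacobian0_locally_constant] adds up many
    remainders and relies on this uniformity. *)
Lemma analytic_taylor n m (f : 'cV[K]_n -> 'cV[K]_m) a : analytic_at f a ->
  exists C r, [/\ 0 < r, 0 <= C & forall x, vnorm (x - a) < r -> exists D,
    forall h, vnorm h < r -> vnorm (f (x + h) - f x - D *m h) <= C * vnorm h ^+ 2].
Proof.
move=> /(analytic_at_uniform K_complete)[r [M [r0 H]]].
exists (`|\sum_(j < m) M / r ^+ 2|), r; split => // x xr.
have xb : in_box r (x - a) by move=> i; exact: le_lt_trans (le_vnorm _ _) xr.
have /choice[D HD] : forall j, exists D : 'rV[K]_n, power_series_ord 2 r
    (fun h => f (x + h) j 0 - (f (x + 0) j 0 + (D *m h) 0 0)) M.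
  by move=> j; exact: power_series_taylor r0 (H x xb j).
by exists (\matrix_(j, i) D j 0 i); exact: power_series_taylor_vnorm.
Qed.

Lemma analytic_jacobian n m (f : 'cV[K]_n -> 'cV[K]_m) a : analytic_at f a ->
  exists D, jacobian f a D.
Proof.
move=> /analytic_taylor[C [r [r0 C0 H]]].
have [|D HD] := H a; first by rewrite subrr vnorm0.
by exists D, C, r.
Qed.

Hypothesis K_arch : archimedean_norm K.

(** Cut the segment from a to x into N steps: each changes f by at most
    C (|x - a| / N) ^ 2, so that the total change is O(1 / N). *)
Lemma jacobian0_locally_constant n m (f : 'cV[K]_n -> 'cV[K]_m) a : analytic_at f a ->
  (\forall x \near a, jacobian f x 0) -> \forall x \near a, f x = f a.
Proof.
move=> /analytic_taylor[C [r [r0 C0 H]]] /nbhs_vnormP[s s0 J0].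
have [t [t0 tr ts]] := exists_pos_le2 r0 s0.
apply/nbhs_vnormP; exists t => // x xt.
have quad y h : vnorm (y - a) < t -> vnorm h < t ->
    vnorm (f (y + h) - f y) <= C * vnorm h ^+ 2.
  move=> yt ht; have [D HD] := H y (lt_le_trans yt tr).
  have D0 : D = 0.
    by apply: jacobian_unique (J0 y (lt_le_trans yt ts)); exists C, r.
  by have := HD h (lt_le_trans ht tr); rewrite D0 mul0mx subr0.
set v := x - a in xt.
(* k steps of length |v| / (N + 1) *)
have step N k : (k <= N.+1)%N ->
    vnorm (f (a + (k%:R / N.+1%:R) *: v) - f a) <= k%:R * (C * (vnorm v / N.+1%:R) ^+ 2).
  have small : forall c : K, 0 <= c -> c <= 1 -> vnorm (c *: v) < t.
    move=> c c0 c1; rewrite vnormZ ger0_norm // (le_lt_trans _ xt) //.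
    by rewrite ler_piMl // vnorm_ge0.
  elim: k => [_|k IH kN]; first by rewrite !mul0r scale0r addr0 subrr vnorm0.
  have -> : a + (k.+1%:R / N.+1%:R) *: v =
      (a + (k%:R / N.+1%:R) *: v) + (1 / N.+1%:R) *: v.
    by rewrite -addrA -scalerDl -mulrDl natr1.
  rewrite -(subrK (f (a + (k%:R / N.+1%:R) *: v)) (f (_ + _ *: v))) -addrA.
  rewrite (le_trans (vnormD _ _)) // -[k.+1%:R]natr1 mulrDl mul1r [leRHS]addrC lerD //.
    2: by apply: IH; exact: ltnW.
  apply: le_trans (quad _ _ _ _) _.
  - rewrite addrC addKr small ?divr_ge0 // ler_pdivrMr // mul1r ler_nat.
    exact: ltnW.
  - by rewrite small ?invr_ge0 // invf_le1 // ler1n.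
  - by rewrite mul1r vnormZ ger0_norm ?invr_ge0 // [_^-1 * _]mulrC.
apply/eqP; rewrite -subr_eq0; apply/eqP/vnorm_eq0; apply: normr_le_eps_eq0 => e e0.
rewrite ger0_norm ?vnorm_ge0 //.
have [N HN] := K_arch (divr_ge0 (mulr_ge0 C0 (exprn_ge0 2 (vnorm_ge0 v))) (ltW e0)).
have := step N N.+1 (leqnn _); rewrite divff ?scale1r; last by rewrite pnatr_eq0.
rewrite /v [a + _]addrC subrK -/v => /le_trans; apply.
have -> : N.+1%:R * (C * (vnorm v / N.+1%:R) ^+ 2) = C * vnorm v ^+ 2 / N.+1%:R.
  by field; rewrite addrC natr1 pnatr_eq0.
rewrite ler_pdivrMr // [leRHS]mulrC -ler_pdivrMr // (le_trans HN) // ler_nat //.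
Qed.

End Jacobian.

(** * Local right inverses *)

Section InverseFunction.
Local Open Scope fset_scope.
Local Open Scope ring_scope.
Variable K : numFieldType.
Hypothesis K_complete : summation_complete K.

Definition segment (N : nat) : {fset nat} := [fset k in iota 0 N].

Lemma in_segment N k : (k \in segment N) = (k < N)%N.
Proof. by rewrite !inE mem_iota. Qed.

Lemma big_segment N (w : nat -> K) : \sum_(k <- segment N) w k = \sum_(k < N) w k.
Proof.
elim: N => [|N IH].
  rewrite big_ord0 (_ : segment 0 = fset0) ?big_seq_fset0 //.
  by apply/fsetP => k; rewrite in_segment inE.
rewrite big_ord_recr /= -IH (_ : segment N.+1 = N |` segment N).
  by rewrite big_fsetU1 ?in_segment ?ltnn //= addrC.
by apply/fsetP => k; rewrite in_fset1U !in_segment ltnS leq_eqVlt.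
Qed.

Lemma segment_cofinal (t : {fset nat}) :
  exists N0, forall N, (N0 <= N)%N -> t `<=` segment N.
Proof.
exists (\max_(k <- t) k).+1 => N HN; apply/fsubsetP => k kt.
by rewrite in_segment (leq_trans _ HN) // ltnS leq_bigmax_seq.
Qed.

(** Bounds the increments of the fixed point iteration. *)
Lemma geometric_bound (s : K) : 0 <= s -> abs_bound (fun k : nat => s / 2 ^+ k) (2 * s).
Proof.
move=> s0 t; have [N /(_ _ (leqnn N)) tN] := segment_cofinal t.
have q0 k : 0 <= s / 2 ^+ k by rewrite divr_ge0 // exprn_ge0.
apply: le_trans (ler_sum_fsubset _ tN) _ => //; rewrite big_segment.
suff -> : \sum_(k < N) `|s / 2 ^+ k| = 2 * s - 2 * (s / 2 ^+ N).
  by rewrite gerBl mulr_ge0.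
elim: N {tN} => [|N IH]; first by rewrite big_ord0 expr0 divr1 subrr.
rewrite big_ord_recr /= IH ger0_norm // exprS.
by field; rewrite expf_neq0 // pnatr_eq0.
Qed.

(** With f = id + rem and rem of order two, f u = y means u = y - rem(u).  The
    iteration for this equation contracts by 1/2 in the Banach algebra of
    series on a small polydisc, so its limit is again a power series. *)
Lemma right_inverse_series n (f : 'cV[K]_n -> 'cV[K]_n) :
  analytic_at f 0 -> f 0 = 0 -> jacobian f 0 1%:M ->
  exists u s, [/\ 0 < s, analytic_at u 0, u 0 = 0 &
    forall y, in_box s y -> f (u y) = y].
Proof.
move=> /(analytic_atP K_complete)[r [M [r0 fM]]] f0 J1.
have /choice[D HD] : forall j, exists D : 'rV[K]_n, power_series_ord 2 r
    (fun h => f (0 + h) j 0 - (f (0 + 0) j 0 + (D *m h) 0 0)) M.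
  by move=> j; exact: power_series_taylor r0 (fM j).
have D1 : \matrix_(j, i) D j 0 i = 1%:M.
  apply: jacobian_unique J1; exists (`|\sum_(j < n) M / r ^+ 2|), r.
  by split=> //; exact: power_series_taylor_vnorm.
(* f is the identity plus a remainder of order two *)
pose rem j (x : 'cV[K]_n) := f x j 0 - x j 0.
have {}HD j : power_series_ord 2 r (rem j) M.
  have E : rem j = (fun h => f (0 + h) j 0 - (f (0 + 0) j 0 + (D j *m h) 0 0)).
    apply/funext => x; rewrite /rem !add0r f0 [(0 : 'cV_n) j 0]mxE add0r; congr (_ - _).
    rewrite -[x in LHS]mul1mx -D1 !mxE; apply: eq_bigr => i _.
    by rewrite mxE.
  by rewrite E.
(* in dimension 0 there is no component, and M may be negative *)
have [M0|n0] : 0 <= M \/ n = 0%N.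
    case: n f rem HD {fM f0 J1 D D1} => [|n] f rem HD; [by right|left].
    exact: power_series_ge0 (power_series_ordW (HD ord0)).
  2: { by subst n; exists id, 1; split=> // [|y _]; [exact: analytic_id|apply/matrixP => -[]]. }
have M1 : 0 < M + 1 by rewrite ltr_wpDl.
(* rho bounds all iterates: 2 rho <= r and the Lipschitz constant is at most 1/2;
   the increments s / 2 ^ k then sum to 2 s = rho *)
have [rho [rho0 rho1 rho2]] := exists_pos_le2 (divr_gt0 r0 (ltr0n K 2))
  (divr_gt0 (exprn_gt0 2 r0) (mulr_gt0 (ltr0n K 8) M1)).
have {rho1} rhor : 2 * rho <= r by rewrite mulrC -ler_pdivlMr.
have {rho2} Lhalf : 4 * M * rho / r ^+ 2 <= 1 / 2.
  rewrite ler_pdivrMr ?exprn_gt0 // mulrAC div1r ler_pdivlMl //.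
  move: rho2; rewrite ler_pdivlMr ?mulr_gt0 // => h; rewrite (le_trans _ h) //.
  rewrite (_ : 2 * _ = rho * (8 * M)); last by ring.
  by rewrite ler_pM2l // ler_pM2l // lerDl.
pose s := rho / 2; have s0 : 0 < s by rewrite divr_gt0.
have s2 : 2 * s = rho by rewrite mulrC divfK // pnatr_eq0.
pose u := fix u k : 'cV[K]_n -> 'cV[K]_n :=
  if k is k'.+1 then fun y => \col_j (y j 0 - rem j (u k' y)) else fun _ => 0.
have rem0 j : rem j 0 = 0 by rewrite /rem f0 subrr.
have d0 k : 0 <= s / 2 ^+ k by rewrite divr_ge0 ?exprn_ge0 // ltW.
have Hu k : (forall j, power_series s (fun y => u k y j 0) (2 * s - 2 * (s / 2 ^+ k))) /\
    (forall j, power_series s (fun y => u k.+1 y j 0 - u k y j 0) (s / 2 ^+ k)).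
  elim: k => [|k [IH1 IH2]].
    split=> j.
      rewrite expr0 divr1 subrr; have := power_series_cst n 0 s0; rewrite normr0.
      by apply: power_series_ext => x _; rewrite mxE.
    rewrite expr0 divr1; apply: power_series_ext (power_series_coord j s0) => x _.
    by rewrite /= !mxE rem0 !subr0.
  have IH3 j : power_series s (fun y => u k.+1 y j 0) (2 * s - 2 * (s / 2 ^+ k.+1)).
    have := power_seriesD (IH2 j) (IH1 j).
    have -> : s / 2 ^+ k + (2 * s - 2 * (s / 2 ^+ k)) = 2 * s - 2 * (s / 2 ^+ k.+1).
      by rewrite exprS; field; rewrite expf_neq0 // pnatr_eq0.
    by apply: power_series_ext => x _; rewrite subrK.
  have le_rho l : 2 * s - 2 * (s / 2 ^+ l) <= rho by rewrite s2 gerBl mulr_ge0.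
  split=> // j.
  have := power_series_ord2_compB K_complete s0 rho0 (d0 k) rhor (HD j)
    (fun j => power_series_weaken (le_rho _) (IH3 j))
    (fun j => power_series_weaken (le_rho _) (IH1 j)) IH2.
  move/(power_series_weaken (ler_wpM2r (d0 k) Lhalf)) => /(power_seriesZ (-1)).
  rewrite normrN1 mul1r (_ : 1 / 2 * _ = s / 2 ^+ k.+1); last first.
    by rewrite exprS; field; rewrite expf_neq0 // pnatr_eq0.
  by apply: power_series_ext => x _; rewrite [in RHS]/= !mxE /=; ring.
have telescope j y k : \sum_(i < k) (u i.+1 y j 0 - u i y j 0) = u k y j 0.
  elim: k => [|k IH]; first by rewrite big_ord0 mxE.
  by rewrite big_ord_recr /= IH addrC subrK.
have ub j y : in_box s y -> abs_bound (fun k => u k.+1 y j 0 - u k y j 0) (2 * s).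
  move=> ys; apply: abs_bound_sub (geometric_bound (ltW s0)) => k.
  rewrite (le_trans (power_series_bound s0 ((Hu k).2 j) ys)) //.
  by rewrite ger0_norm.
have /choice[U0 HU0] : forall jy : 'I_n * 'cV[K]_n, exists S, in_box s jy.2 ->
    has_sum (fun k => u k.+1 jy.2 jy.1 0 - u k jy.2 jy.1 0) S.
  move=> [j y]; case: (pselect (in_box s y)) => [ys|]; last by exists 0.
  by have [S HS] := K_complete (ub j y ys); exists S.
pose U y : 'cV[K]_n := \col_j U0 (j, y).
have HU j y : in_box s y -> has_sum (fun k => u k.+1 y j 0 - u k y j 0) (U y j 0).
  by move=> ys; have -> : U y j 0 = U0 (j, y) by [rewrite mxE]; exact: (HU0 (j, y)).
have PU j : power_series s (fun y => U y j 0) rho.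
  rewrite -s2; apply: (power_series_sum (f := fun k y => u k.+1 y j 0 - u k y j 0)
    K_complete s0 (fun k => (Hu k).2 j)).
    exact: geometric_bound (ltW s0).
  by move=> x xs; exact: HU.
have z0 : in_box s (0 : 'cV[K]_n) by move=> i; rewrite mxE normr0.
have fU y : in_box s y -> f (U y) = y.
  move=> ys; apply/matrixP => j i; rewrite ord1 {i}.
  apply/eqP; rewrite -subr_eq0; apply/eqP; apply: normr_le_eps_eq0 => e e0.
  have e20 : 0 < e / 2 by rewrite divr_gt0.
  have [N HN] : exists N, forall k, (N <= k)%N -> forall j, `|u k y j 0 - U y j 0| <= e / 2.
    have /choice[N HN] : forall j, exists N, forall k, (N <= k)%N ->
        `|u k y j 0 - U y j 0| <= e / 2.
      move=> j'; have [t Ht] := HU j' y ys _ e20; have [N HN] := segment_cofinal t.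
      by exists N => k /HN /Ht; rewrite big_segment telescope.
    exists (\max_j N j) => k Nk j'; apply: HN; apply: leq_trans Nk.
    exact: (leq_bigmax j').
  have uk j' : power_series s (fun _ : 'cV[K]_n => u N y j' 0) rho.
    apply: power_series_weaken (power_series_cst n _ s0).
    by rewrite (le_trans (power_series_bound s0 ((Hu N).1 j') ys)) // s2 gerBl mulr_ge0.
  have Uk j' : power_series s (fun _ : 'cV[K]_n => U y j' 0) rho.
    apply: power_series_weaken (power_series_cst n _ s0).
    exact: power_series_bound s0 (PU j') ys.
  have uU j' : power_series s (fun _ : 'cV[K]_n => u N y j' 0 - U y j' 0) (e / 2).
    by apply: power_series_weaken (power_series_cst n _ s0); exact: HN.
  have := power_series_ord2_compB K_complete s0 rho0 (ltW e20) rhor (HD j) uk Uk uU.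
  move/(power_series_weaken (ler_wpM2r (ltW e20) Lhalf)) => /(power_series_bound s0)/(_ z0) h1.
  have h2 := HN N.+1 (leqnSn N) j.
  rewrite (_ : _ - _ = - ((u N.+1 y j 0 - U y j 0) + (rem j (u N y) - rem j (U y)))).
    rewrite normrN (le_trans (ler_normD _ _)) // (splitr e) lerD // (le_trans h1) //.
    by rewrite ler_piMl ?(ltW e20) // ler_pdivrMr // mul1r ler1n.
  by rewrite /= mxE /rem; ring.
exists U, s; split=> //.
- apply/(analytic_atP K_complete); exists s, rho; split=> // j.
  by apply: power_series_ext (PU j) => x _; rewrite add0r.
- apply/matrixP => j i; rewrite ord1 {i} [RHS]mxE; apply: has_sum_unique (HU j _ z0) _.
  have u0 k : u k 0 = 0.
    elim: k => //= k ->; by apply/matrixP => i l; rewrite ord1 !mxE rem0 subrr.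
  by apply: (has_sum_ext _ (@has_sum0 K _)) => k; rewrite !u0 mxE subrr.
Qed.

End InverseFunction.

(** * The inverse function theorem *)

Lemma open_inter_preimage (X Y : topologicalType) (A : set X) (B : set Y) (f : X -> Y) :
  open A -> open B -> (forall x, A x -> {for x, continuous f}) ->
  open [set x | A x /\ B (f x)].
Proof.
move=> oA oB cf; rewrite openE => x [Ax Bfx].
apply: filterI; first exact: open_nbhs_nbhs.
by apply: cf => //; exact: open_nbhs_nbhs.
Qed.

Section InverseFunctionTheorem.
Variable K : numFieldType.
Hypothesis K_complete : summation_complete K.

(** Inverse germs are made into inverse maps of open sets by intersecting the
    domain of each with the preimage of the domain of the other. *)
Lemma near_inverse n p (f : 'cV[K]_p -> 'cV[K]_n) (g : 'cV[K]_n -> 'cV[K]_p) a :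
  analytic_at f a -> analytic_at g (f a) ->
  (\forall x \near a, g (f x) = x) -> (\forall y \near f a, f (g y) = y) ->
  exists U V, [/\ open U /\ U a, open V /\ V (f a),
    forall x, U x -> V (f x) /\ g (f x) = x,
    forall y, V y -> U (g y) /\ f (g y) = y &
    analytic_on U f /\ analytic_on V g].
Proof.
move=> fa ga gf fg.
pose A := interior [set x | analytic_at f x /\ g (f x) = x].
pose B := interior [set y | analytic_at g y /\ f (g y) = y].
have oA : open A := @open_interior _ _.
have oB : open B := @open_interior _ _.
have Aa : A a by apply: filterI gf; exact: analytic_at_near.
have Ba : B (f a) by apply: filterI fg; exact: analytic_at_near.
have HA x : A x -> analytic_at f x /\ g (f x) = x by move/interior_subset.
have HB x : B x -> analytic_at g x /\ f (g x) = x by move/interior_subset.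
have gfa := nbhs_singleton gf.
exists [set x | A x /\ B (f x)], [set y | B y /\ A (g y)]; split.
- split=> //; apply: open_inter_preimage => // x /HA[fx _].
  exact: analytic_continuous K_complete _ _ _ _ fx.
- split; last by rewrite /= gfa.
  by apply: open_inter_preimage => // x /HB[gx _]; exact: analytic_continuous gx.
- by move=> x [Ax Bfx]; have [_ E] := HA x Ax; rewrite /= E.
- by move=> y [By Agy]; have [_ E] := HB y By; rewrite /= E.
- by split=> x []; [move=> /HA[]|move=> /HB[]].
Qed.

(** A right inverse u of the normalized map F has itself a right inverse v, and
    then F = F u v = v near 0, so that u is a two-sided inverse.  The inverse
    D' of D is an argument because p and n are equal, but not convertible, in the
    applications. *)
Theorem inverse_function n p (f : 'cV[K]_p -> 'cV[K]_n) a D D' :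
  analytic_at f a -> jacobian f a D -> D *m D' = 1%:M -> D' *m D = 1%:M ->
  exists U V g, [/\ open U /\ U a, open V /\ V (f a),
    forall x, U x -> V (f x) /\ g (f x) = x,
    forall y, V y -> U (g y) /\ f (g y) = y &
    analytic_on U f /\ analytic_on V g].
Proof.
move=> fa fJ DD' D'D.
pose F h := D' *m (f (a + h) - f a).
have E h : F h = D' *m f (1%:M *m h + a) + - (D' *m f a).
  by rewrite /F mulmxBr mul1mx [a + h]addrC.
have a0 : 1%:M *m 0 + a = a by rewrite mulmx0 add0r.
have fa0 : analytic_at f (1%:M *m 0 + a) by rewrite a0.
have fJ0 : jacobian f (1%:M *m 0 + a) D by rewrite a0.
have F0 : F 0 = 0 by rewrite /F addr0 subrr mulmx0.
have FA : analytic_at F 0.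
  have h1 := analytic_comp K_complete (analytic_affine K_complete 1%:M a 0) fa0.
  have h2 := analytic_comp K_complete h1 (analytic_affine K_complete D' (- (D' *m f a)) _).
  by apply: analytic_at_eq h2 => x /=; rewrite E.
have FJ : jacobian F 0 1%:M.
  have h1 := jacobian_comp (jacobian_affine 1%:M a 0) fJ0.
  have h2 := jacobian_comp h1 (jacobian_affine D' (- (D' *m f a)) _).
  rewrite mulmx1 D'D in h2; by apply: jacobian_eq h2 => x /=; rewrite E.
have [u [s [s0 uA u0 Fu]]] := right_inverse_series K_complete FA F0 FJ.
have [Du uJ] := analytic_jacobian K_complete uA.
have uJ1 : jacobian u 0 1%:M.
  suff <- : Du = 1%:M by [].
  rewrite -[Du]mul1mx; apply: (jacobian_unique _ (jacobian_id 0)).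
  have FJ' : jacobian F (u 0) 1%:M by rewrite u0.
  apply: jacobian_ext (jacobian_comp uJ FJ').
  by apply/nbhs_boxP; exists s => // x xs; apply: Fu => i; have := xs i; rewrite subr0.
have [v [t [t0 vA v0 uv]]] := right_inverse_series K_complete uA u0 uJ1.
have uF : \forall h \near (0 : 'cV[K]_p), u (F h) = h.
  have /continuous_boxP/(_ s s0)[t' t'0 vs] := analytic_continuous K_complete vA.
  have [q [q0 qt qt']] := exists_pos_le2 t0 t'0.
  apply/nbhs_boxP; exists q => // h hq.
  have ht : in_box t h by move=> i; have := hq i; rewrite subr0 => /lt_le_trans; apply.
  have hs : in_box s (v h).
    move=> i; have := vs h (fun j => lt_le_trans (hq j) qt') i.
    by rewrite v0 subr0.
  by rewrite -{1}(uv h ht) Fu // uv.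
pose g y := u (D' *m (y - f a)) + a.
have gE y : g y = u (D' *m y + - (D' *m f a)) + a by rewrite /g mulmxBr.
have gA : analytic_at g (f a).
  have uA' : analytic_at u (D' *m f a + - (D' *m f a)) by rewrite subrr.
  have h1 := analytic_comp K_complete (analytic_affine K_complete D' (- (D' *m f a)) _) uA'.
  have h2 := analytic_comp K_complete h1 (analytic_affine K_complete 1%:M a _).
  by apply: analytic_at_eq h2 => y /=; rewrite gE mul1mx.
have [||U [V [oU oV UV VU an]]] := @near_inverse _ _ f g a fa gA.
- move: uF => /nbhs_boxP[q q0 Hq]; apply/nbhs_boxP; exists q => // x xq.
  have := Hq (x - a); rewrite subr0 => /(_ xq).
  by rewrite /F [a + _]addrC subrK /g => ->; rewrite subrK.
- have : \forall y \near f a, in_box s (D' *m y + - (D' *m f a)).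
    have := analytic_continuous K_complete (analytic_affine K_complete D' (- (D' *m f a)) (f a)).
    move=> /continuous_boxP/(_ s s0)[q q0 Hq]; apply/nbhs_boxP; exists q => // y /Hq.
    by rewrite subrr subr0.
  apply: filterS => y ys; have := Fu _ ys.
  rewrite /F -mulmxBr => /(congr1 (mulmx D)); rewrite !mulmxA DD' !mul1mx.
  move=> /(congr1 (fun z => z + f a)); rewrite !subrK /g => {2}<-.
  by rewrite mulmxBr [_ + a]addrC.
by exists U, V, g.
Qed.

End InverseFunctionTheorem.

(** * Analytic maps between manifolds *)

Section AnalyticMaps.
Variable K : numFieldType.
Hypothesis K_complete : summation_complete K.

Section Charts.
Variables (n : nat) (X : topologicalType) (c : chart K n X).
Hypothesis c_chart : is_chart c.

Lemma chart_dom_open : open (chart_dom c). Proof. by case: c_chart => -[]. Qed.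
Lemma chart_cod_open : open (chart_cod c). Proof. by case: c_chart => -[]. Qed.

Lemma chart_mapK x : chart_dom c x -> chart_inv c (chart_map c x) = x.
Proof. by case: c_chart => _ H _ _ _ /H[]. Qed.
Lemma chart_invK v : chart_cod c v -> chart_map c (chart_inv c v) = v.
Proof. by case: c_chart => _ _ H _ _ /H[]. Qed.
Lemma chart_map_cod x : chart_dom c x -> chart_cod c (chart_map c x).
Proof. by case: c_chart => _ H _ _ _ /H[]. Qed.
Lemma chart_inv_dom v : chart_cod c v -> chart_dom c (chart_inv c v).
Proof. by case: c_chart => _ _ H _ _ /H[]. Qed.

Lemma chart_map_continuous x : chart_dom c x -> {for x, continuous (chart_map c)}.
Proof.
case: c_chart => _ _ _ + _; rewrite continuous_open_subspace; last exact: chart_dom_open.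
by move=> H xc; apply: H; exact: mem_set.
Qed.

Lemma chart_inv_continuous v : chart_cod c v -> {for v, continuous (chart_inv c)}.
Proof.
case: c_chart => _ _ _ _; rewrite continuous_open_subspace; last exact: chart_cod_open.
by move=> H vc; apply: H; exact: mem_set.
Qed.

Lemma chart_dom_nbhs x : chart_dom c x -> nbhs x (chart_dom c).
Proof. by move=> xc; apply: open_nbhs_nbhs; split=> //; exact: chart_dom_open. Qed.

Lemma chart_cod_nbhs v : chart_cod c v -> nbhs v (chart_cod c).
Proof. by move=> xc; apply: open_nbhs_nbhs; split=> //; exact: chart_cod_open. Qed.

Lemma near_chart_inv x (P : set X) : chart_dom c x -> nbhs x P ->
  \forall v \near chart_map c x, P (chart_inv c v).
Proof.
move=> xc xP; apply: chart_inv_continuous; first exact: chart_map_cod.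
by rewrite chart_mapK.
Qed.

End Charts.

(** The part of a manifold structure that suffices to compose analytic maps; it
    is also available for product atlases. *)
Definition is_atlas n (X : topologicalType) (A : set (chart K n X)) : Prop :=
  (forall c, A c -> is_chart c) /\ (forall x, exists2 c, A c & chart_dom c x).

Lemma manifold_atlas n (X : topologicalType) (A : set (chart K n X)) :
  is_manifold A -> is_atlas A.
Proof. by case=> _ _ ? ? _. Qed.

(** The coordinate space is treated as a manifold with one chart, so that charts,
    sections and coordinate functions are all maps of the same kind. *)
Definition vec_chart n : chart K n 'cV[K]_n := Chart setT setT id id.
Definition vec_atlas n : set (chart K n 'cV[K]_n) := [set vec_chart n].
Arguments vec_atlas : clear implicits.

Lemma vec_atlas_atlas n : is_atlas (vec_atlas n).
Proof.
split=> [_ ->|x]; last by exists (vec_chart n).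
split=> //=; first by split; exact: openT.
  by apply: continuous_subspaceT => x; exact: cvg_id.
by apply: continuous_subspaceT => x; exact: cvg_id.
Qed.

(** The pointwise version of [analytic_map]. *)
Definition analytic_between n m (X Y : topologicalType)
    (A : set (chart K n X)) (B : set (chart K m Y)) (f : X -> Y) (x : X) : Prop :=
  {for x, continuous f} /\
  forall c c', A c -> B c' -> chart_dom c x -> chart_dom c' (f x) ->
    analytic_at (chart_map c' \o f \o chart_inv c) (chart_map c x).

Section Between.
Variables (n m p : nat) (X Y Z : topologicalType).
Variables (A : set (chart K n X)) (B : set (chart K m Y)) (C : set (chart K p Z)).
Hypotheses (A_atlas : is_atlas A) (B_atlas : is_atlas B).

Lemma analytic_between_comp (f : X -> Y) (g : Y -> Z) x :
  analytic_between A B f x -> analytic_between B C g (f x) ->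
  analytic_between A C (g \o f) x.
Proof.
move=> [cf af] [cg ag]; split; first exact: continuous_comp.
move=> c c'' Ac Cc'' xc gfx; have [c' Bc' fxc'] := B_atlas.2 (f x).
have fE : chart_inv c (chart_map c x) = x := chart_mapK (A_atlas.1 c Ac) xc.
have h1 := af c c' Ac Bc' xc fxc'.
have h2 := ag c' c'' Bc' Cc'' fxc' gfx.
have h2' : analytic_at (chart_map c'' \o g \o chart_inv c')
  ((chart_map c' \o f \o chart_inv c) (chart_map c x)) by rewrite /= fE.
apply: analytic_at_ext (analytic_comp K_complete h1 h2') => //.
have := near_chart_inv (A_atlas.1 c Ac) xc (cf _ (chart_dom_nbhs (B_atlas.1 c' Bc') fxc')).
by apply: filterS => v /= h; rewrite (chart_mapK (B_atlas.1 c' Bc')).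
Qed.

Lemma analytic_between_cst (y : Y) x : analytic_between A B (fun _ => y) x.
Proof. by split=> [|c c' _ _ _ _]; [exact: cvg_cst|exact: analytic_cst]. Qed.

End Between.

Lemma analytic_between_vec n m (f : 'cV[K]_n -> 'cV[K]_m) a :
  analytic_between (vec_atlas n) (vec_atlas m) f a <-> analytic_at f a.
Proof.
split=> [[_ /(_ _ _ erefl erefl I I)]//|fa].
by split=> [|_ _ -> -> _ _ //]; exact: analytic_continuous fa.
Qed.

Section Manifold.
Variables (n : nat) (X : topologicalType) (A : set (chart K n X)).
Hypothesis A_man : is_manifold A.
Let A_atlas := manifold_atlas A_man.

Lemma transition_analytic c c' x : A c -> A c' -> chart_dom c x -> chart_dom c' x ->
  analytic_at (chart_map c' \o chart_inv c) (chart_map c x).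
Proof.
by case: A_man => _ _ _ _ H Ac Ac' xc xc'; apply: (H c c' Ac Ac'); exists x.
Qed.

Lemma analytic_between_id x : analytic_between A A id x.
Proof.
by split=> [|c c' Ac Ac' xc xc']; [exact: cvg_id|exact: transition_analytic].
Qed.

Lemma analytic_between_chart_map c x : A c -> chart_dom c x ->
  analytic_between A (vec_atlas n) (chart_map c) x.
Proof.
move=> Ac xc; split; first exact: (chart_map_continuous (A_atlas.1 c Ac)).
by move=> c' _ Ac' -> xc' _; exact: transition_analytic.
Qed.

Lemma analytic_between_chart_inv c v : A c -> chart_cod c v ->
  analytic_between (vec_atlas n) A (chart_inv c) v.
Proof.
move=> Ac vc; have Hc := A_atlas.1 c Ac.
split; first exact: (chart_inv_continuous Hc).
move=> _ c' -> Ac' _ vc'; have := transition_analytic Ac Ac' (chart_inv_dom Hc vc) vc'.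
by rewrite (chart_invK Hc).
Qed.

End Manifold.

Lemma continuous_col_mx n m (T : topologicalType) (f : T -> 'cV[K]_n) (g : T -> 'cV[K]_m) z :
  {for z, continuous f} -> {for z, continuous g} ->
  {for z, continuous (fun t => col_mx (f t) (g t))}.
Proof.
move=> cf cg U /nbhs_boxP[r r0 HU].
have Hf : nbhs (f z) [set y | in_box r (y - f z)] by apply/nbhs_boxP; exists r.
have Hg : nbhs (g z) [set y | in_box r (y - g z)] by apply/nbhs_boxP; exists r.
have {}Hf : nbhs z [set t | in_box r (f t - f z)] := cf _ Hf.
have {}Hg : nbhs z [set t | in_box r (g t - g z)] := cg _ Hg.
rewrite nbhs_simpl; apply: filterS (filterI Hf Hg) => t /= [ft gt]; apply: HU => i.
rewrite opp_col_mx add_col_mx; case: (splitP i) => k ik.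
  by rewrite (_ : i = lshift m k) ?col_mxEu; [exact: ft|exact: val_inj].
by rewrite (_ : i = rshift n k) ?col_mxEd; [exact: gt|exact: val_inj].
Qed.

Lemma continuous_usubmx n m (v : 'cV[K]_(n + m)) : {for v, continuous (@usubmx K n m 1)}.
Proof.
by apply/continuous_boxP => e e0; exists e => // w wv i; have := wv (lshift m i); rewrite !mxE.
Qed.

Lemma continuous_dsubmx n m (v : 'cV[K]_(n + m)) : {for v, continuous (@dsubmx K n m 1)}.
Proof.
by apply/continuous_boxP => e e0; exists e => // w wv i; have := wv (rshift n i); rewrite !mxE.
Qed.

Lemma continuous_pair (T X Y : topologicalType) (f : T -> X) (g : T -> Y) z :
  {for z, continuous f} -> {for z, continuous g} ->
  {for z, continuous (fun t => (f t, g t))}.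
Proof. by move=> cf cg; exact: cvg_pair. Qed.

Section Product.
Variables (n m p : nat) (X Y Z : topologicalType).
Variables (A : set (chart K n X)) (B : set (chart K m Y)) (C : set (chart K p Z)).
Hypotheses (A_atlas : is_atlas A) (B_atlas : is_atlas B).

Lemma prod_chart_chart (c : chart K n X) (c' : chart K m Y) :
  is_chart c -> is_chart c' -> is_chart (prod_chart c c').
Proof.
move=> Hc Hc'.
have oD : open (chart_dom c `*` chart_dom c').
  rewrite openE => -[x y] [/= xc yc'].
  by exists (chart_dom c, chart_dom c') => //=; split; apply: chart_dom_nbhs.
have oC : open [set v : 'cV[K]_(n + m) | chart_cod c (usubmx v) /\ chart_cod c' (dsubmx v)].
  rewrite openE => v [/= vu vd]; apply: filterI.
    by apply: continuous_usubmx; exact: chart_cod_nbhs.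
  by apply: continuous_dsubmx; exact: chart_cod_nbhs.
split=> //.
- move=> [x y] [/= xc yc']; rewrite col_mxKu col_mxKd; split.
    by split; exact: chart_map_cod.
  by rewrite !chart_mapK.
- move=> v [/= vu vd]; split; first by split; exact: chart_inv_dom.
  by rewrite !chart_invK // vsubmxK.
- rewrite continuous_open_subspace // => -[x y] /set_mem[/= xc yc'].
  apply: (@continuous_col_mx _ _ _ (chart_map c \o fst) (chart_map c' \o snd)).
    by apply: continuous_comp; [exact: cvg_fst|exact: chart_map_continuous].
  by apply: continuous_comp; [exact: cvg_snd|exact: chart_map_continuous].
- rewrite continuous_open_subspace // => v /set_mem[/= vu vd].
  apply: (@continuous_pair _ _ _ (chart_inv c \o @usubmx K n m 1)
    (chart_inv c' \o @dsubmx K n m 1)).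
    by apply: continuous_comp; [exact: continuous_usubmx|exact: chart_inv_continuous].
  by apply: continuous_comp; [exact: continuous_dsubmx|exact: chart_inv_continuous].
Qed.

Lemma prod_atlas_atlas : is_atlas (prod_atlas A B).
Proof.
split=> [_ [c [c' [Ac Bc' ->]]]|[x y]].
  by apply: prod_chart_chart; [exact: A_atlas.1|exact: B_atlas.1].
have [c Ac xc] := A_atlas.2 x; have [c' Bc' yc'] := B_atlas.2 y.
by exists (prod_chart c c') => //; exists c, c'.
Qed.

Lemma analytic_between_pair (f : Z -> X) (g : Z -> Y) z :
  analytic_between C A f z -> analytic_between C B g z ->
  analytic_between C (prod_atlas A B) (fun t => (f t, g t)) z.
Proof.
move=> [cf af] [cg ag]; split; first exact: continuous_pair.
move=> c _ Cc [c1 [c2 [Ac1 Bc2 ->]]] zc [/= fz gz].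
exact: analytic_col_mx (af c c1 Cc Ac1 zc fz) (ag c c2 Cc Bc2 zc gz).
Qed.

End Product.

Lemma analytic_map_between n m (X Y : topologicalType)
    (A : set (chart K n X)) (B : set (chart K m Y)) (f : X -> Y) :
  analytic_map A B f -> forall x, analytic_between A B f x.
Proof. by move=> [cf af] x; split=> [|c c'] ; [exact: cf|exact: af]. Qed.

End AnalyticMaps.
Arguments vec_atlas : clear implicits.

(** * Maps of constant rank *)

Lemma nbhs_weaken (T : topologicalType) (x : T) (P Q : set T) :
  (forall y, P y -> Q y) -> nbhs x P -> nbhs x Q.
Proof. by move=> PQ; exact: filterS. Qed.

Lemma nbhs_and (T : topologicalType) (x : T) (P Q : set T) :
  nbhs x P -> nbhs x Q -> nbhs x (fun y => P y /\ Q y).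
Proof. exact: filterI. Qed.

Section ConstantRank.
Variable K : numFieldType.
Hypothesis K_complete : summation_complete K.
Hypothesis K_arch : archimedean_norm K.

(** The idempotent 1 - S' S factors through its image; the factors B and C are
    a basis of the kernel of S and coordinates on it. *)
Lemma right_free_complement r n (S : 'M[K]_(r, n)) (S' : 'M[K]_(n, r)) : S *m S' = 1%:M ->
  exists k (B : 'M[K]_(n, k)) (C : 'M[K]_(k, n)),
    [/\ S' *m S + B *m C = 1%:M, C *m B = 1%:M, S *m B = 0 & C *m S' = 0].
Proof.
move=> SS'; set T := 1%:M - S' *m S.
have ST : S *m T = 0 by rewrite mulmxBr mulmx1 mulmxA SS' mul1mx subrr.
have TS' : T *m S' = 0 by rewrite mulmxBl mul1mx -mulmxA SS' mulmx1 subrr.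
have TT : T *m T = T by rewrite {1}/T mulmxBl mul1mx -mulmxA ST mulmx0 subr0.
have CV := mulmxVp (row_base_free T); have VB := mulVpmx (col_base_full T).
have BC := mulmx_base T.
move: (col_base T) (row_base T) (pinvmx _) (pinvmx _) CV VB BC => B C B' C' CV VB BC.
move: (\rank T) B C B' C' CV VB BC => k B C B' C' CV VB BC.
exists k, B, C; split.
- by rewrite BC /T addrC subrK.
- have : B' *m (T *m T) *m C' = B' *m T *m C' by rewrite TT.
  rewrite -BC !mulmxA VB !mul1mx -!mulmxA CV !mulmx1.
  by [].
- by rewrite -[S *m B]mulmx1 -CV !mulmxA -(mulmxA S) BC ST mul0mx.
- by rewrite -[C *m S']mul1mx -VB -!mulmxA (mulmxA B) BC TS' mulmx0.
Qed.

(** If the rank r of E is less than m, choose P with P E of full rank r.  By the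
    inverse function theorem the fibre of P f through z0 is parametrized by a
    nonconstant map ga.  All derivatives of f factor through dimension r, on which
    P stays injective, so that f ga has zero derivative and is constant,
    although z0 is isolated in its fibre. *)
Lemma constant_rank_injective m n (f : 'cV[K]_m -> 'cV[K]_n) z0 (E : 'M[K]_(n, m)) :
  analytic_at f z0 -> jacobian f z0 E ->
  (\forall z \near z0, forall E', jacobian f z E' -> exists M N, E' = M *m E *m N) ->
  (\forall z \near z0, f z = f z0 -> z = z0) ->
  exists L : 'M[K]_(m, n), L *m E = 1%:M.
Proof.
move=> fA fJ rk inj.
have SV := mulmxVp (row_base_free E); have VC := mulVpmx (col_base_full E).
have CS := mulmx_base E.
move: (col_base E) (row_base E) (pinvmx _) (pinvmx _) SV VC CS => Cb S P S' SV VC CS.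
move: (\rank E) Cb S P S' SV VC CS => r Cb S P S' SV VC CS.
have [k [B [Q [SBQ QB SB QS']]]] := right_free_complement SV.
have [k0|k0] := posnP k.
  exists (S' *m P); rewrite -CS -mulmxA (mulmxA P) VC mul1mx -SBQ.
  by subst k; rewrite (flatmx0 Q) mulmx0 addr0.
exfalso.
have PE : P *m E = S by rewrite -CS mulmxA VC mul1mx.
pose Th z := col_mx (P *m f z) (Q *m z).
have ThA z : analytic_at f z -> analytic_at Th z.
  move=> fz; apply: (analytic_col_mx (f := fun z => P *m f z)).
    exact: (analytic_comp K_complete (g := mulmx P) fz (analytic_linear K_complete P _)).
  exact: analytic_linear.
have ThJ z E' : jacobian f z E' -> jacobian Th z (col_mx (P *m E') Q).
  move=> fz; apply: (jacobian_col_mx (f := fun z => P *m f z)).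
    exact: (jacobian_comp (g := mulmx P) fz (jacobian_linear P _)).
  exact: jacobian_linear.
have [||U [V [Ph [[oU Uz] [oV Vz] UV VU [_ PhA]]]]] :=
  inverse_function (D' := row_mx S' B) K_complete (ThA _ fA) (ThJ _ _ fJ).
- rewrite PE mul_col_row SV SB QS' QB.
  by rewrite -scalar_mx_block.
- by rewrite PE mul_row_col.
(* ga parametrizes the fibre of P f through z0 by b *)
pose line (b : 'cV[K]_k) := col_mx (0 : 'M[K]_(r, k)) 1%:M *m b + Th z0.
pose ga := Ph \o line.
have line0 : line 0 = Th z0 by rewrite /line mulmx0 add0r.
have lineA b : analytic_at line b by exact: analytic_affine.
have lineV : \forall b \near (0 : 'cV[K]_k), V (line b).
  apply: (analytic_continuous K_complete (lineA 0)); rewrite line0.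
  exact: open_nbhs_nbhs.
have gaA b : V (line b) -> analytic_at ga b.
  by move=> Vb; apply: (analytic_comp K_complete (lineA b)); exact: PhA.
have ga0 : ga 0 = z0 by rewrite /ga /= line0; have [_ ->] := UV _ Uz.
have gac : {for 0, continuous ga}.
  by apply: (analytic_continuous K_complete); apply: gaA; rewrite line0.
have near_ga (R : set 'cV[K]_m) : nbhs z0 R -> \forall b \near (0 : 'cV[K]_k), R (ga b).
  by move=> HR; apply: gac; rewrite ga0.
have fga0 : \forall b \near (0 : 'cV[K]_k), jacobian (f \o ga) b 0.
  apply: nbhs_weaken (nbhs_and lineV (nbhs_and (near_ga _ (analytic_at_near K_complete fA))
    (near_ga _ rk))) => b [Vb [fb rkb]].
  have [E' fE'] := analytic_jacobian K_complete fb.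
  have [M [N E'E]] := rkb _ fE'.
  have [J PhJ] := analytic_jacobian K_complete (PhA _ Vb).
  have gaJ : jacobian ga b (J *m col_mx 0 1%:M).
    exact: jacobian_comp (jacobian_affine _ _ _) PhJ.
  have ThJ1 : col_mx (P *m E') Q *m J = 1%:M.
    apply: (jacobian_unique _ (jacobian_id (line b))).
    apply: jacobian_ext (jacobian_comp PhJ (ThJ _ _ fE')).
    apply: filterS (_ : nbhs _ V); last exact: open_nbhs_nbhs.
    by move=> y /VU[].
  have [J1 J2] : P *m E' *m (J *m col_mx 1%:M 0) = 1%:M /\ P *m E' *m (J *m col_mx 0 1%:M) = 0.
    have PJ : P *m E' *m J = row_mx 1%:M 0.
      have := congr1 usubmx ThJ1; rewrite -mul_usub_mx col_mxKu => ->.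
      by rewrite scalar_mx_block block_mxEv col_mxKu.
    by rewrite !mulmxA PJ !mul_row_col !mul1mx !mul0mx !addr0.
  have := jacobian_comp gaJ fE'; suff -> : E' *m (J *m col_mx 0 1%:M) = 0 by [].
  (* E' factors through dimension r; P restricted to this factor is a square
     matrix with a right inverse, hence invertible *)
  set J2' := J *m col_mx 0 _ in J2 *; set J1' := J *m _ in J1.
  rewrite E'E -CS in J1 J2 *.
  have G1 : (S *m N *m J1') *m (P *m M *m Cb) = 1%:M.
    by apply: mulmx1C; rewrite -J1 !mulmxA.
  have G2 : S *m N *m J2' = 0.
    by rewrite -[LHS]mul1mx -G1 -[RHS](mulmx0 _ (S *m N *m J1')) -J2 !mulmxA.
  by rewrite -[RHS](mulmx0 _ (M *m Cb)) -G2 !mulmxA.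
have fgaA : analytic_at (f \o ga) 0.
  by apply: (analytic_comp K_complete); [apply: gaA; rewrite line0|rewrite ga0].
have cst := jacobian0_locally_constant K_complete K_arch fgaA fga0.
have : \forall b \near (0 : 'cV[K]_k), b = 0.
  apply: nbhs_weaken (nbhs_and lineV (nbhs_and cst (near_ga _ inj))) => b [Vb [/= fb injb]].
  have gab : ga b = z0 by apply: injb; rewrite fb ga0.
  have [_ Thb] := VU _ Vb.
  have : line b = Th z0 by rewrite -gab /ga /= Thb.
  move=> /(congr1 (fun z => z - Th z0)); rewrite /line addrK subrr mul_col_mx mul1mx.
  by move=> /(congr1 dsubmx); rewrite col_mxKd => ->; rewrite linear0.
move=> /nbhs_vnormP[e e0 /(_ ((e / 2) *: delta_mx (Ordinal k0) 0))].
rewrite subr0 vnormZ vnorm_delta mulr1 gtr0_norm ?divr_gt0 //.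
rewrite ltr_pdivrMr // ltr_pMr // ltr1n => /(_ isT) /matrixP/(_ (Ordinal k0) 0).
by rewrite !mxE !eqxx mulr1 => /eqP; rewrite gt_eqF // divr_gt0.
Qed.

End ConstantRank.

(** * Invariant complements *)

Section EquivariantComplement.
Variables (K : numFieldType) (G : groupType) (s : seq G).
Hypotheses (s_uniq : uniq s) (s1 : (1%g : G) \in s).
Hypothesis sM : forall g h, g \in s -> h \in s -> (g * h)%g \in s.
Hypothesis sV : forall g, g \in s -> (g^-1)%g \in s.

(** The list s enumerates a finite subgroup; the group G itself may be infinite. *)
Lemma sum_translate_left (V : zmodType) (F : G -> V) h : h \in s ->
  \sum_(g <- s) F (h * g)%g = \sum_(g <- s) F g.
Proof.
move=> hs; rewrite -(big_map (fun g => h * g)%g predT F); apply: perm_big.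
apply: uniq_perm => // [|g]; first by rewrite map_inj_uniq // => x y; exact: mulgI.
apply/mapP/idP => [[k ks ->]|gs]; first exact: sM.
by exists (h^-1 * g)%g; rewrite ?mulVKg // sM ?sV.
Qed.

Lemma sum_translate_right (V : zmodType) (F : G -> V) h : h \in s ->
  \sum_(g <- s) F (g * h)%g = \sum_(g <- s) F g.
Proof.
move=> hs; rewrite -(big_map (fun g => g * h)%g predT F); apply: perm_big.
apply: uniq_perm => // [|g]; first by rewrite map_inj_uniq // => x y; exact: mulIg.
apply/mapP/idP => [[k ks ->]|gs]; first exact: sM.
by exists (g * h^-1)%g; rewrite ?mulgVK // sM ?sV.
Qed.

Lemma size_neq0 : (size s)%:R != 0 :> K.
Proof. by rewrite pnatr_eq0; case: (s) s1. Qed.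

Variables (m n : nat) (A : G -> 'M[K]_n) (E : 'M[K]_(n, m)) (L : 'M[K]_(m, n)).
Hypothesis A1 : A 1%g = 1%:M.
Hypothesis AM : forall g h, g \in s -> h \in s -> A (g * h)%g = A g *m A h.
Hypothesis LE : L *m E = 1%:M.
Hypothesis AE : forall g, g \in s -> exists C, A g *m E = E *m C.

Let C g := L *m A g *m E.

Let AEC g : g \in s -> A g *m E = E *m C g.
Proof.
move=> /AE[C' h]; suff -> : C g = C' by [].
by rewrite /C -mulmxA h mulmxA LE mul1mx.
Qed.

Let CM g h : g \in s -> h \in s -> C (g * h)%g = C g *m C h.
Proof.
by move=> gs hs; rewrite {1}/C AM // -!mulmxA AEC // !mulmxA -[L *m A g *m E]/(C g).
Qed.

(** The average of L over the group is still a left inverse of E, and it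
    intertwines the representations A and C. *)
Let L' := (size s)%:R^-1 *: \sum_(g <- s) C g *m L *m A (g^-1)%g.

Let L'E : L' *m E = 1%:M.
Proof.
rewrite -scalemxAl mulmx_suml big_seq (eq_bigr (fun _ => 1%:M)); last first.
  move=> g gs; rewrite -(mulmxA _ (A _)) AEC ?sV // mulmxA -(mulmxA _ L) LE mulmx1.
  by rewrite -CM ?sV // mulgV /C A1 mulmx1.
rewrite -big_seq big_const_seq count_predT iter_addr_0.
by rewrite -[1%:M *+ _]scaler_nat scalerA mulVf ?size_neq0 // scale1r.
Qed.

Let L'A h : h \in s -> L' *m A h = C h *m L'.
Proof.
move=> hs; rewrite -scalemxAl -scalemxAr; congr (_ *: _).
rewrite mulmx_suml mulmx_sumr -(sum_translate_left _ hs) !big_seq; apply: eq_bigr => g gs.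
rewrite CM // invgM -!mulmxA -AM ?sM ?sV //.
by rewrite -mulgA mulVg mulg1.
Qed.

(** Maschke's theorem for the image of E: the kernel of the averaged left inverse
    is an invariant complement, with basis B, coordinates Q and matrices
    Q (A g) B. *)
Lemma equivariant_complement : exists (P : 'M[K]_(m, n))
    (B : 'M[K]_(n, n - m)) (Q : 'M[K]_(n - m, n)),
  [/\ E *m P + B *m Q = 1%:M, row_mx E B *m col_mx P Q = 1%:M,
      col_mx P Q *m row_mx E B = 1%:M, Q *m B = 1%:M &
      forall g, g \in s -> A g *m B = B *m (Q *m A g *m B)].
Proof.
have [k [B [Q [EB QB PB QE]]]] := right_free_complement L'E.
have inv1 : row_mx E B *m col_mx L' Q = 1%:M by rewrite mul_row_col.
have inv2 : col_mx L' Q *m row_mx E B = 1%:M.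
  by rewrite mul_col_row L'E PB QE QB -scalar_mx_block.
have kE : k = (n - m)%N.
  have := mulmx1_min inv1; have := mulmx1_min inv2 => h1 h2.
  have E1 : (m + k)%N = n by apply/eqP; rewrite eqn_leq h1 h2.
  by rewrite -E1 addKn.
subst k; exists L', B, Q; split=> // g gs.
have BQ : B *m Q = 1%:M - E *m L' by rewrite -EB addrC addKr.
rewrite !mulmxA BQ mulmxBl mul1mx -(mulmxA E) L'A // mulmxA -AEC //.
by rewrite mulmxBl -!mulmxA PB !mulmx0 subr0.
Qed.

End EquivariantComplement.

(** * Analytic actions *)

Lemma nbhs_all (T : topologicalType) (x : T) (I : eqType) (l : seq I) (P : I -> set T) :
  (forall i, i \in l -> nbhs x (P i)) -> nbhs x (fun y => forall i, i \in l -> P i y).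
Proof.
elim: l => [|i l IH] H; first exact: filterE.
have := nbhs_and (H i (mem_head i l)) (IH (fun j jl => H j (mem_behead (s := i :: l) jl))).
by apply: nbhs_weaken => y [Pi Pl] j; rewrite inE => /orP[/eqP ->|/Pl].
Qed.

Section Action.
Variables (K : numFieldType) (m n : nat) (G : GroupWithTopology.type)
  (AG : set (chart K m G)) (X : topologicalType) (AX : set (chart K n X))
  (a : left_action G X).
Hypothesis K_complete : summation_complete K.
Hypothesis K_arch : archimedean_norm K.
Hypothesis G_lie : is_lie_group AG.
Hypothesis X_manifold : is_manifold AX.
Hypothesis a_analytic : analytic_action AG AX a.
Hypothesis a_stab : finite_stabilizers a.

Let G_manifold : is_manifold AG. Proof. by case: G_lie. Qed.
Let AG_atlas := manifold_atlas G_manifold.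
Let AX_atlas := manifold_atlas X_manifold.

Lemma act_analytic g x :
  analytic_between (prod_atlas AG AX) AX (fun p : G * X => a p.1 p.2) (g, x).
Proof. exact: analytic_map_between. Qed.

Lemma translate_analytic g x : analytic_between AX AX (a g) x.
Proof.
have pr : analytic_between AX (prod_atlas AG AX) (fun y => (g, y)) x.
  by apply: analytic_between_pair; [exact: analytic_between_cst|exact: analytic_between_id].
exact: (analytic_between_comp K_complete AX_atlas (prod_atlas_atlas AG_atlas AX_atlas)
  pr (act_analytic g x)).
Qed.

Lemma orbit_analytic x g : analytic_between AG AX (fun h => a h x) g.
Proof.
have pr : analytic_between AG (prod_atlas AG AX) (fun h => (h, x)) g.
  by apply: analytic_between_pair; [exact: analytic_between_id|exact: analytic_between_cst].
exact: (analytic_between_comp K_complete AG_atlas (prod_atlas_atlas AG_atlas AX_atlas)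
  pr (act_analytic g x)).
Qed.

Lemma mul_analytic g h :
  analytic_between (prod_atlas AG AG) AG (fun p : G * G => (p.1 * p.2)%g) (g, h).
Proof. by apply: analytic_map_between; case: G_lie. Qed.

Lemma mull_analytic h g : analytic_between AG AG (fun k => (h * k)%g) g.
Proof.
have pr : analytic_between AG (prod_atlas AG AG) (fun k => (h, k)) g.
  by apply: analytic_between_pair; [exact: analytic_between_cst|exact: analytic_between_id].
exact: (analytic_between_comp K_complete AG_atlas (prod_atlas_atlas AG_atlas AG_atlas)
  pr (mul_analytic h g)).
Qed.

Lemma mulr_analytic h g : analytic_between AG AG (fun k => (k * h)%g) g.
Proof.
have pr : analytic_between AG (prod_atlas AG AG) (fun k => (k, h)) g.
  by apply: analytic_between_pair; [exact: analytic_between_id|exact: analytic_between_cst].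
exact: (analytic_between_comp K_complete AG_atlas (prod_atlas_atlas AG_atlas AG_atlas)
  pr (mul_analytic g h)).
Qed.

Lemma conj_analytic h g : analytic_between AG AG (fun k => (h * k * h^-1)%g) g.
Proof.
exact: (analytic_between_comp K_complete AG_atlas AG_atlas (mull_analytic h g)
  (mulr_analytic _ _)).
Qed.

Lemma act_inv g x : a g^-1%g (a g x) = x.
Proof. by rewrite -actM mulVg act1. Qed.

(** A finite set is discrete in a Hausdorff space. *)
Lemma near_stabilizer_trivial x : \forall g \near (1%g : G), a g x = x -> g = 1%g.
Proof.
have G_haus : hausdorff_space G by case: G_manifold.
have fin : finite_set ([set g | a g x = x] `\ (1%g : G)) by exact: finite_setD.
have cl := (accessible_finite_set_closed).1 (hausdorff_accessible G_haus) _ fin.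
have : nbhs (1%g : G) (~` ([set g | a g x = x] `\ (1%g : G))).
  by apply: open_nbhs_nbhs; split; [exact: closed_openC|move=> -[_]; apply].
by apply: nbhs_weaken => g /= H gx; apply: contrapT => g1; apply: H.
Qed.

(** Near g the orbit map is translation by g^-1, then the orbit map near 1, then
    translation by g.  Hence its derivatives there are M E N, and
    [constant_rank_injective] applies. *)
Lemma orbit_jacobian_injective x c cG (E : 'M[K]_(n, m)) :
  AX c -> chart_dom c x -> AG cG -> chart_dom cG (1%g : G) ->
  jacobian (chart_map c \o (fun g => a g x) \o chart_inv cG) (chart_map cG (1%g : G)) E ->
  exists L : 'M[K]_(m, n), L *m E = 1%:M.
Proof.
move=> Ac xc AcG G1 EJ; set z0 := chart_map cG _ in EJ.
have Hc := AX_atlas.1 c Ac; have HcG := AG_atlas.1 cG AcG.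
have oc g : {for g, continuous (fun h => a h x)} by case: (orbit_analytic x g).
have z01 : chart_inv cG z0 = 1%g by rewrite chart_mapK.
set f := _ \o _ in EJ.
have fA : analytic_at f z0.
  by apply: (orbit_analytic x 1%g).2 => //; rewrite act1.
have domn : \forall z \near z0, chart_cod cG z /\ chart_dom c (a (chart_inv cG z) x).
  apply: nbhs_and; first by apply: chart_cod_nbhs => //; exact: chart_map_cod.
  apply: (near_chart_inv HcG G1 (P := fun g => chart_dom c (a g x))).
  by apply: oc; rewrite act1; exact: chart_dom_nbhs.
have fz0 : f z0 = chart_map c x by rewrite /f /= z01 act1.
apply: (constant_rank_injective K_complete K_arch fA EJ).
- apply: nbhs_weaken domn => z [zc zx] E' fJ'; set g := chart_inv cG z in zx.
  have gc : chart_dom cG g by exact: chart_inv_dom.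
  have gz : chart_map cG g = z by exact: chart_invK.
  pose nu := chart_map cG \o (fun k => g^-1 * k)%g \o chart_inv cG.
  pose mu := chart_map c \o a g \o chart_inv c.
  have nuA : analytic_at nu z.
    by rewrite -gz; apply: (mull_analytic g^-1%g g).2 => //; rewrite mulVg.
  have muA : analytic_at mu (f z0).
    by rewrite fz0; apply: (translate_analytic g x).2.
  have [N nuJ] := analytic_jacobian K_complete nuA.
  have [M muJ] := analytic_jacobian K_complete muA.
  have nuz : nu z = z0 by rewrite /nu /= -/g mulVg.
  have J1 : jacobian (f \o nu) z (E *m N) by apply: (jacobian_comp nuJ); rewrite nuz.
  have J2 : jacobian (mu \o (f \o nu)) z (M *m (E *m N)).
    by apply: (jacobian_comp J1); rewrite /= nuz.
  exists M, N; rewrite -mulmxA; apply: (jacobian_unique fJ').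
  apply: jacobian_ext J2.
  have cm : {for g, continuous (fun k => g^-1 * k)%g} by case: (mull_analytic g^-1%g g).
  have n1 : \forall z' \near z, chart_dom cG (g^-1 * chart_inv cG z')%g.
    rewrite -gz; apply: (near_chart_inv HcG gc (P := fun k => chart_dom cG (g^-1 * k)%g)).
    by apply: cm; rewrite mulVg; exact: chart_dom_nbhs.
  have n2 : \forall z' \near z, chart_dom c (a (g^-1 * chart_inv cG z')%g x).
    rewrite -gz; apply: (near_chart_inv HcG gc (P := fun k => chart_dom c (a (g^-1 * k)%g x))).
    apply: (continuous_comp cm (oc _)); rewrite /= mulVg act1; exact: chart_dom_nbhs.
  apply: nbhs_weaken (nbhs_and n1 n2) => z' [d1 d2].
  rewrite /mu /f /nu /= (chart_mapK HcG) // (chart_mapK Hc) // -actM mulgA mulgV mul1g //.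
- apply: nbhs_weaken (nbhs_and domn (near_chart_inv HcG G1 (near_stabilizer_trivial x))).
  move=> z [[zc zx] st]; rewrite fz0 /f /= => /(congr1 (chart_inv c)).
  rewrite !(chart_mapK Hc) // => /st z1.
  by rewrite -(chart_invK HcG zc) z1.
Qed.

Hypothesis a_proper : locally_proper a.

(** The elements that move x to a neighbourhood of x lie in a compact set.  Those
    among them outside the open set G_x Om form a compact set on which g x <> x,
    so a neighbourhood M of x is moved off itself by all of them at once. *)
Lemma proper_shift x (Om : set G) : nbhs (1%g : G) Om ->
  exists2 M, nbhs x M & forall g y y', M y -> M y' -> a g y = y' ->
    exists gam k, [/\ a gam x = x, Om k & g = (gam * k)%g].
Proof.
move=> Om1; have [V [_ Vx _ /(_ x x Vx Vx)[U [U' [[Ux _] [U'x _] cpt]]]]] := a_proper x.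
have X_haus : hausdorff_space X by case: X_manifold.
pose T := [set g | exists gam k, [/\ a gam x = x, interior Om k & g = (gam * k)%g]].
have oT : open T.
  rewrite openE => g [gam [k [gx Ok gE]]].
  have cm : {for g, continuous (fun h => gam^-1 * h)%g} by case: (mull_analytic gam^-1%g g).
  have On : nbhs (gam^-1 * g)%g (interior Om).
    by apply: open_nbhs_nbhs; split; [exact: open_interior|rewrite gE mulKg].
  have {}On : nbhs g [set h | interior Om (gam^-1 * h)%g] := cm _ On.
  by apply: nbhs_weaken On => h Oh; exists gam, (gam^-1 * h)%g; rewrite mulVKg.
set C := closure _ in cpt.
have cptT : compact (C `&` ~` T) by apply: (compact_closedI cpt); exact: open_closedC.
have : nbhs (x, x) (fun p : X * X => C `&` ~` T `<=` (fun g => a g p.1 <> p.2)).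
  apply: ((compact_near_coveringP _).1 cptT (X * X)%type (nbhs (x, x))
    (fun p g => a g p.1 <> p.2) _) => g [_ Tg].
  have gx : a g x != x.
    by apply/eqP => gx; apply: Tg; exists g, 1%g; split=> //; rewrite mulg1.
  move: X_haus; rewrite open_hausdorff => /(_ _ _ gx)[[A B] /= [Agx Bx] [oA oB /eqP/seteqP[AB _]]].
  move/set_mem: Agx => Agx; move/set_mem: Bx => Bx.
  have [+ _] := act_analytic g x => /(_ A (open_nbhs_nbhs (conj oA Agx)))[[N M] /= [Ng Mx] NM].
  exists (N, M `*` B); first split=> //=.
    by exists (M, B) => //=; split=> //; exact: open_nbhs_nbhs.
  move=> [g' [y y']] /= [Ng' [My By']] E.
  by apply: (AB y'); split=> //; rewrite -E; exact: (NM (g', y)).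
move=> [[M1 M2] /= [M1x M2x] H].
exists (M1 `&` M2 `&` (U `&` U')); first by do !apply: filterI.
move=> g y y' [[M1y _] [Uy _]] [[_ M2y'] [_ U'y']] gy.
have [[gam [k [? Ok ?]]]|Tg] := pselect (T g).
  by exists gam, k; split=> //; exact: interior_subset.
exfalso; apply: (H (y, y') (conj M1y M2y') g) => //; split=> //.
by apply: subset_closure; exists y' ; split=> //; exists y.
Qed.

End Action.

(** * Slices *)

(** Besides the section [slice_map] over [slice_dom], a slice carries the linear
    representation [slice_rep] of the stabilizer of its base point, and the
    inverse y |-> (slice_elt y, slice_coord y), defined on the open set
    [slice_tube], of the local isomorphism (k, w) |-> k (slice_map w). *)
Record slice (K : numFieldType) (n d : nat) (G : GroupWithTopology.type)
    (X : topologicalType) (AX : set (chart K n X)) (a : left_action G X) := Slice {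
  slice_base : X;
  slice_dom : set 'cV[K]_d;
  slice_map : 'cV[K]_d -> X;
  slice_rep : G -> 'M[K]_d;
  slice_shift : set G;
  slice_tube : set X;
  slice_elt : X -> G;
  slice_coord : X -> 'cV[K]_d;
  slice_dom_open : open slice_dom;
  slice_dom0 : slice_dom 0;
  slice_map0 : slice_map 0 = slice_base;
  slice_map_analytic : forall w, slice_dom w ->
    analytic_between (vec_atlas K d) AX slice_map w;
  slice_rep1 : slice_rep 1%g = 1%:M;
  slice_repM : forall g h, a g slice_base = slice_base -> a h slice_base = slice_base ->
    slice_rep (g * h)%g = slice_rep g *m slice_rep h;
  slice_rep_dom : forall g w, a g slice_base = slice_base -> slice_dom w ->
    slice_dom (slice_rep g *m w);
  slice_map_rep : forall g w, a g slice_base = slice_base -> slice_dom w ->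
    slice_map (slice_rep g *m w) = a g (slice_map w);
  slice_shift_nbhs : nbhs (1%g : G) slice_shift;
  slice_tube_open : open slice_tube;
  slice_elt_continuous : forall y, slice_tube y -> {for y, continuous slice_elt};
  slice_coord_analytic : forall y, slice_tube y ->
    analytic_between AX (vec_atlas K d) slice_coord y;
  slice_tubeP : forall y, slice_tube y -> a (slice_elt y) (slice_map (slice_coord y)) = y;
  slice_shiftP : forall k w, slice_shift k -> slice_dom w ->
    [/\ slice_tube (a k (slice_map w)), slice_elt (a k (slice_map w)) = k &
        slice_coord (a k (slice_map w)) = w];
  slice_stab : forall g w w', slice_dom w -> slice_dom w' ->
    a g (slice_map w) = slice_map w' -> a g slice_base = slice_base }.

Section SliceTheorem.
Variables (K : numFieldType) (m n : nat) (G : GroupWithTopology.type)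
  (AG : set (chart K m G)) (X : topologicalType) (AX : set (chart K n X))
  (a : left_action G X).
Hypothesis K_complete : summation_complete K.
Hypothesis K_arch : archimedean_norm K.
Hypothesis G_lie : is_lie_group AG.
Hypothesis X_manifold : is_manifold AX.
Hypothesis a_analytic : analytic_action AG AX a.
Hypothesis a_stab : finite_stabilizers a.
Hypothesis a_proper : locally_proper a.

Let G_manifold : is_manifold AG. Proof. by case: G_lie. Qed.
Let AG_atlas := manifold_atlas G_manifold.
Let AX_atlas := manifold_atlas X_manifold.

Variable x : X.

Lemma stabilizer_seq : exists s : seq G, uniq s /\ forall g, g \in s <-> a g x = x.
Proof.
have /finite_seqP[l Hl] := a_stab x; exists (undup l); split=> [|g]; first exact: undup_uniq.
rewrite mem_undup; have : [set g | a g x = x] g <-> [set` l] g by rewrite Hl.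
by case=> h1 h2; split.
Qed.

Variables (c : chart K n X) (cG : chart K m G).
Hypotheses (Ac : AX c) (xc : chart_dom c x) (AcG : AG cG) (G1 : chart_dom cG (1%g : G)).
Let Hc := AX_atlas.1 c Ac.
Let HcG := AG_atlas.1 cG AcG.
Let x0 := chart_map c x.
Let z0 := chart_map cG (1%g : G).

Let x0K : chart_inv c x0 = x. Proof. exact: chart_mapK. Qed.
Let z0K : chart_inv cG z0 = 1%g. Proof. exact: chart_mapK. Qed.

(** The translation by g and the orbit map of x, in the coordinates c and cG. *)
Let loc g := chart_map c \o a g \o chart_inv c.
Let orb := chart_map c \o (fun g => a g x) \o chart_inv cG.

Variable s : seq G.
Hypothesis s_uniq : uniq s.
Hypothesis sP : forall g, g \in s <-> a g x = x.

Let s1 : (1%g : G) \in s. Proof. by apply/sP; rewrite act1. Qed.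
Let sM g h : g \in s -> h \in s -> (g * h)%g \in s.
Proof. by move=> /sP gx /sP hx; apply/sP; rewrite actM hx gx. Qed.
Let sV g : g \in s -> (g^-1)%g \in s.
Proof. by move=> /sP gx; apply/sP; rewrite -{1}gx act_inv. Qed.

Let act_continuous g y : {for y, continuous (a g)}.
Proof. by case: (translate_analytic K_complete G_lie X_manifold a_analytic g y). Qed.

Let near_loc g : g \in s ->
  \forall v \near x0, chart_cod c v /\ chart_dom c (a g (chart_inv c v)).
Proof.
move=> /sP gx; apply: nbhs_and; first by apply: chart_cod_nbhs => //; exact: chart_map_cod.
apply: (near_chart_inv Hc xc (P := fun y => chart_dom c (a g y))).
by apply: act_continuous; rewrite gx; exact: chart_dom_nbhs.
Qed.

Let locx0 g : g \in s -> loc g x0 = x0.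
Proof. by move=> /sP gx; rewrite /loc /= x0K gx. Qed.

Let loc_analytic g : g \in s -> analytic_at (loc g) x0.
Proof.
move=> /sP gx; apply: (translate_analytic K_complete G_lie X_manifold a_analytic g x).2 => //.
by rewrite gx.
Qed.

Let loc_continuous g : g \in s -> {for x0, continuous (loc g)}.
Proof. by move=> /loc_analytic/(analytic_continuous K_complete). Qed.

Let locM g h : g \in s -> h \in s -> \forall v \near x0, loc (g * h)%g v = loc g (loc h v).
Proof.
move=> gs hs; apply: nbhs_weaken (near_loc hs) => v [vc hv].
by rewrite /loc /= (chart_mapK Hc) // actM.
Qed.

(** The stabilizer acts on the tangent space at x by the chain rule. *)
Lemma isotropy_representation : exists A : G -> 'M[K]_n,
  [/\ forall g, g \in s -> jacobian (loc g) x0 (A g), A 1%g = 1%:M &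
      forall g h, g \in s -> h \in s -> A (g * h)%g = A g *m A h].
Proof.
have /choice[A HA] : forall g, exists D, g \in s -> jacobian (loc g) x0 D.
  move=> g; case: (boolP (g \in s)) => gs; last by exists 0.
  by have [D HD] := analytic_jacobian K_complete (loc_analytic gs); exists D.
exists A; split=> //.
  apply: (jacobian_unique (HA _ s1)); apply: jacobian_ext (jacobian_id x0).
  apply: nbhs_weaken (near_loc s1) => v [vc _].
  by rewrite /loc /= act1 (chart_invK Hc).
move=> g h gs hs; apply: (jacobian_unique (HA _ (sM gs hs))).
apply: (@jacobian_ext _ _ _ (loc g \o loc h)).
  by apply: nbhs_weaken (locM gs hs) => v ->.
by apply: jacobian_comp (HA h hs) _; rewrite locx0 //; exact: HA.
Qed.

Let orb_analytic : analytic_at orb z0.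
Proof.
apply: (orbit_analytic K_complete G_lie X_manifold a_analytic x 1%g).2 => //.
by rewrite act1.
Qed.

Let orbz0 : orb z0 = x0. Proof. by rewrite /orb /= z0K act1. Qed.

Let near_orb : \forall z \near z0, chart_cod cG z /\ chart_dom c (a (chart_inv cG z) x).
Proof.
apply: nbhs_and; first by apply: chart_cod_nbhs => //; exact: chart_map_cod.
apply: (near_chart_inv HcG G1 (P := fun g => chart_dom c (a g x))).
have [ct _] := orbit_analytic K_complete G_lie X_manifold a_analytic x 1%g.
by apply: ct; rewrite act1; exact: chart_dom_nbhs.
Qed.

(** For g fixing x, g (k x) = (g k g^-1) x: on the tangent space of the orbit, g acts
    through its adjoint action C. *)
Lemma isotropy_orbit A E : (forall g, g \in s -> jacobian (loc g) x0 (A g)) ->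
  jacobian orb z0 E -> forall g, g \in s -> exists C, A g *m E = E *m C.
Proof.
move=> HA EJ g gs; have gx := (sP g).1 gs.
pose cj := chart_map cG \o (fun k => g * k * g^-1)%g \o chart_inv cG.
have gg : (g * 1 * g^-1 = 1)%g by rewrite mulg1 mulgV.
have cA := conj_analytic K_complete G_lie g 1%g.
have cjA : analytic_at cj z0 by apply: cA.2 => //; rewrite gg.
have cjz0 : cj z0 = z0 by rewrite /cj /= z0K gg.
have [C cjJ] := analytic_jacobian K_complete cjA; exists C.
apply: (@jacobian_unique _ _ _ (loc g \o orb) z0).
  by apply: (jacobian_comp EJ); rewrite orbz0; exact: HA.
apply: (@jacobian_ext _ _ _ (orb \o cj)); last by apply: (jacobian_comp cjJ); rewrite cjz0.
have n1 : \forall z \near z0, chart_dom cG (g * chart_inv cG z * g^-1)%g.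
  apply: (near_chart_inv HcG G1 (P := fun k => chart_dom cG (g * k * g^-1)%g)).
  by apply: cA.1; rewrite gg; exact: chart_dom_nbhs.
apply: nbhs_weaken (nbhs_and near_orb n1) => z [[zc zx] zg].
rewrite /orb /loc /cj /= (chart_mapK HcG) // (chart_mapK Hc) //.
by rewrite !actM -[in LHS](_ : a g x = x) // act_inv.
Qed.

(** Bochner's linearization: xi is the average of A(g^-1) (loc g v - x0) over the
    stabilizer.  Its derivative is the average of A(g^-1) A(g) = 1, and
    substituting loc h reindexes the sum. *)
Lemma linearizing_coordinates A :
  (forall g, g \in s -> jacobian (loc g) x0 (A g)) -> A 1%g = 1%:M ->
  (forall g h, g \in s -> h \in s -> A (g * h)%g = A g *m A h) ->
  exists xi : 'cV[K]_n -> 'cV[K]_n,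
    [/\ analytic_at xi x0, xi x0 = 0, jacobian xi x0 1%:M &
        forall g, g \in s -> \forall v \near x0, xi (loc g v) = A g *m xi v].
Proof.
move=> HA A1 AM.
pose term g v := A g^-1%g *m loc g v + - (A g^-1%g *m x0).
have termE g v : term g v = A g^-1%g *m (loc g v - x0) by rewrite mulmxBr.
pose xi v := (size s)%:R^-1 *: \sum_(g <- s) term g v.
exists xi; split.
- apply: analyticZ => //; apply: analytic_sum => // g gs.
  exact: (analytic_comp K_complete (loc_analytic gs) (analytic_affine K_complete _ _ _)).
- rewrite /xi big1_seq ?scaler0 // => g /= gs; by rewrite termE locx0 // subrr mulmx0.
- have : jacobian xi x0 ((size s)%:R^-1 *: \sum_(g <- s) A g^-1%g *m A g).
    apply: jacobianZ; apply: jacobian_sum => g gs.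
    exact: (jacobian_comp (HA g gs) (jacobian_affine _ _ _)).
  rewrite (_ : _ *: _ = 1%:M) // big_seq (eq_bigr (fun _ => 1%:M)) => [|g gs]; last first.
    by rewrite -AM ?sV // mulVg A1.
  rewrite -big_seq big_const_seq count_predT iter_addr_0.
  by rewrite -[1%:M *+ _]scaler_nat scalerA mulVf ?size_neq0 // scale1r.
move=> h hs.
have : \forall v \near x0, forall g, g \in s -> loc (g * h)%g v = loc g (loc h v).
  by apply: nbhs_all => g gs; exact: locM.
apply: nbhs_weaken => v Hv; rewrite /xi -scalemxAr; congr (_ *: _).
rewrite mulmx_sumr -(sum_translate_right s_uniq sM sV (fun g => A h *m term g v) hs).
rewrite !big_seq; apply: eq_bigr => g gs; rewrite !termE mulmxA invgM.
rewrite -AM ?sM ?sV // mulVKg Hv //.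
Qed.

Local Notation d := (n - m)%N.

(** The section is the invariant complement of the tangent space of the orbit,
    read in the linearizing coordinates. *)
Lemma linear_slice : exists (E : 'M[K]_(n, m)) (B : 'M[K]_(n, d)) (D' : 'M[K]_(m + d, n))
    (sig : 'cV[K]_d -> X) (rho : G -> 'M[K]_d),
  [/\ jacobian orb z0 E, row_mx E B *m D' = 1%:M /\ D' *m row_mx E B = 1%:M,
      [/\ sig 0 = x, \forall w \near (0 : 'cV[K]_d), analytic_between (vec_atlas K d) AX sig w &
          jacobian (chart_map c \o sig) 0 B],
      rho 1%g = 1%:M /\ (forall g h, g \in s -> h \in s -> rho (g * h)%g = rho g *m rho h) &
      forall g, g \in s -> \forall w \near (0 : 'cV[K]_d), sig (rho g *m w) = a g (sig w)].
Proof.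
have [E EJ] := analytic_jacobian K_complete orb_analytic.
have [L LE] := orbit_jacobian_injective K_complete K_arch G_lie X_manifold a_analytic
  a_stab Ac xc AcG G1 EJ.
have [A [HA A1 AM]] := isotropy_representation.
have [P [B [Q [_ inv1 inv2 QB AB]]]] := equivariant_complement s_uniq s1 sM sV A1 AM LE
  (isotropy_orbit HA EJ).
have [xi [xiA xi0 xiJ xiE]] := linearizing_coordinates HA A1 AM.
have [||U [V [eta [[oU Ux] [oV Vx] UV VU [_ etaA]]]]] :=
  inverse_function (D' := 1%:M) K_complete xiA xiJ; rewrite ?mulmx1 //.
rewrite xi0 in Vx.
have eta0 : eta 0 = x0 by rewrite -xi0; have [] := UV _ Ux.
pose rho g := Q *m A g *m B.
pose sig w := chart_inv c (eta (B *m w)).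
have near_V : \forall w \near (0 : 'cV[K]_d), V (B *m w).
  have cB := analytic_continuous K_complete (analytic_linear K_complete B 0).
  by apply: cB; rewrite mulmx0; exact: open_nbhs_nbhs.
have near_eta (R : set 'cV[K]_n) : nbhs x0 R ->
    \forall w \near (0 : 'cV[K]_d), R (eta (B *m w)).
  move=> x0R; have etaA0 : analytic_at eta (B *m 0) by rewrite mulmx0; exact: etaA.
  have ct := analytic_continuous K_complete
    (analytic_comp K_complete (analytic_linear K_complete B 0) etaA0).
  by apply: ct; rewrite /= mulmx0 eta0.
have near_cod : \forall w \near (0 : 'cV[K]_d), chart_cod c (eta (B *m w)).
  by apply: near_eta; apply: chart_cod_nbhs => //; exact: chart_map_cod.
have etaJ : jacobian eta 0 1%:M.
  have [De etaJ] := analytic_jacobian K_complete (etaA _ Vx).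
  suff <- : De = 1%:M by [].
  rewrite -[De]mul1mx; apply: (jacobian_unique _ (jacobian_id 0)).
  apply: jacobian_ext (jacobian_comp etaJ (_ : jacobian xi (eta 0) 1%:M)); last by rewrite eta0.
  by apply: nbhs_weaken (open_nbhs_nbhs (conj oV Vx)) => y /VU[].
exists E, B, (col_mx P Q), sig, rho; split=> //.
- split; first by rewrite /sig mulmx0 eta0.
    apply: nbhs_weaken (nbhs_and near_V near_cod) => w [Vw cw].
    have h1 : analytic_between (vec_atlas K d) (vec_atlas K n) (eta \o mulmx B) w.
      apply/(analytic_between_vec K_complete).
      exact: (analytic_comp K_complete (analytic_linear K_complete B w) (etaA _ Vw)).
    exact: (analytic_between_comp K_complete (vec_atlas_atlas K d) (vec_atlas_atlas K n)
      h1 (analytic_between_chart_inv X_manifold Ac cw)).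
  apply: (@jacobian_ext _ _ _ (eta \o mulmx B)).
    by apply: nbhs_weaken near_cod => w cw; rewrite /sig /= (chart_invK Hc).
  rewrite -[B in jacobian _ _ B]mul1mx; apply: (jacobian_comp (jacobian_linear B 0)).
  by rewrite mulmx0.
- split; first by rewrite /rho A1 mulmx1.
  move=> g h gs hs; rewrite /rho AM //.
  rewrite (_ : Q *m (A g *m A h) *m B = Q *m A g *m (A h *m B)); last by rewrite !mulmxA.
  by rewrite (AB h hs) !mulmxA.
move=> g gs; have nU := xiE g gs.
have nloc : \forall v \near x0, U (loc g v).
  by apply: loc_continuous => //; rewrite locx0 //; exact: open_nbhs_nbhs.
have := near_eta _ (nbhs_and (near_loc gs) (nbhs_and nU nloc)).
move=> /(nbhs_and near_V); apply: nbhs_weaken => w [Vw [[vc vd] [xiv Uv]]].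
have [_ xieta] := VU _ Vw; have [_ etaxi] := UV _ Uv.
rewrite /sig /rho mulmxA -(AB g gs) -mulmxA -{1}xieta -xiv etaxi.
by rewrite /loc /= (chart_mapK Hc).
Qed.

(** In coordinates (k, w) |-> k (sig w) has the derivative row_mx E B, because it
    is the orbit map on the first factor and sig on the second. *)
Lemma local_tube (E : 'M[K]_(n, m)) (B : 'M[K]_(n, d)) (D' : 'M[K]_(m + d, n))
    (sig : 'cV[K]_d -> X) : jacobian orb z0 E ->
  row_mx E B *m D' = 1%:M -> D' *m row_mx E B = 1%:M -> sig 0 = x ->
  analytic_between (vec_atlas K d) AX sig 0 -> jacobian (chart_map c \o sig) 0 B ->
  exists (Om : set G) (O : set X) (elt : X -> G) (coord : X -> 'cV[K]_d),
  [/\ nbhs (1%g : G) Om, open O,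
      (forall y, O y -> {for y, continuous elt}) /\
      (forall y, O y -> analytic_between AX (vec_atlas K d) coord y),
      forall y, O y -> a (elt y) (sig (coord y)) = y &
      \forall w \near (0 : 'cV[K]_d), forall k, Om k ->
        [/\ O (a k (sig w)), elt (a k (sig w)) = k & coord (a k (sig w)) = w]].
Proof.
move=> EJ inv1 inv2 sig0 sigA sigJ.
pose pu : 'M[K]_(m, m + d) := row_mx 1%:M 0; pose pd : 'M[K]_(d, m + d) := row_mx 0 1%:M.
have puE u w : pu *m col_mx u w = u by rewrite mul_row_col mul1mx mul0mx addr0.
have pdE u w : pd *m col_mx u w = w by rewrite mul_row_col mul1mx mul0mx add0r.
pose Th q := chart_map c (a (chart_inv cG (pu *m q)) (sig (pd *m q))).
pose q0 : 'cV[K]_(m + d) := col_mx z0 0.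
have gA : analytic_between (vec_atlas K (m + d)) AG (fun q => chart_inv cG (pu *m q)) q0.
  have h1 : analytic_between (vec_atlas K (m + d)) (vec_atlas K m) (mulmx pu) q0.
    by apply/(analytic_between_vec K_complete); exact: analytic_linear.
  apply: (analytic_between_comp K_complete (vec_atlas_atlas K _) (vec_atlas_atlas K _) h1).
  apply: (analytic_between_chart_inv G_manifold AcG).
  by rewrite puE; exact: chart_map_cod.
have wA : analytic_between (vec_atlas K (m + d)) AX (fun q => sig (pd *m q)) q0.
  have h1 : analytic_between (vec_atlas K (m + d)) (vec_atlas K d) (mulmx pd) q0.
    by apply/(analytic_between_vec K_complete); exact: analytic_linear.
  apply: (analytic_between_comp K_complete (vec_atlas_atlas K _) (vec_atlas_atlas K _) h1).
  by rewrite pdE.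
have FA : analytic_between (vec_atlas K (m + d)) AX
    (fun q => a (chart_inv cG (pu *m q)) (sig (pd *m q))) q0.
  have h1 := analytic_between_pair gA wA.
  exact: (analytic_between_comp K_complete (vec_atlas_atlas K _)
    (prod_atlas_atlas AG_atlas AX_atlas) h1 (act_analytic a_analytic _ _)).
have F0 : a (chart_inv cG (pu *m q0)) (sig (pd *m q0)) = x.
  by rewrite puE pdE z0K sig0 act1.
have ThA : analytic_at Th q0.
  apply/(analytic_between_vec K_complete).
  apply: (analytic_between_comp K_complete (vec_atlas_atlas K _) AX_atlas FA).
  by apply: (analytic_between_chart_map X_manifold Ac); rewrite F0.
have Th0 : Th q0 = x0 by rewrite /Th F0.
have ThJ : jacobian Th q0 (row_mx E B).
  have [D DJ] := analytic_jacobian K_complete ThA.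
  suff <- : D = row_mx E B by [].
  have DE : D *m col_mx 1%:M 0 = E.
    apply: (jacobian_unique _ EJ).
    have i0 : col_mx 1%:M 0 *m z0 = q0 by rewrite mul_col_mx mul1mx mul0mx.
    apply: (@jacobian_eq _ _ _ (Th \o mulmx (col_mx 1%:M 0))).
      by move=> z; rewrite /Th /= mul_col_mx mul1mx mul0mx puE pdE sig0.
    by apply: (jacobian_comp (jacobian_linear _ z0)); rewrite i0.
  have DB : D *m col_mx 0 1%:M = B.
    apply: (jacobian_unique _ sigJ).
    have i0 : col_mx 0 1%:M *m 0 + q0 = q0 by rewrite mulmx0 add0r.
    apply: (@jacobian_eq _ _ _ (Th \o (fun w => col_mx 0 1%:M *m w + q0))).
      move=> w; rewrite /Th /= mul_col_mx mul1mx mul0mx /q0 add_col_mx add0r addr0.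
      by rewrite puE pdE z0K act1.
    by apply: (jacobian_comp (jacobian_affine _ _ 0)); rewrite i0.
  by rewrite -[D]mulmx1 scalar_mx_block block_mxEh mul_mx_row DE DB.
have [U [V [g [[oU Uq] [oV Vq] UV VU [_ VA]]]]] := inverse_function K_complete ThA ThJ inv1 inv2.
(* where the local inverse g of Th can be read in the charts cG and c *)
pose good q := [/\ U q, chart_cod cG (pu *m q) &
  chart_dom c (a (chart_inv cG (pu *m q)) (sig (pd *m q)))].
pose R := interior good.
have oR : open R by exact: open_interior.
have Rgood q : R q -> good q by move/interior_subset.
have Rq0 : nbhs q0 good.
  have n1 : nbhs q0 U by exact: open_nbhs_nbhs.
  have n2 : nbhs q0 [set q | chart_cod cG (pu *m q)].
    apply: (analytic_continuous K_complete (analytic_linear K_complete pu q0)).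
    by rewrite puE; apply: chart_cod_nbhs => //; exact: chart_map_cod.
  have n3 : nbhs q0 [set q | chart_dom c (a (chart_inv cG (pu *m q)) (sig (pd *m q)))].
    by apply: FA.1; rewrite F0; exact: chart_dom_nbhs.
  by apply: nbhs_weaken (nbhs_and n1 (nbhs_and n2 n3)) => q [? []].
have [e e0 He] := (nbhs_boxP q0 R).1 (nbhs_interior Rq0).
have Hbox k w : in_box e (chart_map cG k - z0) -> in_box e w -> R (col_mx (chart_map cG k) w).
  move=> kz wz; apply: He => i; rewrite opp_col_mx add_col_mx subr0.
  case: (splitP i) => j ij.
    by rewrite (_ : i = lshift d j) ?col_mxEu; [exact: kz|exact: val_inj].
  by rewrite (_ : i = rshift m j) ?col_mxEd; [exact: wz|exact: val_inj].
pose V' := [set v | V v /\ R (g v)].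
pose O := [set y | chart_dom c y /\ V' (chart_map c y)].
have gcont v : V v -> {for v, continuous g}.
  by move=> /VA; exact: analytic_continuous.
pose Om := [set k | chart_dom cG k /\ in_box e (chart_map cG k - z0)].
exists Om, O, (fun y => chart_inv cG (pu *m g (chart_map c y))),
  (fun y => pd *m g (chart_map c y)); split.
- apply: nbhs_and; first exact: chart_dom_nbhs.
  have nz : nbhs z0 [set v | in_box e (v - z0)] by apply/nbhs_boxP; exists e.
  exact: (chart_map_continuous HcG G1 nz).
- apply: open_inter_preimage; first exact: chart_dom_open.
    by apply: open_inter_preimage.
  by move=> y; exact: chart_map_continuous.
- split=> y [yc [Vy Ry]].
    have [Uy cy dy] := Rgood _ Ry.
    have c1 := chart_map_continuous Hc yc; have c2 := gcont _ Vy.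
    have c3 := analytic_continuous K_complete (analytic_linear K_complete pu (g (chart_map c y))).
    have c4 := chart_inv_continuous HcG cy.
    exact: continuous_comp (continuous_comp (continuous_comp c1 c2) c3) c4.
  have h : analytic_between (vec_atlas K n) (vec_atlas K d) (mulmx pd \o g) (chart_map c y).
    apply/(analytic_between_vec K_complete).
    exact: (analytic_comp K_complete (VA _ Vy) (analytic_linear K_complete pd _)).
  exact: (analytic_between_comp K_complete AX_atlas (vec_atlas_atlas K n)
    (analytic_between_chart_map X_manifold Ac yc) h).
- move=> y [yc [Vy Ry]]; have [Uy cy dy] := Rgood _ Ry.
  have [_ Thg] := VU _ Vy.
  by have := congr1 (chart_inv c) Thg; rewrite /Th !(chart_mapK Hc).
have : \forall w \near (0 : 'cV[K]_d), in_box e w.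
  by apply/nbhs_boxP; exists e => // w; rewrite subr0.
apply: nbhs_weaken => w we k [kc ke].
have Rq := Hbox k w ke we; have [Uq' cq dq] := Rgood _ Rq.
have [VTh gTh] := UV _ Uq'.
have E1 : Th (col_mx (chart_map cG k) w) = chart_map c (a k (sig w)).
  by rewrite /Th puE pdE (chart_mapK HcG).
rewrite puE pdE (chart_mapK HcG kc) in dq.
rewrite E1 in VTh gTh; split.
- by split=> //; split=> //; rewrite /= gTh.
- by rewrite gTh puE (chart_mapK HcG).
- by rewrite gTh pdE.
Qed.

(** The properties of the tube hold near 0; intersecting the translates of such a
    neighbourhood by the finite stabilizer makes it invariant.  If g maps a point
    of the section to another, then g = gam k with gam in G_x and k near 1 by
    [proper_shift], and k = 1 since the tube determines k. *)
Lemma slice_exists_in_charts : exists S : slice d AX a, slice_base S = x.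
Proof.
have [E [B [D' [sig [rho [EJ [inv1 inv2] [sig0 sigA sigJ] [rho1 rhoM] rhoE]]]]]] := linear_slice.
have [Om [Tb [elt [coord [Om1 oO [eltC coordA] OP OmP]]]]] :=
  local_tube EJ inv1 inv2 sig0 (nbhs_singleton sigA) sigJ.
have [M Mx HM] := proper_shift K_complete G_lie X_manifold a_analytic a_proper x Om1.
pose good w := [/\ analytic_between (vec_atlas K d) AX sig w,
  forall g, g \in s -> sig (rho g *m w) = a g (sig w),
  forall k, Om k -> [/\ Tb (a k (sig w)), elt (a k (sig w)) = k & coord (a k (sig w)) = w] &
  M (sig w)].
have good0 : nbhs (0 : 'cV[K]_d) good.
  have nM : nbhs (0 : 'cV[K]_d) (sig @^-1` M).
    by apply: (nbhs_singleton sigA).1; rewrite sig0.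
  have nE : nbhs (0 : 'cV[K]_d) (fun w => forall g, g \in s -> sig (rho g *m w) = a g (sig w)).
    exact: nbhs_all.
  by apply: nbhs_weaken (nbhs_and sigA (nbhs_and nE (nbhs_and OmP nM))) => w [? [? [? ?]]]; split.
pose W w := forall g, g \in s -> interior good (rho g *m w).
have Wgood w : W w -> good w.
  by move=> /(_ _ s1); rewrite rho1 mul1mx => /interior_subset.
have Wrho g w : g \in s -> W w -> W (rho g *m w).
  by move=> gs Ww h hs; rewrite mulmxA -rhoM //; apply: Ww; exact: sM.
have oW : open W.
  rewrite openE => w Ww; apply: nbhs_all => g gs.
  apply: (analytic_continuous K_complete (analytic_linear K_complete (rho g) w)).
  by apply: open_nbhs_nbhs; split; [exact: open_interior|exact: Ww].
have W0 : W 0 by move=> g gs; rewrite mulmx0; exact: good0.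
have Wstab g w w' : W w -> W w' -> a g (sig w) = sig w' -> a g x = x.
  move=> Ww Ww' gw; have [_ _ wOm Mw] := Wgood w Ww; have [_ w2E _ Mw'] := Wgood w' Ww'.
  have [gam [k [gx Ok gE]]] := HM g _ _ Mw Mw' gw.
  have gs : gam^-1%g \in s by apply: sV; exact/sP.
  have [_ _ w2Om _] := Wgood _ (Wrho _ _ gs Ww').
  have kw : a k (sig w) = a 1%g (sig (rho gam^-1%g *m w')).
    by rewrite act1 w2E // -gw gE actM act_inv.
  have [_ k1 _] := wOm k Ok; have [_ e1 _] := w2Om 1%g (nbhs_singleton Om1).
  by rewrite gE -k1 kw e1 mulg1.
pose S := @Slice K n d G X AX a x W sig rho Om Tb elt coord oW W0 sig0.
have h1 w : W w -> analytic_between (vec_atlas K d) AX sig w by move=> /Wgood[].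
have h2 g h : a g x = x -> a h x = x -> rho (g * h)%g = rho g *m rho h.
  by move=> gx hx; apply: rhoM; exact/sP.
have h3 g w : a g x = x -> W w -> W (rho g *m w) by move=> gx; apply: Wrho; exact/sP.
have h4 g w : a g x = x -> W w -> sig (rho g *m w) = a g (sig w).
  by move=> gx /Wgood[_ H _ _]; apply: H; exact/sP.
have h5 k w : Om k -> W w ->
  [/\ Tb (a k (sig w)), elt (a k (sig w)) = k & coord (a k (sig w)) = w].
  by move=> Ok /Wgood[_ _ H _]; exact: H.
by exists (S h1 rho1 h2 h3 h4 Om1 oO eltC coordA OP h5 Wstab).
Qed.

End SliceTheorem.

Theorem slice_exists (K : numFieldType) (m n : nat) (G : GroupWithTopology.type)
    (AG : set (chart K m G)) (X : topologicalType) (AX : set (chart K n X))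
    (a : left_action G X) :
  summation_complete K -> archimedean_norm K -> is_lie_group AG -> is_manifold AX ->
  analytic_action AG AX a -> finite_stabilizers a -> locally_proper a ->
  forall x, exists S : slice (n - m) AX a, slice_base S = x.
Proof.
move=> K_complete K_arch G_lie X_man a_an a_stab a_prop x.
have [s [s_uniq sP]] := stabilizer_seq a_stab x.
have [c Ac xc] := (manifold_atlas X_man).2 x.
have G_man : is_manifold AG by case: G_lie.
have [cG AcG G1] := (manifold_atlas G_man).2 (1%g : G).
exact: (slice_exists_in_charts K_complete K_arch G_lie X_man a_an a_stab a_prop Ac xc AcG G1
  s_uniq sP).
Qed.

(** * Orbifold charts from slices *)

Section OrbitSpace.
Variables (G : groupType) (X : topologicalType) (a : left_action G X).

Definition orbit_of (x : X) : orbit_space a := \pi_(orbit_space a)%qT x.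

Lemma orbit_ofP x y : orbit_of x = orbit_of y <-> exists g, a g x = y.
Proof.
have E : (\pi_({eq_quot (same_orbit a)})%qT x = \pi_({eq_quot (same_orbit a)})%qT y) <->
    same_orbit a x y.
  by split=> [/eqmodP|/eqmodP].
split=> [H|H]; first exact/asboolP/E.
by apply/E/asboolP.
Qed.

Lemma orbit_of_surj u : exists x, orbit_of x = u.
Proof. by exists (repr u); rewrite /orbit_of reprK. Qed.

Lemma orbit_openE (B : set (orbit_space a)) : open B = open (orbit_of @^-1` B).
Proof. by []. Qed.

End OrbitSpace.

Section SliceCharts.
Variables (K : numFieldType) (n d : nat) (G : GroupWithTopology.type)
  (X : topologicalType) (AX : set (chart K n X)) (a : left_action G X).
Hypothesis K_complete : summation_complete K.
Hypothesis AX_atlas : is_atlas AX.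
Hypothesis act_an : forall g y, analytic_between AX AX (a g) y.
Hypothesis a_stab : finite_stabilizers a.
Hypothesis conj_cont : forall h g : G, {for g, continuous (fun k => h * k * h^-1)%g}.
Hypothesis inv_cont : forall g : G, {for g, continuous (fun k => k^-1)%g}.
Implicit Types S : slice d AX a.

Let act_continuous g y : {for y, continuous (a g)}. Proof. exact: (act_an g y).1. Qed.

(** The chart group is the image of the stabilizer, on which [slice_rep] need not
    be injective. *)
Definition slice_chart S : orb_chart K d (orbit_space a) :=
  OrbChart [set h | exists2 g, a g (slice_base S) = slice_base S & slice_rep S g = h]
    (slice_dom S) (fun w => orbit_of a (slice_map S w)).

Let slice_map_continuous S w : slice_dom S w -> {for w, continuous (slice_map S)}.
Proof. by move=> /slice_map_analytic[]. Qed.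

Lemma stab_inv x g : a g x = x -> a g^-1%g x = x.
Proof. by move=> gx; rewrite -{1}gx act_inv. Qed.

(** The preimage in X of the image of A is the union of the translates of the open
    set of tube points with coordinate in A. *)
Lemma slice_chart_image_open S A : open A -> A `<=` slice_dom S ->
  open (orb_proj (slice_chart S) @` A).
Proof.
move=> oA Adom; rewrite orbit_openE.
pose T := [set y | slice_tube S y /\ A (slice_coord S y)].
have oT : open T.
  apply: open_inter_preimage => //; first exact: slice_tube_open.
  by move=> y /slice_coord_analytic[].
rewrite openE => y [w Aw /orbit_ofP[g gw]].
have [ty ey cy] := slice_shiftP (nbhs_singleton (slice_shift_nbhs S)) (Adom _ Aw).
rewrite act1 in ty ey cy.
have Ty : nbhs (a g^-1%g y) T.
  by apply: open_nbhs_nbhs; split=> //; rewrite -gw act_inv; split=> //; rewrite cy.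
have {}Ty : nbhs y (a g^-1%g @^-1` T) := act_continuous Ty.
apply: nbhs_weaken Ty => z [tz Az].
exists (slice_coord S (a g^-1%g z)) => //.
apply/orbit_ofP; exists (g * slice_elt S (a g^-1%g z))%g.
by rewrite actM (slice_tubeP tz) -actM mulgV act1.
Qed.

Lemma slice_chart_preimage_open S B : open B ->
  open (slice_dom S `&` orb_proj (slice_chart S) @^-1` B).
Proof.
rewrite orbit_openE => oB.
exact: (open_inter_preimage (slice_dom_open (s := S)) oB (@slice_map_continuous S)).
Qed.

Lemma slice_chart_fibre S w w' : slice_dom S w -> slice_dom S w' ->
  (orb_proj (slice_chart S) w = orb_proj (slice_chart S) w' <->
   exists2 h, orb_group (slice_chart S) h & h *m w = w').
Proof.
move=> dw dw'; split=> [/orbit_ofP[g gw]|[_ [g gx <-] <-]]; last first.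
  by apply/orbit_ofP; exists g; rewrite slice_map_rep.
have gx := slice_stab dw dw' gw.
exists (slice_rep S g); first by exists g.
have dgw := slice_rep_dom gx dw.
have [_ _ E1] := slice_shiftP (nbhs_singleton (slice_shift_nbhs S)) dgw.
have [_ _ E2] := slice_shiftP (nbhs_singleton (slice_shift_nbhs S)) dw'.
by rewrite -E1 slice_map_rep // gw E2.
Qed.

Lemma slice_group_finite S : finite_set (orb_group (slice_chart S)).
Proof.
have -> : orb_group (slice_chart S) =
    slice_rep S @` [set g | a g (slice_base S) = slice_base S].
  by [].
exact: finite_image.
Qed.

Lemma slice_chart_orb_chart S : is_orb_chart (slice_chart S).
Proof.
have repV g : a g (slice_base S) = slice_base S ->
    slice_rep S g *m slice_rep S g^-1%g = 1%:M.
  by move=> gx; rewrite -slice_repM ?stab_inv // mulgV slice_rep1.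
split.
- split; first exact: slice_group_finite.
  + by move=> _ [g gx <-]; exact: (mulmx1_unit (repV g gx)).1.
  + by exists 1%g; rewrite ?act1 ?slice_rep1.
  + move=> _ _ [g gx <-] [h hx <-]; exists (g * h)%g; last by rewrite slice_repM.
    by rewrite actM hx gx.
  + move=> _ [g gx <-]; exists g^-1%g; first exact: stab_inv.
    have U := (mulmx1_unit (repV g gx)).1.
    by rewrite -[LHS](mulKmx U) repV // mulmx1.
- split; [exact: slice_dom_open|exact: slice_dom0|].
  by move=> _ w [g gx <-]; exact: slice_rep_dom.
- by apply: slice_chart_image_open => //; exact: slice_dom_open.
- by move=> w w'; exact: slice_chart_fibre.
- move=> B BW; split=> [|oB]; first exact: slice_chart_preimage_open.
  rewrite (_ : B = orb_proj (slice_chart S) @` (slice_dom S `&` orb_proj (slice_chart S) @^-1` B)).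
    by apply: slice_chart_image_open => // w [].
  apply/seteqP; split=> [u Bu|_ [w [_ Bw] <-]//].
  by have [w dw wu] := BW u Bu; rewrite -wu in Bu; exists w.
Qed.

(** Finitely many matrices that move w1 move a neighbourhood of w1 off itself; this
    is the disjointness required of a restriction. *)
Lemma separation_near (w1 : 'cV[K]_d) (l : seq 'M[K]_d) : exists2 N, nbhs w1 N &
  forall h, h \in l -> h *m w1 <> w1 -> forall w w', N w -> N w' -> h *m w <> w'.
Proof.
elim: l => [|h l [N nN HN]]; first by exists setT => //; exact: filterT.
have [hw|hw] := eqVneq (h *m w1) w1.
  exists N => // h'; rewrite inE => /orP[/eqP ->|/HN//].
  by move=> /(_ hw).
have [i hi] : exists i, (h *m w1 - w1) i 0 != 0.
  apply/existsP; apply: contraNT hw; rewrite negb_exists => /forallP H.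
  rewrite -subr_eq0; apply/eqP/matrixP => i j; rewrite ord1 [RHS]mxE.
  by apply/eqP; have := H i; rewrite negbK.
have e0 : 0 < `|(h *m w1 - w1) i 0| / 2 by rewrite divr_gt0 // normr_gt0.
have /continuous_boxP/(_ _ e0)[r r0 Hr] :=
  analytic_continuous K_complete (analytic_linear K_complete h w1).
exists (N `&` ([set w | in_box r (w - w1)] `&`
    [set w | in_box (`|(h *m w1 - w1) i 0| / 2) (w - w1)])).
  apply: nbhs_and => //; apply: nbhs_and; first by apply/nbhs_boxP; exists r.
  by apply/nbhs_boxP; exists (`|(h *m w1 - w1) i 0| / 2).
move=> h'; rewrite inE => /orP[/eqP -> _|/HN H hw1]; last first.
  by move=> w w' [Nw _] [Nw' _]; exact: H.
move=> w w' [_ [/Hr rw _]] [_ [_ ew]] E.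
have vE : (w' - w1) - (h *m w - h *m w1) = h *m w1 - w1.
  by rewrite E opprB [LHS]addrC addrA subrK.
have : `|(h *m w1 - w1) i 0| < `|(h *m w1 - w1) i 0|; last by rewrite ltxx.
rewrite [ltRHS]splitr -[in ltLHS]vE [in ltLHS]mxE [X in `|_ + X|]mxE.
by apply: le_lt_trans (ler_normB _ _) (ltrD (ew i) (rw i)).
Qed.

(** Move a point of the first section by g, then push it along its orbit into the
    second section. *)
Definition slice_transition S1 S2 (g : G) (w : 'cV[K]_d) : 'cV[K]_d :=
  slice_coord S2 (a g (slice_map S1 w)).

(** All that is needed of the transition near w1.  The isotropy element gam of
    the first chart corresponds to g gam g^-1 in the second. *)
Definition good_transition S1 S2 (g : G) (w1 w : 'cV[K]_d) : Prop :=
  [/\ slice_dom S1 w /\ slice_dom S2 (slice_transition S1 S2 g w),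
      analytic_at (slice_transition S1 S2 g) w,
      slice_transition S2 S1 g^-1%g (slice_transition S1 S2 g w) = w,
      orbit_of a (slice_map S2 (slice_transition S1 S2 g w)) = orbit_of a (slice_map S1 w) &
      forall gam, a gam (slice_base S1) = slice_base S1 ->
        a gam (slice_map S1 w1) = slice_map S1 w1 ->
        slice_transition S1 S2 g (slice_rep S1 gam *m w) =
        slice_rep S2 (g * gam * g^-1)%g *m slice_transition S1 S2 g w].

Section Transition.
Variables (S1 S2 : slice d AX a) (g : G) (w1 w2 : 'cV[K]_d).
Hypotheses (dw1 : slice_dom S1 w1) (dw2 : slice_dom S2 w2)
  (gw : a g (slice_map S1 w1) = slice_map S2 w2).

Lemma slice_coord_map S w : slice_dom S w ->
  [/\ slice_tube S (slice_map S w), slice_elt S (slice_map S w) = 1%g &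
      slice_coord S (slice_map S w) = w].
Proof.
by move=> /(slice_shiftP (nbhs_singleton (slice_shift_nbhs S))); rewrite act1.
Qed.

Lemma slice_transition_base : slice_transition S1 S2 g w1 = w2.
Proof. by rewrite /slice_transition gw; case: (slice_coord_map dw2). Qed.

Lemma conj_stab gam : a gam (slice_map S1 w1) = slice_map S1 w1 ->
  a (g * gam * g^-1)%g (slice_map S2 w2) = slice_map S2 w2.
Proof. by move=> E; rewrite -gw !actM act_inv E. Qed.

(** The element k = slice_elt S2 (g (slice_map S1 w)) that pushes the point into the
    second section tends to 1 as w tends to w1.  Hence so do its conjugates by g
    and by the isotropy elements, and uniqueness of the tube decomposition gives
    the inverse and the equivariance of the transition. *)
Lemma good_transition_near : \forall w \near w1, good_transition S1 S2 g w1 w.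
Proof.
have [tube2 elt2 coord2] := slice_coord_map dw2.
pose y w := a g (slice_map S1 w).
have yA w : slice_dom S1 w -> analytic_between (vec_atlas K d) AX y w.
  move=> dw; exact: (analytic_between_comp K_complete (vec_atlas_atlas K d) AX_atlas
    (slice_map_analytic dw) (act_an g _)).
have yw1 : y w1 = slice_map S2 w2 by [].
have tw1 : slice_tube S2 (y w1) by rewrite yw1.
have n1 : nbhs w1 (slice_dom S1) by apply: open_nbhs_nbhs; split=> //; exact: slice_dom_open.
have nT : nbhs w1 [set w | slice_tube S2 (y w)].
  apply: (yA _ dw1).1; rewrite yw1; apply: open_nbhs_nbhs; split=> //; exact: slice_tube_open.
have trA w : slice_dom S1 w -> slice_tube S2 (y w) -> analytic_at (slice_transition S1 S2 g) w.
  move=> dw tw; apply/(analytic_between_vec K_complete).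
  exact: (analytic_between_comp K_complete (vec_atlas_atlas K d) AX_atlas
    (yA _ dw) (slice_coord_analytic tw)).
have n2 : nbhs w1 [set w | slice_dom S2 (slice_transition S1 S2 g w)].
  have ct := analytic_continuous K_complete (trA w1 dw1 tw1).
  have nd : nbhs (slice_transition S1 S2 g w1) (slice_dom S2).
    by rewrite slice_transition_base; apply: open_nbhs_nbhs; split=> //; exact: slice_dom_open.
  exact: ct _ nd.
(* properties of k near 1 hold for the k of all w near w1 *)
have nE R : nbhs (1%g : G) R -> nbhs w1 [set w | R (slice_elt S2 (y w))].
  move=> R1; have ct := continuous_comp (yA _ dw1).1 (slice_elt_continuous tw1).
  have {}R1 : nbhs (slice_elt S2 (y w1)) R by rewrite yw1 elt2.
  exact: ct _ R1.
have nconj h (R : set G) : nbhs (1%g : G) R -> nbhs (1%g : G) [set k | R (h * k * h^-1)%g].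
  move=> R1; have R1' : nbhs (h * 1 * h^-1)%g R by rewrite mulg1 mulgV.
  exact: (@conj_cont h 1%g) R1'.
have ninv (R : set G) : nbhs (1%g : G) R -> nbhs (1%g : G) [set k | R k^-1%g].
  move=> R1; have R1' : nbhs (1^-1)%g R by rewrite invg1.
  exact: (@inv_cont 1%g) R1'.
have n3 : nbhs w1 [set w | slice_shift S1 (g^-1 * (slice_elt S2 (y w))^-1 * g^-1^-1)%g].
  by apply: (nE [set k | slice_shift S1 (g^-1 * k^-1 * g^-1^-1)%g]);
     apply: (ninv [set k | slice_shift S1 (g^-1 * k * g^-1^-1)%g]); apply: nconj;
     exact: slice_shift_nbhs.
have [l [_ lP]] := stabilizer_seq a_stab (slice_base S1).
have n4 : nbhs w1 (fun w => forall gam, gam \in l -> slice_shift S2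
    ((g * gam * g^-1) * slice_elt S2 (y w) * (g * gam * g^-1)^-1)%g).
  apply: nbhs_all => gam _.
  apply: (nE [set k | slice_shift S2 ((g * gam * g^-1) * k * (g * gam * g^-1)^-1)%g]).
  by apply: nconj; exact: slice_shift_nbhs.
apply: nbhs_weaken (nbhs_and (nbhs_and n1 n2) (nbhs_and nT (nbhs_and n3 n4))).
move=> w [[dw dtw] [tw [sh1 sh2]]].
have yE : a (slice_elt S2 (y w)) (slice_map S2 (slice_transition S1 S2 g w)) = y w.
  exact: slice_tubeP.
split=> //.
- exact: trA.
- have [_ _ E] := slice_shiftP sh1 dw; rewrite -[RHS]E.
  rewrite /slice_transition invgK !actM; congr (slice_coord S1 (a _ _)).
  by rewrite -[LHS](act_inv a (slice_elt S2 (y w))) [a (slice_elt _ _) _]yE.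
- apply/orbit_ofP; exists (g^-1 * slice_elt S2 (y w))%g.
  by rewrite actM yE act_inv.
- move=> gam gx gw1; have gx2 : a (g * gam * g^-1)%g (slice_base S2) = slice_base S2.
    exact: slice_stab dw2 dw2 (conj_stab gw1).
  have := sh2 gam ((lP gam).2 gx) => sh.
  have [_ _ <-] := slice_shiftP sh (slice_rep_dom gx2 dtw).
  rewrite /slice_transition slice_map_rep // slice_map_rep //; congr slice_coord.
  by rewrite [in RHS]actM act_inv actM yE /y !actM act_inv.
Qed.

(** Differentiating psi (h w) = h' (psi w) at the fixed point w1 of h gives
    h' = D h D^-1, which defines the isomorphism without choices, although h does
    not determine gam. *)
Lemma transition_conj_stab (D D' : 'M[K]_d) : jacobian (slice_transition S1 S2 g) w1 D ->
  D *m D' = 1%:M ->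
  forall h, orb_stab (slice_chart S1) w1 h -> orb_stab (slice_chart S2) w2 (D *m h *m D') /\
    forall w, good_transition S1 S2 g w1 w ->
      slice_transition S1 S2 g (h *m w) = D *m h *m D' *m slice_transition S1 S2 g w.
Proof.
move=> DJ DD' _ [[gam gx <-] gw1].
have gm : a gam (slice_map S1 w1) = slice_map S1 w1 by rewrite -slice_map_rep // gw1.
have gx2 : a (g * gam * g^-1)%g (slice_base S2) = slice_base S2.
  exact: slice_stab dw2 dw2 (conj_stab gm).
have E : D *m slice_rep S1 gam = slice_rep S2 (g * gam * g^-1)%g *m D.
  apply: (@jacobian_unique _ _ _ (slice_transition S1 S2 g \o mulmx (slice_rep S1 gam)) w1).
    by apply: (jacobian_comp (jacobian_linear _ w1)); rewrite gw1.
  apply: jacobian_ext (jacobian_comp DJ (jacobian_linear _ _)).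
  by apply: nbhs_weaken good_transition_near => w [_ _ _ _ H]; rewrite /= H.
have E' : D *m slice_rep S1 gam *m D' = slice_rep S2 (g * gam * g^-1)%g.
  by rewrite E -mulmxA DD' mulmx1.
rewrite E'; split=> [|w [_ _ _ _ H]]; last exact: H.
split; first by exists (g * gam * g^-1)%g.
have [_ _ <-] := slice_coord_map (slice_rep_dom gx2 dw2).
rewrite slice_map_rep // conj_stab //.
by have [_ _ ->] := slice_coord_map dw2.
Qed.

End Transition.

(** Finite intersections of translates are invariant neighbourhoods. *)
Lemma stab_invariant_nbhd S w0 (P : set 'cV[K]_d) : slice_dom S w0 -> nbhs w0 P ->
  exists A, [/\ open A, A w0, A `<=` P &
    forall h w, orb_stab (slice_chart S) w0 h -> A w -> A (h *m w)].
Proof.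
move=> dw0 w0P; have [[/finite_seqP[l El] _ H1 HM _] _ _ _ _] := slice_chart_orb_chart S.
have lP h : h \in l <-> orb_group (slice_chart S) h by rewrite El.
exists (fun w => forall h, h \in l -> h *m w0 = w0 -> interior P (h *m w)); split.
- rewrite openE => w Aw; apply: nbhs_all => h hl.
  have [hw0|hw0] := eqVneq (h *m w0) w0; last first.
    by apply: filterE => v E; rewrite E eqxx in hw0.
  have Ph : nbhs (h *m w) (interior P).
    by apply: open_nbhs_nbhs; split; [exact: open_interior|exact: Aw].
  have {}Ph := analytic_continuous K_complete (analytic_linear K_complete h w) Ph.
  by apply: nbhs_weaken Ph => v Pv _.
- by move=> h _ ->.
- move=> w /(_ 1%:M ((lP _).2 H1) (mul1mx _)); rewrite mul1mx; exact: interior_subset.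
- move=> h w [hR hw0] Aw k kl kw0; rewrite mulmxA; apply: Aw.
    by apply/lP; apply: HM => //; exact/lP.
  by rewrite -mulmxA hw0.
Qed.

Lemma slice_chart_restriction S w0 (A B : set 'cV[K]_d) (N U' : set (orbit_space a)) :
  open B -> B w0 -> B `<=` slice_dom S ->
  (forall h w, orb_stab (slice_chart S) w0 h -> B w -> B (h *m w)) ->
  (forall h w w', orb_group (slice_chart S) h -> h *m w0 <> w0 -> B w -> B w' -> h *m w <> w') ->
  open U' -> U' (orb_proj (slice_chart S) w0) ->
  U' `<=` orb_proj (slice_chart S) @` B ->
  is_restriction (slice_chart S) w0 (B `&` orb_proj (slice_chart S) @^-1` U') U'.
Proof.
move=> oB Bw0 Bdom Binv Bsep oU' U'w0 U'B; split.
- split=> //; rewrite (_ : _ `&` _ = B `&` (slice_dom S `&` orb_proj (slice_chart S) @^-1` U')).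
    by apply: openI => //; exact: slice_chart_preimage_open.
  by apply/seteqP; split=> w; [move=> [Bw ?]; do !split => //; exact: Bdom|case=> ? []].
- by move=> w [/Bdom].
- move=> h w hs [Bw U'w]; split; first exact: Binv.
  case: hs => hR _.
  have [_ _ _ fib _] := slice_chart_orb_chart S.
  have hw : slice_dom S (h *m w) by case: hR => gam gx <-; exact: slice_rep_dom gx (Bdom _ Bw).
  suff E : orb_proj (slice_chart S) w = orb_proj (slice_chart S) (h *m w).
    by move: U'w; rewrite /preimage /mkset E.
  by apply/(fib _ _ (Bdom _ Bw) hw); exists h.
- move=> h hR hs; apply/seteqP; split=> // _ [[w [Bw _] <-] [Bhw _]].
  apply: (Bsep h w (h *m w) hR _ Bw Bhw) => // E; exact: hs.
- apply/seteqP; split=> [_ [w [_ ?] <-]//|u U'u].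
  by have [w Bw wu] := U'B u U'u; rewrite -wu in U'u; exists w.
Qed.

(** The transition and its inverse are bijections between the two sets B1 and B2
    of points that stay in the invariant neighbourhoods A1 and A2; smaller open
    sets U' of orbits are treated by restricting to preimages. *)
Lemma slice_charts_compatible S1 S2 : orb_compatible (slice_chart S1) (slice_chart S2).
Proof.
move=> w1 w2 dw1 dw2 /orbit_ofP[g gw].
have gw' : a g^-1%g (slice_map S2 w2) = slice_map S1 w1 by rewrite -gw act_inv.
pose psi := slice_transition S1 S2 g; pose psi' := slice_transition S2 S1 g^-1%g.
have psiw1 : psi w1 = w2 by exact: slice_transition_base.
have psiw2 : psi' w2 = w1 by exact: slice_transition_base.
have good1 := good_transition_near dw1 dw2 gw.
have good2 := good_transition_near dw2 dw1 gw'.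
have psiK w : good_transition S1 S2 g w1 w -> psi' (psi w) = w by case.
have psiK' w : good_transition S2 S1 g^-1%g w2 w -> psi (psi' w) = w.
  by case=> _ _ + _ _; rewrite invgK.
have [_ psiA1 _ _ _] := nbhs_singleton good1; have [_ psiA2 _ _ _] := nbhs_singleton good2.
have [D DJ] := analytic_jacobian K_complete psiA1.
have [D' D'J] := analytic_jacobian K_complete psiA2.
have D'D : D' *m D = 1%:M.
  apply: (jacobian_unique _ (jacobian_id w1)).
  have D'J1 : jacobian psi' (psi w1) D' by rewrite psiw1.
  by apply: jacobian_ext (jacobian_comp DJ D'J1); apply: nbhs_weaken good1.
have DD' : D *m D' = 1%:M by exact: mulmx1C.
have conj1 := transition_conj_stab dw1 dw2 gw DJ DD'.
have conj2 := transition_conj_stab dw2 dw1 gw' D'J D'D.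
have sep S (w : 'cV[K]_d) : exists2 N, nbhs w N & forall h v v', orb_group (slice_chart S) h ->
    h *m w <> w -> N v -> N v' -> h *m v <> v'.
  have /finite_seqP[l El] := slice_group_finite S.
  have [N nN HN] := separation_near w l; exists N => // h v v'.
  by rewrite El => hl hw; exact: HN hl hw v v'.
have [N1 nN1 sep1] := sep S1 w1; have [N2 nN2 sep2] := sep S2 w2.
have [A1 [oA1 A1w1 A1P A1inv]] := stab_invariant_nbhd dw1 (nbhs_and good1 nN1).
have [A2 [oA2 A2w2 A2P A2inv]] := stab_invariant_nbhd dw2 (nbhs_and good2 nN2).
pose B1 := [set w | A1 w /\ A2 (psi w)]; pose B2 := [set w | A2 w /\ A1 (psi' w)].
have oB1 : open B1.
  apply: open_inter_preimage => // w /A1P[[_ wA _ _ _] _].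
  exact: (analytic_continuous K_complete wA).
have oB2 : open B2.
  apply: open_inter_preimage => // w /A2P[[_ wA _ _ _] _].
  exact: (analytic_continuous K_complete wA).
have B1w1 : B1 w1 by split=> //; rewrite psiw1.
have B2w2 : B2 w2 by split=> //; rewrite psiw2.
have B12 w : B1 w -> B2 (psi w) /\ psi' (psi w) = w.
  by move=> [A1w A2w]; have [/psiK E _] := A1P w A1w; split=> //; split=> //; rewrite E.
have B21 w : B2 w -> B1 (psi' w) /\ psi (psi' w) = w.
  by move=> [A2w A1w]; have [/psiK' E _] := A2P w A2w; split=> //; split=> //; rewrite E.
have p12 w : B1 w -> orb_proj (slice_chart S2) (psi w) = orb_proj (slice_chart S1) w.
  by move=> [/A1P[[_ _ _ E _] _] _]; exact: E.
have B1dom : B1 `<=` slice_dom S1 by move=> w [/A1P[[[]]]].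
have B2dom : B2 `<=` slice_dom S2 by move=> w [/A2P[[[]]]].
exists (orb_proj (slice_chart S1) @` B1).
  apply: open_nbhs_nbhs; split; first exact: slice_chart_image_open.
  by exists w1.
move=> U' oU' U'w1 U'B1.
exists (B1 `&` orb_proj (slice_chart S1) @^-1` U').
exists (B2 `&` orb_proj (slice_chart S2) @^-1` U'); split.
- apply: slice_chart_restriction => //
    [h w hs [A1w A2w]|h w w' hR hw [/A1P[_ Nw] _] [/A1P[_ Nw'] _]].
    split; first exact: A1inv.
    have [hs2 hE] := conj1 h hs; have [gw1 _] := A1P w A1w.
    by rewrite /psi hE //; exact: A2inv.
  exact: sep1 hR hw Nw Nw'.
- apply: slice_chart_restriction => //
    [h w hs [A2w A1w]|h w w' hR hw [/A2P[_ Nw] _] [/A2P[_ Nw'] _]||u U'u].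
  + split; first exact: A2inv.
    have [hs2 hE] := conj2 h hs; have [gw1 _] := A2P w A2w.
    by rewrite /psi' hE //; exact: A1inv.
  + exact: sep2 hR hw Nw Nw'.
  + by rewrite -psiw1 p12.
  + by have [w B1w <-] := U'B1 u U'u; exists (psi w); [case: (B12 w B1w)|exact: p12].
exists (fun h => D *m h *m D'), psi, psi'; split.
- split; first split.
  + by move=> h /conj1[].
  + move=> h k _ _ /(congr1 (fun M => D' *m M *m D)).
    by rewrite !mulmxA D'D !mul1mx -!mulmxA D'D !mulmx1.
  + move=> h /conj2[hs _]; exists (D' *m h *m D) => //.
    by rewrite !mulmxA DD' mul1mx -mulmxA DD' mulmx1.
  + move=> h k _ _; rewrite -!mulmxA (mulmxA D' D) D'D mul1mx //.
- split=> w [Bw U'w].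
    have [B2w E] := B12 w Bw; split=> //; split=> //.
    by rewrite /preimage /mkset p12.
  have [B1w E] := B21 w Bw; split=> //; split=> //.
  by rewrite /preimage /mkset -p12 // E.
- by split=> w [[Aw _] _]; [have [[]] := A1P w Aw|have [[]] := A2P w Aw].
- move=> h w hs [[A1w _] _]; have [_ hE] := conj1 h hs; apply: hE.
  by have [] := A1P w A1w.
- by move=> w [Bw _]; exact: p12.
Qed.

End SliceCharts.

Theorem locally_proper_orbit_space_orbifold (K : numFieldType) (m n : nat)
    (G : GroupWithTopology.type) (AG : set (chart K m G)) (X : topologicalType)
    (AX : set (chart K n X)) (a : left_action G X) :
  summation_complete K -> archimedean_norm K -> is_lie_group AG -> is_manifold AX ->
  analytic_action AG AX a -> finite_stabilizers a -> locally_proper a ->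
  is_orbifold K (orbit_space a).
Proof.
move=> K_complete K_arch G_lie X_man a_an a_stab a_prop.
have S_ex := slice_exists K_complete K_arch G_lie X_man a_an a_stab a_prop.
have AX_atlas := manifold_atlas X_man.
have act_an := translate_analytic K_complete G_lie X_man a_an.
have conj_cont h g : {for g, continuous (fun k : G => h * k * h^-1)%g}.
  exact: (conj_analytic K_complete G_lie h g).1.
have inv_cont g : {for g, continuous (fun k : G => k^-1)%g}.
  by case: G_lie => _ _ [+ _]; apply.
pose A := [set c | exists S : slice (n - m) AX a, c = slice_chart S].
exists (n - m)%N, [set B | is_orb_atlas B /\ orb_atlas_equiv A B]; exists A => //; split.
- by move=> _ [S ->]; exact: slice_chart_orb_chart.
- move=> u; have [x <-] := orbit_of_surj u; have [S Sx] := S_ex x.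
  exists (slice_chart S); first by exists S.
  by exists 0; [exact: slice_dom0|rewrite /= slice_map0 Sx].
- by move=> _ _ [S1 ->] [S2 ->]; exact: slice_charts_compatible.
Qed.

Lemma summation_complete_ground (R : realType) (k : ground) :
  summation_complete (ground_field R k).
Proof. by case: k; [exact: summation_complete_real|exact: summation_complete_complex]. Qed.

Lemma archimedean_ground (R : realType) (k : ground) : archimedean_norm (ground_field R k).
Proof. by case: k; [exact: archimedean_real|exact: archimedean_complex]. Qed.

Theorem corollary2p25 (R : realType) (k : ground) (m n : nat)
    (G : GroupWithTopology.type) (AG : set (chart (ground_field R k) m G))
    (X : topologicalType) (AX : set (chart (ground_field R k) n X))
    (a : left_action G X)
    (G_lie : is_lie_group AG)
    (X_manifold : is_manifold AX)
    (a_analytic : analytic_action AG AX a)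
    (a_effective : effective a)
    (a_proper : locally_proper a)
    (a_stab : finite_stabilizers a) :
  is_orbifold (ground_field R k) (orbit_space a).
Proof.
exact: (locally_proper_orbit_space_orbifold (@summation_complete_ground R k)
  (@archimedean_ground R k) G_lie X_manifold a_analytic a_stab a_proper).
Qed.
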